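(* Let $(A,G,\rho,\sigma)$ be a twisted dynamical system with $A$ a unital $C^*$-algebra and $G$ a discrete group, let $(\mathcal{A},H,D,\pi)$ be an odd $G$-equivariant spectral triple on $A$ with $\pi$ faithful and with twisted covariant representation $(\pi,U)$ on $H$, the twisted action being smooth, and let $\ell:G\to\mathbb{B}_h(V)$ be a proper translation bounded function with $V$ a finite dimensional Hilbert space. Then the spectral triple $(C_c(G,\mathcal{A}),\widetilde H,\widetilde D,\hat\pi\times\hat L)$ on $A\rtimes_r^{\rho,\sigma}G$ resulting from the equivariant construction is the restriction, via $\psi_A:A\rtimes_r^{\rho,\sigma}G\to B\otimes C^*_r(G)$, of the exterior product of the spectral triples $(\mathcal{B},H,D)$ and $(C_c(G),\ell^2(G)\otimes V,M_\ell,\lambda)$.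
   Context: All Hilbert spaces and $C^*$-algebras are separable; all algebras are complex and unital. Twisted dynamical system: $\rho:G\to\mathrm{Aut}(A)$, $\sigma:G\times G\to U(A)$ with $\rho_x(\sigma_{y,z})=\sigma_{x,y}\sigma_{xy,z}\sigma_{x,yz}^*$, $\rho_x\rho_y=\mathrm{Ad}(\sigma_{x,y})\rho_{xy}$, $\sigma_{x,e}=\sigma_{e,x}=1$, $\rho_e=\mathrm{id}_A$. Smooth means $\rho_x\in\mathrm{Aut}(\mathcal{A})$ and $\sigma_{x,y}\in U(\mathcal{A})$. A twisted covariant representation $(\pi,U)$ on $H$: a non-degenerate representation $\pi:A\to\mathbb{B}(H)$ and $U:G\to U(H)$ with $U_xU_y=\pi(\sigma_{x,y})U_{xy}$, $\pi\circ\rho_x=\mathrm{Ad}(U_x)\circ\pi$. The $*$-algebra $C_c(G,A)$ has $(a\delta_x)\star(b\delta_y)=a\rho_x(b)\sigma_{x,y}\delta_{xy}$, $(a\delta_x)^*=\sigma_{x^{-1},x}^*\rho_{x^{-1}}(a^* )\delta_{x^{-1}}$. $A\rtimes^{\rho,\sigma}G$ is the universal (full) twisted crossed product, the enveloping $C^*$-algebra; $\pi\times U$ is the integrated form, $(\pi\times U)(a\delta_g)=\pi(a)U_g$. $A\rtimes_r^{\rho,\sigma}G$ is the image of $A\rtimes^{\rho,\sigma}G$ under the left regular representation $a\delta_x:\xi\otimes\delta_y\mapsto\pi(\rho_{y^{-1}x^{-1}}(a)\sigma_{y^{-1}x^{-1},x})\xi\otimes\delta_{xy}$ on $H\otimes\ell^2(G)$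 for a faithful $\pi$. Odd spectral triple $(\mathcal{A},H,D,\pi)$: dense $*$-subalgebra $\mathcal{A}\subseteq A$, representation $\pi$ of $A$ on $H$, self-adjoint $D$ with $(1+D^2)^{-1/2}$ compact, $\pi(a)\mathrm{Dom}(D)\subseteq\mathrm{Dom}(D)$ and $[D,\pi(a)]$ bounded for $a\in\mathcal{A}$. It is $G$-equivariant if there is $U:G\to U(H)$ with $(\pi,U)$ twisted covariant, each $U_g$ leaving $\mathrm{Dom}(D)$ invariant and $[D,U_g]$ bounded for every $g$. $\ell:G\to\mathbb{B}_h(V)$ (self-adjoint operators on $V$) is translation bounded if $x\mapsto\ell(x)-\ell(y^{-1}x)$ is bounded for each $y$; proper if $\ell(g)=0$ iff $g=e$, $\bigcup_x\mathrm{Sp}\,\ell(x)$ is a discrete subset of $\mathbb{R}$ (finite intersection with every bounded interval), and each $t$ in this union belongs to $\mathrm{Sp}\,\ell(x)$ for only finitely many $x$. $M_\ell(\delta_x\otimes v)=\delta_x\otimes\ell(x)v$; $\lambda$ is the left regular representation (amplified to $\ell^2(G)\otimes V$). Equivariant construction: $\widetilde H=(H\otimes\ell^2(G)\otimes V)\oplus(H\otimes\ell^2(G)\otimes V)$, the representation $\hat\pi\times\hat L$ of $A\rtimes_r^{\rho,\sigma}G$ is two copies of $a\delta_h:\xi\otimes\delta_x\otimes v\mapsto\pi(a)U_h\xi\otimes\delta_{hx}\otimes v$, and $\widetilde D$ is the closure of $$\begin{pmatrix}0&D\otimes1\otimes1_V-i1_H\otimes M_\ell\\ D\otimes1\otimes1_V+i1_H\otimes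 M_\ell&0\end{pmatrix}.$$ $B\subset\mathbb{B}(H)$ is the $C^*$-algebra image of $\pi\times U$ on $A\rtimes^{\rho,\sigma}G$, and $\mathcal{B}\subset B$ is the $*$-algebra of finite sums $\sum_g\pi(a_g)U_g$, $a_g\in\mathcal{A}$; $(\mathcal{B},H,D)$ is a spectral triple on $B$. $\psi_A:A\rtimes_r^{\rho,\sigma}G\to B\otimes C^*_r(G)$ (minimal tensor product) is the $*$-homomorphism with $\psi_A(a\delta_g)=\pi(a)U_g\otimes\delta_g$; it is the composition of $\phi_A^r:A\rtimes_r^{\rho,\sigma}G\to(A\rtimes^{\rho,\sigma}G)\otimes C^*_r(G)$, $a\delta_g\mapsto a\delta_g\otimes\delta_g$, with $(\pi\times U)\otimes\mathrm{id}$. Exterior product of odd spectral triples $(\mathcal{A}_1,H_1,D_1)$, $(\mathcal{A}_2,H_2,D_2)$: the even spectral triple $(\mathcal{A}_1\otimes_{\mathrm{alg}}\mathcal{A}_2,(H_1\otimes H_2)\oplus(H_1\otimes H_2),D_1\times D_2)$ on $A_1\otimes A_2$, represented by two copies of the tensor product representation, with standard grading and $D_1\times D_2$ the closure of $\begin{pmatrix}0&D_1\otimes1-i1\otimes D_2\\ D_1\otimes1+i1\otimes D_2&0\end{pmatrix}$. Given a spectral triple $(\mathcal{A}',H',D')$ on $A'$ with representation $\pi'$ and a unital $*$-homomorphism $f:B'\to A'$ of $C^*$-algebras mapping a dense $*$-subalgebra $\mathcal{B}'$ into $\mathcal{A}'$, the pullback is the spectral triple $(\mathcal{B}',H',D')$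 with representation $\pi'\circ f$; when $f$ is a unital inclusion (injective) it is called the restriction. *)

(* Defs.v *)
(* The complex numbers are R[i], for an arbitrary R : realType. *)
From HB Require Import structures.
From mathcomp Require Import all_boot all_order all_algebra.
From mathcomp Require Import complex.
From mathcomp Require Import mathcomp_extra boolp classical_sets functions.
From mathcomp Require Import cardinality fsbigop reals topology normedtype.
From mathcomp Require Import ring lra.

Set Implicit Arguments.
Unset Strict Implicit.
Unset Printing Implicit Defensive.

Import Order.TTheory GRing.Theory Num.Theory numFieldNormedType.Exports.

Local Open Scope classical_set_scope.
Local Open Scope complex_scope.
Local Open Scope ring_scope.

(* The inner product is linear in its first argument. *)
HB.mixin Record isHilbert (R : realType) H of CompleteNormedModule R[i] H := {
  inner : H -> H -> R[i];
  inner_linear : forall (a : R[i]) x y z,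
    inner (a *: x + y) z = a * inner x z + inner y z;
  inner_conj : forall x y, inner y x = conjc (inner x y);
  inner_norm : forall x, inner x x = `|x| ^+ 2
}.

#[short(type="hilbertType")]
HB.structure Definition Hilbert (R : realType) :=
  {H of isHilbert R H & CompleteNormedModule R[i] H}.

(* Unital C*-algebras.  The product is a field of the mixin, since MathComp
   has no join of the ring structures with the normed modules. *)
HB.mixin Record isCstar (R : realType) A of CompleteNormedModule R[i] A := {
  cone : A;
  cmul : A -> A -> A;
  star : A -> A;
  cmulA : associative cmul;
  cmul1r : left_id cone cmul;
  cmulr1 : right_id cone cmul;
  cmulDl : left_distributive cmul +%R;
  cmulDr : right_distributive cmul +%R;
  cscaleAl : forall (k : R[i]) a b, k *: cmul a b = cmul (k *: a) b;
  cscaleAr : forall (k : R[i]) a b, k *: cmul a b = cmul a (k *: b);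
  starK : involutive star;
  starD : {morph star : a b / a + b};
  starZ : forall (k : R[i]) a, star (k *: a) = conjc k *: star a;
  starM : forall a b, star (cmul a b) = cmul (star b) (star a);
  cnormM : forall a b, `|cmul a b| <= `|a| * `|b|;
  cstar_norm : forall a, `|cmul (star a) a| = `|a| ^+ 2
}.

#[short(type="cstarType")]
HB.structure Definition Cstar (R : realType) :=
  {A of isCstar R A & CompleteNormedModule R[i] A}.

Declare Scope cstar_scope.
Delimit Scope cstar_scope with CS.
Notation "a ** b" := (cmul a b) (at level 40, left associativity) : cstar_scope.
Local Open Scope cstar_scope.

Section RealNorm.
Variables (R : realType) (V : normedModType R[i]).
Implicit Types x y : V.

Definition rnorm x : R := complex.Re `|x|.

Lemma rnormE x : `|x| = (rnorm x)%:C.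
Proof. by rewrite /rnorm RRe_real// normr_real. Qed.

Lemma rnorm_ge0 x : 0 <= rnorm x.
Proof. by rewrite -ler0c -rnormE. Qed.

Lemma rnorm_le x (r : R) : (rnorm x <= r) = (`|x| <= r%:C).
Proof. by rewrite rnormE lecR. Qed.

Lemma rnorm_lt x (r : R) : (rnorm x < r) = (`|x| < r%:C).
Proof. by rewrite rnormE ltcR. Qed.

Lemma rnormD x y : rnorm (x + y) <= rnorm x + rnorm y.
Proof. by rewrite rnorm_le rmorphD/= -!rnormE ler_normD. Qed.

Lemma rdistC x y : rnorm (x - y) = rnorm (y - x).
Proof. by rewrite /rnorm distrC. Qed.

Lemma rdistD z x y : rnorm (x - y) <= rnorm (x - z) + rnorm (z - y).
Proof. by apply: le_trans (rnormD _ _); rewrite addrA subrK. Qed.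

Lemma rnormZ (a : R[i]) x : rnorm (a *: x) = complex.Re `|a| * rnorm x.
Proof.
apply: (@complexI R); rewrite rmorphM -!rnormE normrZ; congr (_ * _).
by symmetry; apply: RRe_real; exact: normr_real.
Qed.

Lemma rnorm_eq0 x : rnorm x = 0 -> x = 0.
Proof. by move=> x0; apply/normr0_eq0; rewrite rnormE x0. Qed.

Lemma rnorm0 : rnorm 0 = 0.
Proof. by rewrite /rnorm normr0. Qed.

End RealNorm.

Section RealCauchy.
Variables (R : realType) (V : normedModType R[i]).

Lemma real_cauchyP (F : set_system V) : ProperFilter F ->
  cauchy F <->
  forall e : R, 0 < e -> exists x, F [set y | rnorm (x - y) < e].
Proof.
move=> FF; split=> [/cauchyP Fc e e0|Fc].
  have [|x Fx] := Fc e%:C; first by rewrite ltcR.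
  exists x; apply: filterS Fx => y /=.
  by rewrite -ball_normE/= rnorm_lt.
apply/cauchyP => e e0.
have eE : e = (complex.Re e)%:C by rewrite RRe_real// gtr0_real.
have [|x Fx] := Fc (complex.Re e); first by rewrite -ltcR -eE.
exists x; apply: filterS Fx => y /=.
by rewrite -ball_normE/= rnorm_lt -eE.
Qed.

Lemma real_cvgP (F : set_system V) (x : V) : Filter F ->
  F --> x <-> forall e : R, 0 < e -> F [set y | rnorm (x - y) < e].
Proof.
move=> FF; split=> [/cvgrPdist_lt Fx e e0|Fx].
  have := Fx e%:C; rewrite ltcR => /(_ e0); apply: filterS => y.
  by rewrite /= rnorm_lt.
apply/cvgrPdist_lt => e e0.
have eE : e = (complex.Re e)%:C by rewrite RRe_real// gtr0_real.
have := Fx (complex.Re e); rewrite -ltcR -eE => /(_ e0); apply: filterS => y.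
by rewrite /= rnorm_lt -eE.
Qed.

End RealCauchy.

Section RealComplex.
Variable R : realType.
Implicit Types r s : R.
Lemma rcM r s : (r * s)%:C = r%:C * s%:C. Proof. exact: rmorphM. Qed.
Lemma rcD r s : (r + s)%:C = r%:C + s%:C. Proof. exact: rmorphD. Qed.
Lemma rcX r n : (r ^+ n)%:C = r%:C ^+ n. Proof. exact: rmorphXn. Qed.
Lemma rc_norm (a : R[i]) : (complex.Re `|a|)%:C = `|a|.
Proof. by apply: RRe_real; exact: normr_real. Qed.
End RealComplex.

Section InnerTheory.
Variables (R : realType) (H : hilbertType R).
Implicit Types x y z : H.

Lemma innerDl x y z : inner (x + y) z = inner x z + inner y z.
Proof. by rewrite -[x in LHS]scale1r inner_linear mul1r. Qed.
Lemma inner0l z : inner 0 z = 0.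
Proof. by apply: (@addIr _ (inner 0 z)); rewrite -innerDl !add0r. Qed.
Lemma innerZl a x z : inner (a *: x) z = a * inner x z.
Proof. by rewrite -[a *: x]addr0 inner_linear inner0l addr0. Qed.
Lemma innerNl x z : inner (- x) z = - inner x z.
Proof. by rewrite -scaleN1r innerZl mulN1r. Qed.
Lemma innerDr x y z : inner z (x + y) = inner z x + inner z y.
Proof. by rewrite inner_conj innerDl rmorphD/= -!(inner_conj _ z). Qed.
Lemma innerZr a x z : inner z (a *: x) = conjc a * inner z x.
Proof. by rewrite inner_conj innerZl rmorphM/= -(inner_conj _ z). Qed.
Lemma innerNr x z : inner z (- x) = - inner z x.
Proof. by rewrite inner_conj innerNl rmorphN/= -(inner_conj _ z). Qed.

Lemma inner_eq0 x : (forall y, inner x y = 0) -> x = 0.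
Proof.
move=> /(_ x); rewrite inner_norm => /eqP; rewrite expf_eq0/=.
by rewrite normr_eq0 => /eqP.
Qed.

Lemma inner_inj x y : (forall z, inner x z = inner y z) -> x = y.
Proof.
move=> xy; apply/eqP; rewrite -subr_eq0; apply/eqP/inner_eq0 => z.
by rewrite innerDl innerNl xy subrr.
Qed.

Lemma inner_injr x y : (forall z, inner z x = inner z y) -> x = y.
Proof.
by move=> xy; apply: inner_inj => z; rewrite inner_conj xy -inner_conj.
Qed.

Lemma CauchySchwarz x y : `|inner x y| <= `|x| * `|y|.
Proof.
have [->|y0] := eqVneq y 0.
  by rewrite -(scale0r 0) innerZr rmorph0 mul0r normr0 mulr_ge0.
have ny0 : 0 < `|y| by rewrite normr_gt0.
have ny2 : 0 < `|y| ^+ 2 by rewrite exprn_gt0.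
have ny2C : conjc (`|y| ^+ 2) = `|y| ^+ 2.
  by rewrite -inner_norm -inner_conj.
set c := inner x y / `|y| ^+ 2.
have : 0 <= `|x - c *: y| ^+ 2 by rewrite exprn_ge0.
rewrite -inner_norm innerDl !innerDr !innerNl !innerNr !innerZl !innerZr.
rewrite !inner_norm.
have -> : c * (conjc c * `|y| ^+ 2) = c * inner y x.
  rewrite /c rmorphM/= fmorphV/= ny2C -(inner_conj x y).
  by rewrite divfK// gt_eqF.
rewrite opprK addrA subrK.
have -> : conjc c * inner x y = `|inner x y| ^+ 2 / `|y| ^+ 2.
  by rewrite /c rmorphM/= fmorphV/= ny2C sqr_normc mulrAC [_ * inner x y]mulrC.
rewrite subr_ge0 ler_pdivrMr// -exprMn => h.
by rewrite -(@ler_pXn2r _ 2)// nnegrE// mulr_ge0.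
Qed.

End InnerTheory.

(* B(H): the bounded linear maps having an adjoint, which by the Riesz
   representation theorem are all the bounded linear maps. *)
Record bop (R : realType) (H : hilbertType R) := Bop {
  bop_fun :> H -> H;
  bop_linear : linear bop_fun;
  bop_bounded : exists M : R[i], forall x, `|bop_fun x| <= M * `|x|;
  bop_adjointable : exists f : H -> H,
    forall x y, inner (bop_fun x) y = inner x (f y)
}.

Section BopAlgebra.
Variables (R : realType) (H : hilbertType R).
Implicit Types (S T : bop H) (x y : H) (a b : R[i]).

Lemma bopP S T : (forall x, S x = T x) -> S = T.
Proof.
case: S T => [s s1 s2 s3] [t t1 t2 t3] /= /funext st.
by rewrite st in s1 s2 s3 *; congr Bop; exact: Prop_irrelevance.
Qed.

HB.instance Definition _ := gen_eqMixin (bop H).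
HB.instance Definition _ := gen_choiceMixin (bop H).

Lemma bopD T x y : T (x + y) = T x + T y.
Proof. by rewrite -[x in LHS]scale1r bop_linear scale1r. Qed.
Lemma bop0x T : T 0 = 0.
Proof. by apply: (@addIr _ (T 0)); rewrite -bopD !add0r. Qed.
Lemma bopZ T a x : T (a *: x) = a *: T x.
Proof. by rewrite -[a *: x]addr0 bop_linear bop0x addr0. Qed.
Lemma bopN T x : T (- x) = - T x.
Proof. by rewrite -scaleN1r bopZ scaleN1r. Qed.
Lemma bopB T x y : T (x - y) = T x - T y.
Proof. by rewrite bopD bopN. Qed.

Lemma bop_bound_ge0 (f : H -> H) :
  (exists M : R[i], forall x, `|f x| <= M * `|x|) <->
  (exists2 M : R, 0 <= M & forall x, rnorm (f x) <= M * rnorm x).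
Proof.
split=> [[M fM]|[M M0 fM]]; last first.
  by exists M%:C => x; rewrite !rnormE -rcM lecR.
have [xz|/existsNP[x0 /eqP x00]] := pselect (forall x : H, x = 0).
  exists 0 => // x; rewrite (xz (f x)) rnorm0; exact: mulr_ge0 (rnorm_ge0 _).
have M0 : 0 <= M.
  have x0p : 0 < `|x0| by rewrite normr_gt0.
  by rewrite -(pmulr_lge0 _ x0p); apply: le_trans (fM x0).
have ME : M = (complex.Re M)%:C by symmetry; apply: RRe_real; exact: ger0_real.
exists (complex.Re M); first by rewrite -ler0c -ME.
by move=> x; rewrite rnorm_le rcM -rnormE -ME; exact: fM.
Qed.

Lemma bop_rbounded T :
  exists2 M : R, 0 <= M & forall x, rnorm (T x) <= M * rnorm x.
Proof. exact/bop_bound_ge0/bop_bounded. Qed.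

Section Build.
Variables (f g : H -> H) (M : R).
Hypotheses (f_lin : linear f) (M0 : 0 <= M)
  (fM : forall x, rnorm (f x) <= M * rnorm x)
  (fg : forall x y, inner (f x) y = inner x (g y)).
Definition mkbop : bop H.
Proof.
exists f => //; last by exists g.
by apply/bop_bound_ge0; exists M.
Defined.
End Build.

Definition bzero : bop H.
Proof.
exists (fun=> 0) => [a x y||]; first by rewrite scaler0 addr0.
  by exists 0 => x; rewrite normr0 mul0r.
exists (fun=> 0) => x y.
by rewrite inner0l inner_conj inner0l rmorph0.
Defined.

Definition bid : bop H.
Proof.
exists idfun => //; first by exists 1 => x; rewrite mul1r.
by exists idfun.
Defined.

Definition badd S T : bop H.
Proof.
exists (fun x => S x + T x) => [a x y||].
- by rewrite !bop_linear scalerDr addrACA.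
- have [M SM] := bop_bounded S; have [N TN] := bop_bounded T.
  exists (M + N) => x; rewrite mulrDl.
  by apply: le_trans (ler_normD _ _) _; exact: lerD.
- have [s Ss] := bop_adjointable S; have [t Tt] := bop_adjointable T.
  by exists (fun x => s x + t x) => x y; rewrite innerDl Ss Tt innerDr.
Defined.

Definition bscale a T : bop H.
Proof.
exists (fun x => a *: T x) => [b x y||].
- by rewrite bop_linear scalerDr !scalerA mulrC.
- have [M TM] := bop_bounded T.
  exists (`|a| * M) => x; rewrite normrZ -mulrA; exact: ler_wpM2l.
- have [t Tt] := bop_adjointable T.
  exists (fun x => conjc a *: t x) => x y.
  by rewrite innerZl innerZr conjcK Tt.
Defined.

Definition bopp T := bscale (-1) T.

Definition bcomp S T : bop H.
Proof.
exists (fun x => S (T x)) => [b x y||].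
- by rewrite !bop_linear.
- have /bop_bound_ge0[M M0 SM] := bop_bounded S.
  have /bop_bound_ge0[N N0 TN] := bop_bounded T.
  apply/bop_bound_ge0; exists (M * N); first exact: mulr_ge0.
  by move=> x; apply: le_trans (SM _) _; rewrite -mulrA ler_wpM2l.
- have [s Ss] := bop_adjointable S; have [t Tt] := bop_adjointable T.
  by exists (fun x => t (s x)) => x y; rewrite Ss Tt.
Defined.

Let badj_subproof T : { f : H -> H |
  forall x y, inner (T x) y = inner x (f y)}.
Proof. exact/cid/bop_adjointable. Qed.
Let adjf T := sval (badj_subproof T).
Let adjfE T x y : inner (T x) y = inner x (adjf T y).
Proof. exact: (svalP (badj_subproof T)). Qed.

Lemma adj_bound (f g : H -> H) (M : R) : 0 <= M ->
  (forall x y, inner (f x) y = inner x (g y)) ->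
  (forall x, rnorm (f x) <= M * rnorm x) ->
  forall x, rnorm (g x) <= M * rnorm x.
Proof.
move=> M0 fg fM x.
have [->|gx0] := eqVneq (g x) 0.
  by rewrite rnorm0 mulr_ge0// rnorm_ge0.
have gx1 : 0 < rnorm (g x).
  rewrite lt_neqAle rnorm_ge0 andbT eq_sym.
  by apply: contra gx0 => /eqP/rnorm_eq0 ->.
have : `|inner (f (g x)) x| <= `|f (g x)| * `|x| by exact: CauchySchwarz.
rewrite fg inner_norm normrX normr_id !rnormE -rcX -rcM lecR => h.
rewrite -(ler_pM2l gx1) -expr2; apply: le_trans h _.
by rewrite mulrCA mulrA ler_wpM2r// rnorm_ge0.
Qed.

Definition badj T : bop H.
Proof.
exists (adjf T) => [a x y||].
- apply: inner_injr => z.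
  by rewrite innerDr innerZr -!adjfE innerDr innerZr.
- have [M M0 TM] := bop_rbounded T.
  apply/bop_bound_ge0; exists M => //.
  by apply: adj_bound TM => // x y; exact: adjfE.
- by exists T => x y; rewrite inner_conj -adjfE -inner_conj.
Defined.

Lemma badjE T x y : inner (T x) y = inner x (badj T y).
Proof. exact: adjfE. Qed.

Lemma badjEr T x y : inner x (T y) = inner (badj T x) y.
Proof. by rewrite inner_conj badjE -inner_conj. Qed.

Fact baddA : associative badd.
Proof. by move=> ? ? ?; apply: bopP => x /=; rewrite addrA. Qed.
Fact baddC : commutative badd.
Proof. by move=> ? ?; apply: bopP => x /=; rewrite addrC. Qed.
Fact badd0 : left_id bzero badd.
Proof. by move=> ?; apply: bopP => x /=; rewrite add0r. Qed.
Fact baddN : left_inverse bzero bopp badd.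
Proof. by move=> ?; apply: bopP => x /=; rewrite scaleN1r addNr. Qed.
HB.instance Definition _ :=
  GRing.isZmodule.Build (bop H) baddA baddC badd0 baddN.

Fact bscaleA a b T : bscale a (bscale b T) = bscale (a * b) T.
Proof. by apply: bopP => x /=; rewrite scalerA. Qed.
Fact bscale1 : left_id 1 bscale.
Proof. by move=> ?; apply: bopP => x /=; rewrite scale1r. Qed.
Fact bscaleDr : right_distributive bscale +%R.
Proof. by move=> ? ? ?; apply: bopP => x /=; rewrite scalerDr. Qed.
Fact bscaleDl T : {morph bscale^~ T : a b / a + b}.
Proof. by move=> ? ?; apply: bopP => x /=; rewrite scalerDl. Qed.
HB.instance Definition _ := GRing.Zmodule_isLmodule.Build R[i] (bop H)
  bscaleA bscale1 bscaleDr bscaleDl.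

Lemma baddE S T x : (S + T) x = S x + T x. Proof. by []. Qed.
Lemma bscaleE a T x : (a *: T) x = a *: T x. Proof. by []. Qed.
Lemma boppE T x : (- T) x = - T x. Proof. exact: scaleN1r. Qed.
Lemma bsubE S T x : (S - T) x = S x - T x.
Proof. by rewrite baddE boppE. Qed.
Lemma bzeroE x : (0 : bop H) x = 0. Proof. by []. Qed.

Definition bnorm T : R :=
  sup [set rnorm (T x) | x in [set x | rnorm x <= 1]].

Let bset T := [set rnorm (T x) | x in [set x : H | rnorm x <= 1]].

Let bset_has_sup T : has_sup (bset T).
Proof.
split; first by exists (rnorm (T 0)), 0 => //=; rewrite rnorm0.
have [M M0 TM] := bop_rbounded T; exists M => _ [x /= x1 <-].
by apply: le_trans (TM x) _; rewrite ler_piMr.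
Qed.

Lemma bnorm_ge0 T : 0 <= bnorm T.
Proof.
apply: le_trans (rnorm_ge0 (T 0)) _; apply: ub_le_sup.
  by have [] := bset_has_sup T.
by exists 0 => //=; rewrite rnorm0.
Qed.

Lemma le_bnorm T x : rnorm (T x) <= bnorm T * rnorm x.
Proof.
have [->|x0] := eqVneq x 0; first by rewrite bop0x rnorm0 mulr0.
have x1 : 0 < rnorm x.
  rewrite lt_neqAle rnorm_ge0 andbT eq_sym.
  by apply: contra x0 => /eqP/rnorm_eq0 ->.
rewrite -ler_pdivrMr//; apply: ub_le_sup.
  by have [] := bset_has_sup T.
have E y : rnorm ((rnorm x)^-1%:C *: y) = (rnorm x)^-1 * rnorm y.
  rewrite rnormZ ger0_norm// ler0c invr_ge0; exact: ltW.
exists ((rnorm x)^-1%:C *: x) => /=; first by rewrite E mulVf ?gt_eqF.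
by rewrite bopZ E mulrC.
Qed.

Lemma bnorm_le T (M : R) : 0 <= M ->
  (forall x, rnorm (T x) <= M * rnorm x) -> bnorm T <= M.
Proof.
move=> M0 TM; apply: sup_le_ub; first by have [] := bset_has_sup T.
move=> _ [x /= x1 <-]; apply: le_trans (TM x) _.
by rewrite ler_piMr.
Qed.

Definition bnormC T : R[i] := (bnorm T)%:C.

Fact bnormCD S T : bnormC (S + T) <= bnormC S + bnormC T.
Proof.
rewrite /bnormC -rcD lecR; apply: bnorm_le.
  by rewrite addr_ge0// bnorm_ge0.
move=> x; apply: le_trans (rnormD _ _) _.
by rewrite mulrDl lerD// le_bnorm.
Qed.

Lemma bnormZ_le a T : bnorm (a *: T) <= complex.Re `|a| * bnorm T.
Proof.
have a0 : 0 <= complex.Re `|a| by rewrite -ler0c RRe_real ?normr_real.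
apply: bnorm_le; first by rewrite mulr_ge0// bnorm_ge0.
by move=> x; rewrite bscaleE rnormZ -mulrA ler_wpM2l// le_bnorm.
Qed.

Fact bnormCZ a T : bnormC (a *: T) = `|a| * bnormC T.
Proof.
have aE : `|a| = (complex.Re `|a|)%:C.
  by symmetry; apply: RRe_real; exact: normr_real.
rewrite /bnormC aE -rcM; congr (_%:C); apply/eqP.
rewrite eq_le bnormZ_le andTb.
have [->|a0] := eqVneq a 0.
  have -> : complex.Re `|0 : R[i]| = 0 by rewrite [`|_|]normr0.
  by rewrite mul0r bnorm_ge0.
have an0 : 0 < complex.Re `|a| by rewrite -ltcR -aE normr_gt0.
rewrite -ler_pdivlMl//.
have := bnormZ_le a^-1 (a *: T); rewrite scalerA mulVf// scale1r.
suff -> : complex.Re `|a^-1| = (complex.Re `|a|)^-1 by [].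
apply: (mulIf (lt0r_neq0 an0)); rewrite mulVf ?gt_eqF//.
by apply: complexI; rewrite rcM !rc_norm -normrM mulVf// normr1.
Qed.

Fact bnormC_eq0 T : bnormC T = 0 -> T = 0.
Proof.
move=> /complexI T0; apply: bopP => x; apply: rnorm_eq0; apply/eqP.
by rewrite eq_le rnorm_ge0 andbT -[X in _ <= X](mul0r (rnorm x)) -T0 le_bnorm.
Qed.

HB.instance Definition _ := Lmodule_isNormed.Build R[i] (bop H)
  bnormCD bnormCZ bnormC_eq0.

Lemma bop_normE T : `|T| = (bnorm T)%:C. Proof. by []. Qed.
Lemma rnorm_bop T : rnorm T = bnorm T. Proof. by []. Qed.

Lemma bnorm_adj_le T : bnorm (badj T) <= bnorm T.
Proof.
apply: bnorm_le; first exact: bnorm_ge0.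
by apply: (adj_bound (f := T)); [exact: bnorm_ge0|exact: badjE|exact: le_bnorm].
Qed.

Fact badjK : involutive badj.
Proof.
move=> T; apply: bopP => x; apply: inner_injr => z.
by rewrite -badjE -badjEr.
Qed.

Lemma bnorm_adj T : bnorm (badj T) = bnorm T.
Proof.
by apply/eqP; rewrite eq_le bnorm_adj_le/= -{1}[T]badjK bnorm_adj_le.
Qed.

Fact badjD : {morph badj : S T / S + T}.
Proof.
move=> S T; apply: bopP => x; apply: inner_injr => z.
by rewrite -badjE !baddE innerDl innerDr !badjE.
Qed.

Fact badjZ a T : badj (a *: T) = conjc a *: badj T.
Proof.
apply: bopP => x; apply: inner_injr => z.
by rewrite -badjE !bscaleE innerZl innerZr conjcK badjE.
Qed.

Fact badjM S T : badj (bcomp S T) = bcomp (badj T) (badj S).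
Proof.
apply: bopP => x; apply: inner_injr => z.
by rewrite -badjE /= !badjE.
Qed.

Fact bcompA : associative bcomp.
Proof. by move=> ? ? ?; apply: bopP. Qed.
Fact bcomp1 : left_id bid bcomp.
Proof. by move=> ?; apply: bopP. Qed.
Fact bcompr1 : right_id bid bcomp.
Proof. by move=> ?; apply: bopP. Qed.
Fact bcompDl : left_distributive bcomp +%R.
Proof. by move=> ? ? ?; apply: bopP. Qed.
Fact bcompDr : right_distributive bcomp +%R.
Proof. by move=> ? ? ?; apply: bopP => x /=; rewrite bopD. Qed.
Fact bscaleAl a S T : a *: bcomp S T = bcomp (a *: S) T.
Proof. exact: bopP. Qed.
Fact bscaleAr a S T : a *: bcomp S T = bcomp S (a *: T).
Proof. by apply: bopP => x /=; rewrite bopZ. Qed.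

Lemma bnormM S T : bnorm (bcomp S T) <= bnorm S * bnorm T.
Proof.
apply: bnorm_le; first by rewrite mulr_ge0 ?bnorm_ge0.
move=> x; apply: le_trans (le_bnorm S _) _.
by rewrite -mulrA ler_wpM2l ?bnorm_ge0 ?le_bnorm.
Qed.

Fact bnormCM S T : `|bcomp S T| <= `|S| * `|T|.
Proof. by rewrite !bop_normE -rcM lecR bnormM. Qed.


Fact bcstar T : `|bcomp (badj T) T| = `|T| ^+ 2.
Proof.
apply/eqP; rewrite eq_le !bop_normE -rcX !lecR; apply/andP; split.
  by rewrite expr2 -{1}(bnorm_adj T) bnormM.
set N := bnorm (bcomp _ _).
have N0 : 0 <= N by exact: bnorm_ge0.
rewrite -(sqr_sqrtr N0) ler_pXn2r ?nnegrE ?bnorm_ge0 ?sqrtr_ge0//.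
apply: bnorm_le; first exact: sqrtr_ge0.
move=> x; rewrite -(@ler_pXn2r _ 2) ?nnegrE ?rnorm_ge0//; last first.
  by rewrite mulr_ge0 ?sqrtr_ge0 ?rnorm_ge0.
rewrite exprMn sqr_sqrtr// -lecR rcX -rnormE -inner_norm badjE.
have : `|inner x (badj T (T x))| <= `|x| * `|bcomp (badj T) T x|.
  exact: CauchySchwarz.
rewrite -badjE inner_norm normrX normr_id => /le_trans; apply.
rewrite !rnormE -rcM lecR mulrC expr2 mulrA ler_wpM2r ?rnorm_ge0//.
exact: le_bnorm.
Qed.

Lemma bop_complete (F : set_system (bop H)) :
  ProperFilter F -> cauchy F -> cvg F.
Proof.
move=> FF /real_cauchyP Fc.
have Fx x : cauchy ((fun T : bop H => T x) @ F).
  apply/real_cauchyP => e e0.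
  have x1 : 0 < rnorm x + 1 by rewrite ltr_wpDl// rnorm_ge0.
  have [|T FT] := Fc (e / (rnorm x + 1)); first exact: divr_gt0.
  exists (T x).
  change (F [set S : bop H | rnorm (T x - S x) < e]); apply: filterS FT => S /= TS.
  rewrite -bsubE; apply: le_lt_trans (le_bnorm _ _) _.
  move: TS; rewrite rnorm_bop ltr_pdivlMr//; apply: le_lt_trans.
  by rewrite ler_wpM2l ?bnorm_ge0// lerDl.
pose f x := lim ((fun T : bop H => T x) @ F).
have cf x : (fun T : bop H => T x) @ F --> f x by apply: cauchy_cvg; exact: Fx.
have Fc' : cauchy (badj @ F).
  apply/real_cauchyP => e e0; have [T FT] := Fc e e0.
  exists (badj T).
  change (F [set S : bop H | rnorm (badj T - badj S) < e]); apply: filterS FT => S /=.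
  rewrite !rnorm_bop; have -> : badj T - badj S = badj (T - S).
    by rewrite badjD -[- S]scaleN1r badjZ rmorphN rmorph1 scaleN1r.
  by rewrite bnorm_adj.
have Fx' x : cauchy ((fun T : bop H => badj T x) @ F).
  apply/real_cauchyP => e e0.
  have x1 : 0 < rnorm x + 1 by rewrite ltr_wpDl// rnorm_ge0.
  have [|T FT] := Fc (e / (rnorm x + 1)); first exact: divr_gt0.
  exists (badj T x).
  change (F [set S : bop H | rnorm (badj T x - badj S x) < e]); apply: filterS FT => S /= TS.
  have -> : badj T x - badj S x = badj (T - S) x.
    by rewrite badjD -[- S]scaleN1r badjZ rmorphN rmorph1 scaleN1r bsubE.
  apply: le_lt_trans (le_bnorm _ _) _; rewrite bnorm_adj.
  move: TS; rewrite rnorm_bop ltr_pdivlMr//; apply: le_lt_trans.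
  by rewrite ler_wpM2l ?bnorm_ge0// lerDl.
pose g x := lim ((fun T : bop H => badj T x) @ F).
have cg x : (fun T : bop H => badj T x) @ F --> g x by apply: cauchy_cvg; exact: Fx'.
have f_lin : linear f.
  move=> a x y; apply: (@cvg_unique _ _ ((fun T : bop H => T (a *: x + y)) @ F)).
  - exact: norm_hausdorff.
  - exact: cf.
  - have -> : (fun T : bop H => T (a *: x + y)) =
              (fun T : bop H => a *: T x + T y).
      by apply/funext => T; rewrite bop_linear.
    by apply: cvgD; [apply: cvgZr|]; exact: cf.
have close e T : 0 < e -> F [set S | rnorm (T - S) < e] ->
    forall x, rnorm (T x - f x) <= e * rnorm x.
  move=> e0 FT x; apply/ler_addgt0Pr => d d0.
  have /real_cvgP/(_ _ d0) Fd := cf x.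
  have {}Fd : F [set S : bop H | rnorm (f x - S x) < d] := Fd.
  have [S [/= TS Sd]] := filter_ex (filterI FT Fd).
  apply: le_trans (rdistD (S x) _ _) _; apply: lerD.
    rewrite -bsubE; apply: le_trans (le_bnorm _ _) _.
    by rewrite ler_wpM2r ?rnorm_ge0// ltW.
  by rewrite rdistC ltW.
have [T1 FT1] := Fc 1 ltr01.
have fM x : rnorm (f x) <= (bnorm T1 + 1) * rnorm x.
  rewrite -[f x](subrK (T1 x)); apply: le_trans (rnormD _ _) _.
  rewrite addrC mulrDl lerD ?le_bnorm// rdistC.
  exact: close FT1 _.
have fg x y : inner (f x) y = inner x (g y).
  apply/eqP; rewrite -subr_eq0 -normr_eq0; apply/eqP.
  have E : `|inner (f x) y - inner x (g y)| =
     (complex.Re `|inner (f x) y - inner x (g y)|)%:C.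
    by symmetry; apply: RRe_real; exact: normr_real.
  rewrite E; congr (_%:C); apply/eqP; rewrite eq_le -ler0c -E normr_ge0 andbT.
  apply/ler_addgt0Pr => d d0; rewrite add0r -lecR -E.
  set M := rnorm x + rnorm y + 1.
  have M0 : 0 < M by rewrite ltr_wpDl// addr_ge0// rnorm_ge0.
  have /real_cvgP/(_ _ (divr_gt0 d0 M0)) Fd := cf x.
  have /real_cvgP/(_ _ (divr_gt0 d0 M0)) Gd := cg y.
  have {}Fd : F [set S : bop H | rnorm (f x - S x) < d / M] := Fd.
  have {}Gd : F [set S : bop H | rnorm (g y - badj S y) < d / M] := Gd.
  have [S [/= Sx Sy]] := filter_ex (filterI Fd Gd).
  have -> : inner (f x) y - inner x (g y) =
     inner (f x - S x) y - inner x (g y - badj S y).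
    by rewrite innerDl innerNl innerDr innerNr -badjE opprB addrA subrK.
  apply: le_trans (ler_normB _ _) _.
  apply: le_trans (lerD (CauchySchwarz _ _) (CauchySchwarz _ _)) _.
  rewrite !rnormE -!rcM -rcD lecR.
  apply: (@le_trans _ _ (d / M * rnorm y + rnorm x * (d / M))).
    by rewrite lerD// ?ler_wpM2r ?ler_wpM2l ?rnorm_ge0// ltW.
  rewrite [rnorm x * _]mulrC -mulrDr -mulrA; apply: ler_piMr; first exact: ltW.
  by rewrite mulrC ler_pdivrMr// mul1r /M [rnorm y + _]addrC lerDl.
pose T0 := @mkbop f g (bnorm T1 + 1) f_lin
  (addr_ge0 (bnorm_ge0 T1) ler01) fM fg.
apply/cvg_ex; exists T0; apply/real_cvgP => e e0.
have e20 : 0 < e / 2 / 2 by rewrite !divr_gt0.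
have [T FT] := Fc _ e20.
apply: (filterS _ FT) => S /= TS.
apply: le_lt_trans (rdistD T _ _) _.
rewrite [ltRHS](splitr e) ltrD//.
  rewrite rdistC rnorm_bop; apply: (@le_lt_trans _ _ (e / 2 / 2)).
    apply: bnorm_le; first exact: ltW.
    by move=> x; rewrite bsubE; exact: (close _ _ e20 FT x).
  by rewrite [ltRHS]splitr ltrDl.
by apply: lt_le_trans TS _; rewrite [leRHS]splitr lerDl ltW.
Qed.
HB.instance Definition _ := Uniform_isComplete.Build (bop H) bop_complete.

HB.instance Definition _ := isCstar.Build R (bop H)
  bcompA bcomp1 bcompr1 bcompDl bcompDr bscaleAl bscaleAr
  badjK badjD badjZ badjM bnormCM bcstar.

End BopAlgebra.

(* The Hilbert space direct sum; the product of normed modules carries the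
   sup norm instead. *)
Definition hsum (R : realType) (H K : hilbertType R) : Type := (H * K)%type.

Section HilbertSum.
Variables (R : realType) (H K : hilbertType R).

HB.instance Definition _ := GRing.Lmodule.copy (hsum H K) (H * K)%type.

Let hnorm (x : hsum H K) : R :=
  Num.sqrt (rnorm x.1 ^+ 2 + rnorm x.2 ^+ 2).

Let hsqr_ge0 (x : hsum H K) : 0 <= rnorm x.1 ^+ 2 + rnorm x.2 ^+ 2.
Proof. by rewrite addr_ge0// sqr_ge0. Qed.

Let sqr_hnorm x : hnorm x ^+ 2 = rnorm x.1 ^+ 2 + rnorm x.2 ^+ 2.
Proof. exact: sqr_sqrtr. Qed.

Definition hsum_norm (x : hsum H K) : R[i] := (hnorm x)%:C.

Let minkowski (a b c d : R) : 0 <= a -> 0 <= b -> 0 <= c -> 0 <= d ->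
  Num.sqrt ((a + c) ^+ 2 + (b + d) ^+ 2) <=
  Num.sqrt (a ^+ 2 + b ^+ 2) + Num.sqrt (c ^+ 2 + d ^+ 2).
Proof.
move=> a0 b0 c0 d0.
set s := Num.sqrt (a ^+ 2 + _); set t := Num.sqrt (c ^+ 2 + _).
have s2 : s ^+ 2 = a ^+ 2 + b ^+ 2 by rewrite sqr_sqrtr// addr_ge0 ?sqr_ge0.
have t2 : t ^+ 2 = c ^+ 2 + d ^+ 2 by rewrite sqr_sqrtr// addr_ge0 ?sqr_ge0.
have s0 : 0 <= s by exact: sqrtr_ge0.
have t0 : 0 <= t by exact: sqrtr_ge0.
rewrite -(@ler_pXn2r _ 2) ?nnegrE ?sqrtr_ge0 ?addr_ge0//.
rewrite sqr_sqrtr ?addr_ge0 ?sqr_ge0//.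
have h : a * c + b * d <= s * t.
  rewrite -(@ler_pXn2r _ 2) ?nnegrE ?addr_ge0 ?mulr_ge0//.
  rewrite exprMn s2 t2; have := sqr_ge0 (a * d - b * c); nra.
rewrite (sqrrD s t) s2 t2; nra.
Qed.

Fact hsum_normD x y : hsum_norm (x + y) <= hsum_norm x + hsum_norm y.
Proof.
rewrite /hsum_norm -rcD lecR /hnorm.
apply: le_trans (minkowski (rnorm_ge0 _) (rnorm_ge0 _) (rnorm_ge0 _)
  (rnorm_ge0 _)).
apply: ler_wsqrtr; apply: lerD.
  by rewrite ler_pXn2r ?nnegrE ?addr_ge0 ?rnorm_ge0//= rnormD.
by rewrite ler_pXn2r ?nnegrE ?addr_ge0 ?rnorm_ge0//= rnormD.
Qed.

Fact hsum_normZ (a : R[i]) x : hsum_norm (a *: x) = `|a| * hsum_norm x.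
Proof.
rewrite /hsum_norm -rc_norm -rcM; congr (_%:C).
have a0 : 0 <= complex.Re `|a| by rewrite -ler0c rc_norm.
rewrite /hnorm !rnormZ !exprMn -mulrDr sqrtrM ?sqr_ge0// sqrtr_sqr.
by rewrite ger0_norm.
Qed.

Fact hsum_norm_eq0 x : hsum_norm x = 0 -> x = 0.
Proof.
move=> /complexI x0; have := sqr_hnorm x; rewrite x0 expr0n/= => /esym/eqP.
rewrite paddr_eq0 ?sqr_ge0// !expf_eq0/= => /andP[/eqP/rnorm_eq0 a].
by move=> /eqP/rnorm_eq0 b; exact: injective_projections.
Qed.

HB.instance Definition _ := Lmodule_isNormed.Build R[i] (hsum H K)
  hsum_normD hsum_normZ hsum_norm_eq0.

Lemma sqr_hsum_norm (x : hsum H K) : `|x| ^+ 2 = `|x.1| ^+ 2 + `|x.2| ^+ 2.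
Proof. by rewrite /Num.norm/= -rcX sqr_hnorm rcD !rcX -!rnormE. Qed.

Let fst_le (x : hsum H K) : rnorm x.1 <= rnorm x.
Proof.
rewrite -[X in _ <= X]/(hnorm x) -[rnorm x.1]ger0_norm ?rnorm_ge0//.
by rewrite -sqrtr_sqr ler_wsqrtr// lerDl sqr_ge0.
Qed.

Let snd_le (x : hsum H K) : rnorm x.2 <= rnorm x.
Proof.
rewrite -[X in _ <= X]/(hnorm x) -[rnorm x.2]ger0_norm ?rnorm_ge0//.
by rewrite -sqrtr_sqr ler_wsqrtr// lerDr sqr_ge0.
Qed.

Let norm_le (x : hsum H K) : rnorm x <= rnorm x.1 + rnorm x.2.
Proof.
rewrite -[X in X <= _]/(hnorm x) /hnorm.
rewrite -[leRHS]ger0_norm ?addr_ge0 ?rnorm_ge0// -sqrtr_sqr ler_wsqrtr//.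
by rewrite sqrrD lerD2r lerDl mulrn_wge0// mulr_ge0// rnorm_ge0.
Qed.

Lemma hsum_complete (F : set_system (hsum H K)) :
  ProperFilter F -> cauchy F -> cvg F.
Proof.
move=> FF /real_cauchyP Fc.
have F1 : cauchy ((fun x : hsum H K => x.1) @ F).
  apply/real_cauchyP => e e0; have [x Fx] := Fc e e0; exists x.1.
  change (F [set y : hsum H K | rnorm (x.1 - y.1) < e]).
  apply: (filterS _ Fx) => y /=; exact: le_lt_trans (fst_le (x - y)).
have F2 : cauchy ((fun x : hsum H K => x.2) @ F).
  apply/real_cauchyP => e e0; have [x Fx] := Fc e e0; exists x.2.
  change (F [set y : hsum H K | rnorm (x.2 - y.2) < e]).
  apply: (filterS _ Fx) => y /=; exact: le_lt_trans (snd_le (x - y)).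
have /real_cvgP c1 : (fun x : hsum H K => x.1) @ F -->
   lim ((fun x : hsum H K => x.1) @ F) by apply: cauchy_cvg; exact: F1.
have /real_cvgP c2 : (fun x : hsum H K => x.2) @ F -->
   lim ((fun x : hsum H K => x.2) @ F) by apply: cauchy_cvg; exact: F2.
set a := lim _ in c1; set b := lim _ in c2.
apply/cvg_ex; exists ((a, b) : hsum H K); apply/real_cvgP => e e0.
have e2 : 0 < e / 2 by rewrite divr_gt0.
have A : F [set y : hsum H K | rnorm (a - y.1) < e / 2] := c1 _ e2.
have B : F [set y : hsum H K | rnorm (b - y.2) < e / 2] := c2 _ e2.
apply: (filterS _ (filterI A B)) => y [/= ay by'].
apply: le_lt_trans (norm_le _) _ => /=.
by rewrite [ltRHS]splitr ltrD.
Qed.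
HB.instance Definition _ := Uniform_isComplete.Build (hsum H K) hsum_complete.

Definition hsum_inner (x y : hsum H K) : R[i] := inner x.1 y.1 + inner x.2 y.2.

Fact hsum_inner_linear (a : R[i]) x y z :
  hsum_inner (a *: x + y) z = a * hsum_inner x z + hsum_inner y z.
Proof. by rewrite /hsum_inner !inner_linear mulrDr addrACA. Qed.

Fact hsum_inner_conj x y : hsum_inner y x = conjc (hsum_inner x y).
Proof. by rewrite /hsum_inner rmorphD/= -!inner_conj. Qed.

Fact hsum_inner_norm x : hsum_inner x x = `|x| ^+ 2.
Proof. by rewrite sqr_hsum_norm /hsum_inner !inner_norm. Qed.

HB.instance Definition _ := isHilbert.Build R (hsum H K)
  hsum_inner_linear hsum_inner_conj hsum_inner_norm.

End HilbertSum.

Definition separable_space (T : topologicalType) : Prop :=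
  exists2 S : set T, countable S & dense S.

Section StarAlgebras.
Variable R : realType.

Section One.
Variable E : cstarType R.

Definition star_subalgebra (S : set E) : Prop :=
  [/\ S cone,
      forall (k : R[i]) a b, S a -> S b -> S (k *: a + b),
      forall a b, S a -> S b -> S (a ** b) &
      forall a, S a -> S (star a)].

Definition dense_star_subalgebra (S0 S : set E) : Prop :=
  [/\ star_subalgebra S0, S0 `<=` S & S `<=` closure S0].

Definition unitary (u : E) : Prop := star u ** u = cone /\ u ** star u = cone.

Definition spectrum (a : E) : set R[i] :=
  [set z | ~ exists b,
    (a - z *: cone) ** b = cone /\ b ** (a - z *: cone) = cone].

End One.

(* Unital *-homomorphisms defined on a *-subalgebra S of E. *)
Definition star_hom (E F : cstarType R) (S : set E) (f : E -> F) : Prop :=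
  [/\ f cone = cone,
      forall (k : R[i]) a b, S a -> S b -> f (k *: a + b) = k *: f a + f b,
      forall a b, S a -> S b -> f (a ** b) = f a ** f b &
      forall a, S a -> f (star a) = star (f a)].

End StarAlgebras.

(* An unbounded operator on H is given by its graph, a subset of H * H. *)
Section UnboundedOperators.
Variables (R : realType) (H : hilbertType R).
Implicit Types (D : set (H * H)) (T Q : bop H).

Definition dom D : set H := [set x | exists y, D (x, y)].

Definition adjoint_graph D : set (H * H) :=
  [set p | forall u v, D (u, v) -> inner v p.1 = inner u p.2].

Definition self_adjoint D : Prop := dense (dom D) /\ D = adjoint_graph D.

Definition compact_operator T : Prop :=
  compact (closure (T @` [set x | `|x| <= 1])).

Definition positive_operator T : Prop := forall x, 0 <= inner (T x) x.

(* Q = (1 + D^2)^(-1/2) is the positive operator with (1 + D^2) Q^2 = 1. *)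
Definition is_inv_sqrt_resolvent D Q : Prop :=
  positive_operator Q /\
  forall x, exists y z, [/\ D (Q (Q x), y), D (y, z) & Q (Q x) + z = x].

Definition compact_resolvent D : Prop :=
  exists2 Q, is_inv_sqrt_resolvent D Q & compact_operator Q.

Definition bounded_commutator D T : Prop :=
  (forall x, dom D x -> dom D (T x)) /\
  exists M : R[i], forall x y z, D (x, y) -> D (T x, z) ->
    `|z - T y| <= M * `|x|.

End UnboundedOperators.

Section SpectralTriples.
Variable R : realType.

(* A triple on the C*-algebra st_alg, which is given inside an ambient
   C*-algebra E; the values of st_rep outside st_alg are irrelevant. *)
Record triple (E : cstarType R) (H : hilbertType R) := Triple {
  st_alg : set E;
  st_sub : set E;
  st_op : set (H * H);
  st_rep : E -> bop H
}.

Definition spectral_triple (E : cstarType R) (H : hilbertType R)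
    (t : triple E H) : Prop :=
  [/\ star_subalgebra (st_alg t) /\
        dense_star_subalgebra (st_sub t) (st_alg t),
      star_hom (st_alg t) (st_rep t),
      self_adjoint (st_op t),
      compact_resolvent (st_op t) &
      forall a, st_sub t a -> bounded_commutator (st_op t) (st_rep t a)].

Definition even_spectral_triple (E : cstarType R) (H : hilbertType R)
    (t : triple E H) (gamma : H -> H) : Prop :=
  [/\ spectral_triple t,
      linear gamma /\ involutive gamma,
      forall x y, inner (gamma x) (gamma y) = inner x y,
      forall a x, st_alg t a -> st_rep t a (gamma x) = gamma (st_rep t a x) &
      forall x y, st_op t (x, y) -> st_op t (gamma x, - gamma y)].

Definition pullback (E F : cstarType R) (H : hilbertType R)
    (f : E -> F) (s : triple E H) (t : triple F H) : Prop :=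
  [/\ star_hom (st_alg s) f /\ (forall a, st_alg s a -> st_alg t (f a)),
      dense_star_subalgebra (st_sub s) (st_alg s),
      forall a, st_sub s a -> st_sub t (f a),
      st_op s = st_op t &
      forall a, st_alg s a -> st_rep s a = st_rep t (f a)].

Definition restriction (E F : cstarType R) (H : hilbertType R)
    (f : E -> F) (s : triple E H) (t : triple F H) : Prop :=
  pullback f s t /\
  forall a b, st_alg s a -> st_alg s b -> f a = f b -> a = b.

End SpectralTriples.

(* The Hilbert space tensor product and l^2(G) are determined up to a unique
   compatible unitary by the following data; statements quantify over all
   models. *)
Record tensor_space (R : realType) (H K : hilbertType R) := TensorSpace {
  ts_space :> hilbertType R;
  ts_map : H -> K -> ts_space;
  ts_linearl : forall y, linear (ts_map^~ y);
  ts_linearr : forall x, linear (ts_map x);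
  ts_inner : forall x y x' y',
    inner (ts_map x y) (ts_map x' y') = inner x x' * inner y y';
  ts_dense : dense [set z : ts_space | exists n (x : 'I_n -> H) (y : 'I_n -> K),
    z = \sum_i ts_map (x i) (y i)]
}.

Record l2_space (R : realType) (G : groupType) := L2Space {
  l2_hilbert :> hilbertType R;
  l2_delta : G -> l2_hilbert;
  l2_orthonormal : forall x y, inner (l2_delta x) (l2_delta y) = (x == y)%:R;
  l2_dense : dense [set z : l2_hilbert |
    exists n (c : 'I_n -> R[i]) (x : 'I_n -> G),
      z = \sum_i c i *: l2_delta (x i)]
}.

Section Tensor.
Variables (R : realType) (H K : hilbertType R) (t : tensor_space H K).

(* The operator S (x) T. *)
Definition optens (S : bop H) (T : bop K) : bop t :=
  xget 0 [set W : bop t |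
    forall x y, W (ts_map t x y) = ts_map t (S x) (T y)].

Definition alg_tensor (A : set (bop H)) (B : set (bop K)) : set (bop t) :=
  [set W | exists n (a : 'I_n -> bop H) (b : 'I_n -> bop K),
    [/\ forall i, A (a i), forall i, B (b i) &
        W = \sum_i optens (a i) (b i)]].

(* As A and B are represented faithfully, the minimal C*-norm is the operator
   norm on the Hilbert space tensor product. *)
Definition min_tensor (A : set (bop H)) (B : set (bop K)) : set (bop t) :=
  closure (alg_tensor A B).

(* D1 (x) 1 + c (1 (x) D2) on the algebraic tensor product of the domains. *)
Definition tensor_sum (D1 : set (H * H)) (D2 : set (K * K)) (c : R[i]) :
    set (t * t) :=
  [set p | exists n (x x' : 'I_n -> H) (y y' : 'I_n -> K),
    [/\ forall i, D1 (x i, x' i), forall i, D2 (y i, y' i),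
        p.1 = \sum_i ts_map t (x i) (y i) &
        p.2 = \sum_i (ts_map t (x' i) (y i) + c *: ts_map t (x i) (y' i))]].

(* The closure of the matrix (0, D1 (x) 1 - i 1 (x) D2;
   D1 (x) 1 + i 1 (x) D2, 0). *)
Definition product_operator (D1 : set (H * H)) (D2 : set (K * K)) :
    set (hsum t t * hsum t t) :=
  closure [set p : hsum t t * hsum t t |
    tensor_sum D1 D2 (- 'i%C) (p.1.2, p.2.1) /\
    tensor_sum D1 D2 'i%C (p.1.1, p.2.2)].

Definition standard_grading (x : hsum t t) : hsum t t := (x.1, - x.2).

End Tensor.

Arguments product_operator {R H K} t D1 D2 _.
Arguments standard_grading {R H K} t x.

(* t is the exterior product of t1 and t2.  Its representation is the
   continuous extension to A1 (x) A2 of two copies of the tensor product of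
   the representations. *)
Definition exterior_product (R : realType) (K1 K2 H1 H2 : hilbertType R)
    (K : tensor_space K1 K2) (H : tensor_space H1 H2)
    (t1 : triple (bop K1) H1) (t2 : triple (bop K2) H2)
    (t : triple (bop K) (hsum H H)) : Prop :=
  [/\ st_alg t = min_tensor (st_alg t1) (st_alg t2),
      st_sub t = alg_tensor (st_sub t1) (st_sub t2),
      st_op t = product_operator H (st_op t1) (st_op t2),
      star_hom (st_alg t) (st_rep t) /\
        {within st_alg t, continuous (st_rep t)} &
      forall a b x y x' y', st_alg t1 a -> st_alg t2 b ->
        st_rep t (optens K a b) (ts_map H x y, ts_map H x' y') =
        (ts_map H (st_rep t1 a x) (st_rep t2 b y),
         ts_map H (st_rep t1 a x') (st_rep t2 b y'))].

Section TwistedSystems.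
Variables (R : realType) (A : cstarType R) (G : groupType).
Variables (rho : G -> A -> A) (sigma : G -> G -> A).

Definition twisted_system : Prop :=
  [/\ forall x, star_hom setT (rho x) /\ bijective (rho x),
      forall x y, unitary (sigma x y),
      forall x y z, rho x (sigma y z) =
        sigma x y ** sigma (x * y)%g z ** star (sigma x (y * z)%g),
      forall x y a, rho x (rho y a) =
        sigma x y ** rho (x * y)%g a ** star (sigma x y) &
      (forall x, sigma x 1%g = cone /\ sigma 1%g x = cone) /\
        (forall a, rho 1%g a = a)].

Definition smooth_system (A0 : set A) : Prop :=
  (forall x, rho x @` A0 = A0) /\ (forall x y, A0 (sigma x y)).

(* As A is unital, a representation is non-degenerate iff it is unital. *)
Definition twisted_covariant (H : hilbertType R)
    (pi : A -> bop H) (U : G -> bop H) : Prop :=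
  [/\ star_hom setT pi,
      forall x, unitary (U x),
      forall x y, U x ** U y = pi (sigma x y) ** U (x * y)%g &
      forall x a, pi (rho x a) = U x ** pi a ** star (U x)].

Definition equivariant_spectral_triple (H : hilbertType R) (A0 : set A)
    (D : set (H * H)) (pi : A -> bop H) (U : G -> bop H) : Prop :=
  [/\ spectral_triple (Triple setT A0 D pi),
      twisted_covariant pi U &
      forall g, bounded_commutator D (U g)].

(* C_c(G, A0), as a set of functions. *)
Definition Cc (A0 : set A) : set (G -> A) :=
  [set f | finite_set [set x | f x <> 0] /\ forall x, A0 (f x)].

Definition single (a : A) (x : G) : G -> A := fun y => if y == x then a else 0.

Definition conv (f g : G -> A) : G -> A := fun z =>
  \sum_(x \in [set: G]) (f x ** rho x (g (x^-1 * z)%g) ** sigma x (x^-1 * z)%g).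

Definition convstar (f : G -> A) : G -> A := fun x =>
  star (sigma x x^-1%g) ** rho x (star (f x^-1%g)).

Definition Cc_representation (K : hilbertType R)
    (Theta : (G -> A) -> bop K) : Prop :=
  [/\ Theta (single cone 1%g) = cone,
      forall (k : R[i]) f g, Cc setT f -> Cc setT g ->
        Theta (fun x => k *: f x + g x) = k *: Theta f + Theta g,
      forall f g, Cc setT f -> Cc setT g ->
        Theta (conv f g) = Theta f ** Theta g &
      forall f, Cc setT f -> Theta (convstar f) = star (Theta f)].

(* Cauchy sequences of C_c(G, A) for the norm of its enveloping C*-algebra,
   the supremum of the norms in all its *-representations. *)
Definition full_cauchy (f : nat -> G -> A) : Prop :=
  (forall n, Cc setT (f n)) /\
  forall e : R, 0 < e -> exists N, forall m n, (N <= m)%N -> (N <= n)%N ->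
    forall (K : hilbertType R) (Theta : (G -> A) -> bop K),
      Cc_representation Theta ->
      `|Theta (fun x => f m x - f n x)| <= e%:C.

(* The image of the full crossed product, i.e. of the completion of C_c(G, A)
   for the enveloping norm, under the extension of Theta. *)
Definition full_image (K : hilbertType R) (Theta : (G -> A) -> bop K) :
    set (bop K) :=
  [set T | exists2 f, full_cauchy f & (fun n => Theta (f n)) @ \oo --> T].

Definition integrated (H : hilbertType R) (pi : A -> bop H) (U : G -> bop H)
    (f : G -> A) : bop H :=
  \sum_(x \in [set: G]) (pi (f x) ** U x).

Section Regular.
Variables (H : hilbertType R) (l2 : l2_space R G) (L : tensor_space H l2).
Variable pi : A -> bop H.

Local Notation delta := (l2_delta l2).

Definition regular_op (a : A) (x : G) : bop L :=
  xget 0 [set W : bop L | forall xi y, W (ts_map L xi (delta y)) =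
    ts_map L (pi (rho (y^-1 * x^-1)%g a ** sigma (y^-1 * x^-1)%g x) xi)
             (delta (x * y)%g)].

Definition regular (f : G -> A) : bop L :=
  \sum_(x \in [set: G]) regular_op (f x) x.

Definition reduced_crossed_product : set (bop L) := full_image regular.

End Regular.

End TwistedSystems.

Arguments reduced_crossed_product {R A G} rho sigma {H l2} L pi _.

Section GroupAlgebra.
Variables (R : realType) (G : groupType) (l2 : l2_space R G).

Definition left_translation (g : G) : bop l2 :=
  xget 0 [set W : bop l2 |
    forall x, W (l2_delta l2 x) = l2_delta l2 (g * x)%g].

Definition group_algebra : set (bop l2) :=
  [set T | exists n (c : 'I_n -> R[i]) (g : 'I_n -> G),
    T = \sum_i c i *: left_translation (g i)].

Definition reduced_group_algebra : set (bop l2) := closure group_algebra.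

Section Length.
Variables (V : hilbertType R) (ell : G -> bop V) (LV : tensor_space l2 V).

Definition finite_dimensional : Prop :=
  exists n (e : 'I_n -> V), forall v, exists c : 'I_n -> R[i],
    v = \sum_i c i *: e i.

Definition translation_bounded : Prop :=
  forall y, exists M : R[i], forall x, `|ell x - ell (y^-1 * x)%g| <= M.

(* The values of ell are self-adjoint, so that their spectra are real. *)
Definition proper_function : Prop :=
  [/\ forall g, ell g = 0 <-> g = 1%g,
      forall a b : R, finite_set [set t : R |
        [/\ a <= t, t <= b & exists x, spectrum (ell x) t%:C]] &
      forall t : R, (exists x, spectrum (ell x) t%:C) ->
        finite_set [set x | spectrum (ell x) t%:C]].

(* M_ell on the algebraic tensor product of C_c(G) and V. *)
Definition multiplication : set (LV * LV) :=
  [set p | exists n (x : 'I_n -> G) (v : 'I_n -> V),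
    p.1 = \sum_i ts_map LV (l2_delta l2 (x i)) (v i) /\
    p.2 = \sum_i ts_map LV (l2_delta l2 (x i)) (ell (x i) (v i))].

(* (C_c(G), l^2(G) (x) V, M_ell, lambda) *)
Definition length_triple : triple (bop l2) LV :=
  Triple reduced_group_algebra group_algebra (closure multiplication)
    (fun c => optens LV c cone).

End Length.
End GroupAlgebra.

Arguments multiplication {R G l2 V} ell LV _.

Section EquivariantConstruction.
Variables (R : realType) (A : cstarType R) (G : groupType).
Variables (rho : G -> A -> A) (sigma : G -> G -> A).
Variables (H V : hilbertType R) (A0 : set A) (D : set (H * H)).
Variables (pi : A -> bop H) (U : G -> bop H) (ell : G -> bop V).
Variables (l2 : l2_space R G) (L : tensor_space H l2) (LV : tensor_space l2 V).
Variable W : tensor_space H LV.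

Local Notation delta := (l2_delta l2).
Local Notation Lambda := (regular rho sigma L pi).
Local Notation Ared := (reduced_crossed_product rho sigma L pi).

(* (calB, H, D) *)
Definition image_triple : triple (bop H) H :=
  Triple (full_image rho sigma (integrated pi U))
    (integrated pi U @` Cc A0) D idfun.

(* s is the triple (C_c(G, calA), H~, D~, pi^ x L^) on the reduced crossed
   product, with H (x) l^2(G) (x) V bracketed as W = H (x) (l^2(G) (x) V).
   Its representation is the continuous extension of the formula on a delta_h,
   whose image in the reduced crossed product is Lambda (single a h). *)
Definition equivariant_construction (s : triple (bop L) (hsum W W)) : Prop :=
  [/\ st_alg s = Ared,
      st_sub s = Lambda @` Cc A0,
      st_op s = product_operator W D (multiplication ell LV),
      star_hom Ared (st_rep s) /\ {within Ared, continuous (st_rep s)} &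
      forall a h xi x v xi' x' v',
        st_rep s (Lambda (single a h))
          (ts_map W xi (ts_map LV (delta x) v),
           ts_map W xi' (ts_map LV (delta x') v')) =
        (ts_map W ((pi a ** U h) xi) (ts_map LV (delta (h * x)%g) v),
         ts_map W ((pi a ** U h) xi') (ts_map LV (delta (h * x')%g) v'))].

(* psi is the *-homomorphism psi_A. *)
Definition is_psiA (psi : bop L -> bop L) : Prop :=
  [/\ star_hom Ared psi,
      {within Ared, continuous psi} &
      forall a g, psi (Lambda (single a g)) =
        optens L (pi a ** U g) (left_translation l2 g)].

End EquivariantConstruction.

(* Main.v *)
(* A symmetric operator with an orthonormal basis of eigenvectors in its domain, finitely many
   eigenvalues lying in each bounded set, has a self-adjoint closure with compact resolvent;
   conversely, a self-adjoint operator with compact resolvent has such a basis. M_ell has one,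
   obtained by diagonalising each matrix ell(x), and bases (e_i), (f_j) for D1, D2 with
   eigenvalues s_i, r_j give one for the product of D1 and D2, with eigenvalues
   +-sqrt (s_i^2 + r_j^2). Bounded commutators are computed one tensor factor at a time, on the
   core, and survive closure; the product of D with M_ell equals its product with the closure
   of M_ell.

   Fell absorption: the unitary W (xi (x) delta_y) = U_{y^-1}^* xi (x) delta_y conjugates the
   regular representation into a delta_g |-> pi(a) U_g (x) lambda_g. Hence T |-> W T W^* is an
   injective *-homomorphism realising psi_A. Any representation as in the equivariant
   construction, or in the exterior product composed with psi_A, sends T to two copies of
   W T W^* (x) 1_V, because both sides are continuous and agree on the dense subalgebra
   C_c(G, A). *)

Require Import Defs.
From HB Require Import structures.
From mathcomp Require Import all_boot all_order all_algebra.
From mathcomp Require Import complex.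
From mathcomp Require Import mathcomp_extra boolp classical_sets functions.
From mathcomp Require Import cardinality fsbigop reals topology normedtype.
From mathcomp Require Import ring lra.

Set Implicit Arguments.
Unset Strict Implicit.
Unset Printing Implicit Defensive.

Import Order.TTheory GRing.Theory Num.Theory numFieldNormedType.Exports.

Local Open Scope classical_set_scope.
Local Open Scope complex_scope.
Local Open Scope ring_scope.
Local Open Scope cstar_scope.

(* [bop] asks for an adjoint, while [optens], [left_translation] and [regular_op] are picked by
   [xget]. Each such operator must therefore be constructed before its formula can be used: it is
   given by a bounded linear relation on a total set and extended by continuity, and its adjoint
   comes from Riesz. Eigenbases stand in for functional calculus: one basis settles both
   self-adjointness and compactness of the resolvent of the product, without a theory of commuting
   unbounded operators. The crossed products consist of limits along sequences that are Cauchy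
   uniformly over all representations of C_c(G, A), so every estimate has to be uniform in the
   representation. The source of uniformity is that a representation of an abstract C*-algebra is
   contractive, which gives the bound of |Theta f| by the sum of the |f x|. Fell's unitary serves
   twice: it realises psi_A, and it exhibits the regular representation as the integrated form of a
   covariant pair, hence as a representation of C_c(G, A). *)
#[global] Hint Extern 0 (is_true (0 <= rnorm _)) => exact: rnorm_ge0 : core.
#[global] Hint Extern 0 (is_true (0 <= bnorm _)) => exact: bnorm_ge0 : core.

Implicit Types R : realType.

(** * Norms, closures and spans *)

Section Norm.
Variables (R : realType) (V : normedModType R[i]).
Implicit Types (x y : V) (S : set V).

Lemma rnormN x : rnorm (- x) = rnorm x.
Proof. by rewrite /rnorm normrN. Qed.

Lemma rnormB x y : rnorm (x - y) <= rnorm x + rnorm y.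
Proof. by rewrite -[rnorm y]rnormN rnormD. Qed.

Lemma rnorm_sum (I : Type) (s : seq I) (P : pred I) (F : I -> V) :
  rnorm (\sum_(i <- s | P i) F i) <= \sum_(i <- s | P i) rnorm (F i).
Proof.
elim/big_ind2: _ => [|x a y b xa yb|//]; first by rewrite rnorm0.
exact: le_trans (rnormD _ _) (lerD xa yb).
Qed.

Lemma rnorm_gt0 x : x <> 0 -> 0 < rnorm x.
Proof.
move=> x0; rewrite lt_neqAle rnorm_ge0 andbT.
by apply/eqP => /esym/rnorm_eq0.
Qed.

Lemma rnorm_small x : (forall e, 0 < e -> rnorm x < e) -> x = 0.
Proof.
move=> xe; apply: contrapT => /rnorm_gt0 x0.
by have := xe _ x0; rewrite ltxx.
Qed.

Lemma rball_nbhs x (e : R) : 0 < e -> nbhs x [set y | rnorm (x - y) < e].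
Proof.
by move=> e0; have /real_cvgP := @cvg_id _ (nbhs x); apply.
Qed.

Lemma nbhs_rball x (A : set V) :
  nbhs x A <-> exists2 e : R, 0 < e & [set y | rnorm (x - y) < e] `<=` A.
Proof.
split=> [|[e e0 eA]]; last by apply: filterS eA _; exact: rball_nbhs.
move=> /nbhs_normP[e /= e0 eA].
have eE : e = (complex.Re e)%:C by rewrite RRe_real// gtr0_real.
exists (complex.Re e); first by rewrite -ltcR -eE.
by move=> y /= xy; apply: eA; move: xy; rewrite /ball_/= rnorm_lt -eE.
Qed.

Lemma closureP S x :
  closure S x <-> forall e : R, 0 < e -> exists2 y, S y & rnorm (x - y) < e.
Proof.
split=> [Sx e e0|Sx B /nbhs_rball[e e0 eB]].
  by have [y [Sy xy]] := Sx _ (rball_nbhs x e0); exists y.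
by have [y Sy xy] := Sx e e0; exists y; split => //; exact: eB.
Qed.

Lemma denseP S :
  dense S <-> forall x (e : R), 0 < e -> exists2 y, S y & rnorm (x - y) < e.
Proof.
split=> [Sd x e e0|Sd O [x Ox] Oo]; last first.
  have [e e0 eO] := (nbhs_rball x O).1 (open_nbhs_nbhs (conj Oo Ox)).
  by have [y Sy xy] := Sd x e e0; exists y; split => //; exact: eO.
have [||y [xy Sy]] := Sd [set y | rnorm (x - y) < e]%classic°.
- by exists x; exact: rball_nbhs.
- exact: open_interior.
- by exists y => //; exact: interior_subset xy.
Qed.

Lemma dense_closure S : dense S <-> forall x, closure S x.
Proof.
by split=> [/denseP Sd x|Sd]; [apply/closureP; exact: Sd|
  apply/denseP => x; exact/closureP].
Qed.

End Norm.

Lemma rcauchy_cvg R (V : completeNormedModType R[i])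
    (u : nat -> V) :
  (forall e : R, 0 < e -> exists N, forall m n, (N <= m)%N -> (N <= n)%N ->
    rnorm (u m - u n) < e) ->
  exists l, forall e : R, 0 < e -> exists N, forall n, (N <= n)%N ->
    rnorm (l - u n) < e.
Proof.
move=> uc; have : cauchy (u @ \oo).
  apply/real_cauchyP => e e0; have [N uN] := uc e e0.
  by exists (u N); exists N => // n /= Nn; exact: uN.
move/cauchy_cvg/cvg_ex => [l /real_cvgP ul]; exists l => e e0.
by have [N _ uN] := ul e e0; exists N => n Nn; exact: uN.
Qed.

Lemma inv_small R (e : R) : 0 < e ->
  exists N, forall n, (N <= n)%N -> n.+1%:R^-1 < e.
Proof.
move=> e0; exists (Num.truncn e^-1) => n Nn.
rewrite invf_plt ?posrE//; apply: lt_le_trans (truncnS_gt _) _.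
by rewrite ler_nat ltnS.
Qed.

Lemma closure_pairP R (V W : normedModType R[i])
    (S : set (V * W)) x y :
  closure S (x, y) <-> forall e : R, 0 < e ->
    exists p, [/\ S p, rnorm (x - p.1) < e & rnorm (y - p.2) < e].
Proof.
split=> [Sxy e e0|Sxy B].
  have [|p [Sp [/= xp yp]]] :=
      Sxy ([set v | rnorm (x - v) < e] `*` [set w | rnorm (y - w) < e]).
    by exists ([set v | rnorm (x - v) < e], [set w | rnorm (y - w) < e]);
      [split; exact: rball_nbhs|].
  by exists p.
case=> -[P Q] /= [/nbhs_rball[d d0 dP] /nbhs_rball[e e0 eQ]] PQB.
have m0 : 0 < Num.min d e by rewrite lt_min d0.
have [p [Sp xp yp]] := Sxy _ m0; exists p; split => //.
apply: PQB; split; [apply: dP|apply: eQ] => /=.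
- by apply: lt_le_trans xp _; rewrite ge_min lexx.
- by apply: lt_le_trans yp _; rewrite ge_min lexx orbT.
Qed.

Section Span.
Variables (R : realType) (V : lmodType R[i]).
Implicit Types (S : set V).

Definition span S : set V := [set z | exists n (c : 'I_n -> R[i]) (f : 'I_n -> V),
  (forall i, S (f i)) /\ z = \sum_i c i *: f i].

Definition linear_set S : Prop :=
  S 0 /\ forall (a : R[i]) x y, S x -> S y -> S (a *: x + y).

Lemma linear_setD S x y : linear_set S -> S x -> S y -> S (x + y).
Proof. by move=> [_ Sl] Sx Sy; rewrite -[x]scale1r; exact: Sl. Qed.

Lemma linear_setZ S a x : linear_set S -> S x -> S (a *: x).
Proof. by move=> [S0 Sl] Sx; rewrite -[_ *: _]addr0; exact: Sl. Qed.

Lemma linear_setN S x : linear_set S -> S x -> S (- x).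
Proof. by move=> Sl Sx; rewrite -scaleN1r; exact: linear_setZ. Qed.

Lemma linear_setB S x y : linear_set S -> S x -> S y -> S (x - y).
Proof. by move=> Sl Sx Sy; apply: linear_setD => //; exact: linear_setN. Qed.

Lemma linear_set_sum S (I : Type) (s : seq I) (P : pred I) (F : I -> V) :
  linear_set S -> (forall i, P i -> S (F i)) -> S (\sum_(i <- s | P i) F i).
Proof.
move=> Sl SF; elim/big_ind: _ => //; first exact: (proj1 Sl).
by move=> x y; exact: linear_setD.
Qed.

Lemma span_min S T : linear_set T -> S `<=` T -> span S `<=` T.
Proof.
move=> Tl ST _ [n [c [f [Sf ->]]]]; apply: linear_set_sum => // i _.
by apply: linear_setZ => //; exact: ST.
Qed.

Lemma span_linear S : linear_set (span S).
Proof.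
split; first by exists 0%N, (fun=> 0), (fun=> 0); split=> [[]//|]; rewrite big_ord0.
move=> a _ _ [n [c [f [Sf ->]]]] [m [d [g [Sg ->]]]].
exists (n + m)%N, (fun i : 'I_(n + m) => match fintype.split i with inl j => a * c j | inr j => d j end),
  (fun i : 'I_(n + m) => match fintype.split i with inl j => f j | inr j => g j end).
split=> [i|]; first by case: fintype.split.
rewrite big_split_ord/= scaler_sumr; congr (_ + _); apply: eq_bigr => i _.
  by rewrite -[lshift m i]/(unsplit (inl i)) unsplitK scalerA.
by rewrite -[rshift n i]/(unsplit (inr i)) unsplitK.
Qed.

Lemma sub_span S : S `<=` span S.
Proof.
move=> x Sx; exists 1%N, (fun=> 1), (fun=> x); split=> //.
by rewrite big_ord1 scale1r.
Qed.

Lemma span_mono S T : S `<=` span T -> span S `<=` span T.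
Proof. by move=> ST; apply: span_min => //; exact: span_linear. Qed.

End Span.
#[global] Hint Resolve span_linear : core.

Section LinearFun.
Variables (R : realType) (V W : lmodType R[i]).
Implicit Types f : V -> W.

Lemma linear_fun0 f :
  linear f -> f 0 = 0.
Proof.
by move=> fl; have := fl (-1) 0 0; rewrite scaler0 addr0 scaleN1r => ->; rewrite addNr.
Qed.

Lemma linear_funD f :
  linear f -> {morph f : x y / x + y}.
Proof. by move=> fl x y; rewrite -[x in LHS]scale1r fl scale1r. Qed.

Lemma linear_funZ f a x :
  linear f -> f (a *: x) = a *: f x.
Proof. by move=> fl; rewrite -[a *: x]addr0 fl linear_fun0// addr0. Qed.

Lemma linear_funB f :
  linear f -> {morph f : x y / x - y}.
Proof.
by move=> fl x y; rewrite linear_funD// -scaleN1r linear_funZ// scaleN1r.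
Qed.

Lemma linear_fun_sum f (I : Type) (s : seq I) (P : pred I) (F : I -> V) :
  linear f -> f (\sum_(i <- s | P i) F i) = \sum_(i <- s | P i) f (F i).
Proof.
by move=> fl; apply: big_morph; [exact: linear_funD|exact: linear_fun0].
Qed.

Lemma span_image f (S : set V) (T : set W) :
  linear f -> linear_set T -> (forall x, S x -> T (f x)) ->
  forall x, span S x -> T (f x).
Proof.
move=> fl [T0 Tl] ST x.
apply: (@span_min _ _ S (f @^-1` T)) => //.
split; first by rewrite /preimage/= linear_fun0.
by move=> a y z; rewrite /preimage/= fl; exact: Tl.
Qed.

End LinearFun.

Lemma closure_linear R (V : normedModType R[i]) (S : set V) :
  linear_set S -> linear_set (closure S).
Proof.
move=> [S0 Sl]; split; first exact: subset_closure.
move=> a x y /closureP Sx /closureP Sy; apply/closureP => e e0.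
set k := complex.Re `|a|.
have k0 : 0 <= k by rewrite -ler0c rc_norm.
have ke : 0 < e / 2 / (k + 1) by rewrite !divr_gt0// ltr_wpDl.
have [x' Sx' xx'] := Sx _ ke; have [y' Sy' yy'] := Sy (e / 2) (divr_gt0 e0 (ltr0Sn _ 1)).
exists (a *: x' + y'); first exact: Sl.
rewrite opprD addrACA -scalerBr; apply: le_lt_trans (rnormD _ _) _.
rewrite [ltRHS]splitr ler_ltD// rnormZ.
move: xx'; rewrite ltr_pdivlMr ?ltr_wpDl// => /ltW; apply: le_trans.
by rewrite mulrC ler_wpM2l// lerDl.
Qed.

Section PairSums.
Variables (R : realType) (V W : lmodType R[i]).

Lemma fst_sum (I : Type) (s : seq I) (P : pred I) (F : I -> V * W) :
  (\sum_(i <- s | P i) F i).1 = \sum_(i <- s | P i) (F i).1.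
Proof. exact: (big_morph fst). Qed.

Lemma snd_sum (I : Type) (s : seq I) (P : pred I) (F : I -> V * W) :
  (\sum_(i <- s | P i) F i).2 = \sum_(i <- s | P i) (F i).2.
Proof. exact: (big_morph snd). Qed.

Lemma linear_set_fst (S : set (V * W)) : linear_set S -> linear_set [set p.1 | p in S].
Proof.
move=> [S0 Sl]; split; first by exists 0.
by move=> a _ _ [p Sp <-] [q Sq <-]; exists (a *: p + q) => //; exact: Sl.
Qed.

End PairSums.

Lemma dense_span_mono R (V : normedModType R[i]) (S T : set V) :
  S `<=` span T -> dense (span S) -> dense (span T).
Proof.
move=> ST /denseP Sd; apply/denseP => x e /(Sd x)[y Sy xy].
by exists y => //; exact: span_mono Sy.
Qed.

Lemma dense_spanT R (V : normedModType R[i]) : dense (span (setT : set V)).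
Proof. by apply/dense_closure => x; apply: subset_closure; exact: sub_span. Qed.

Lemma dense_span_fst R (V W : normedModType R[i]) (S : set (V * W)) :
  dense (span [set p.1 | p in S]) -> dense [set p.1 | p in span S].
Proof.
move=> /denseP Sd; apply/denseP => x e /(Sd x)[y Sy xy]; exists y => //.
move: y Sy {xy}; apply: span_min; first exact/linear_set_fst/span_linear.
by move=> _ [p Sp <-]; exists p => //; exact: sub_span.
Qed.

(** * Extension of densely defined bounded linear relations *)

Section Extension.
Variables (R : realType) (X : normedModType R[i]) (Y : completeNormedModType R[i]).
Variables (Gam : set (X * Y)) (M : R).
Hypotheses (Gl : linear_set Gam) (M0 : 0 <= M)
  (Gd : dense [set p.1 | p in Gam])
  (GM : forall p, Gam p -> rnorm p.2 <= M * rnorm p.1).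

Let Gap x y := forall e : R, 0 < e ->
  exists p, [/\ Gam p, rnorm (x - p.1) < e & rnorm (y - p.2) < e].

Let Gap_bound x y : Gap x y -> rnorm y <= M * rnorm x.
Proof.
move=> xy; apply/ler_addgt0Pr => e e0.
have M1 : 0 < M + 1 by rewrite ltr_wpDl.
have [p [Gp xp yp]] := xy _ (divr_gt0 e0 M1).
have <- : e / (M + 1) + M * (e / (M + 1)) = e by field; rewrite gt_eqF.
rewrite addrCA -mulrDr -[y](subrK p.2); apply: le_trans (rnormD _ _) _.
rewrite lerD ?(ltW yp)//; apply: le_trans (GM Gp) _.
rewrite ler_wpM2l// addrC -[p.1](subrK x); apply: le_trans (rnormD _ _) _.
by rewrite lerD2r rdistC ltW.
Qed.

Let Gap_lin a x y x' y' : Gap x y -> Gap x' y' -> Gap (a *: x + x') (a *: y + y').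
Proof.
move=> xy xy'.
have : closure Gam (a *: (x, y) + (x', y')).
  by apply: (closure_linear Gl).2; apply/closure_pairP.
by move/closure_pairP.
Qed.

Let Gap_ex x : exists y, Gap x y.
Proof.
have M1 : 0 < M + 1 by rewrite ltr_wpDl.
have /choice[p pP] : forall n : nat, exists p, Gam p /\ rnorm (x - p.1) < n.+1%:R^-1.
  move=> n; have /denseP/(_ x n.+1%:R^-1) := Gd.
  by case=> [|_ [p Gp <-] xp]; [rewrite invr_gt0|exists p].
have pc (e : R) : 0 < e -> exists N, forall n, (N <= n)%N -> rnorm (x - (p n).1) < e.
  move=> /inv_small[N Ne]; exists N => n /Ne; apply: lt_trans.
  by have [] := pP n.
have [e e0|y yc] := @rcauchy_cvg _ Y (fun n => (p n).2).
  have eM : 0 < e / 2 / (M + 1) by rewrite !divr_gt0.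
  have [N NE] := pc _ eM; exists N => m n /NE xm /NE xn.
  have Gmn : Gam (p m - p n) by apply: linear_setB; [|have [] := pP m|have [] := pP n].
  apply: le_lt_trans (GM Gmn) _; rewrite /=.
  have mn : rnorm ((p m).1 - (p n).1) < e / (M + 1).
    apply: le_lt_trans (rdistD x _ _) _; rewrite rdistC.
    have -> : e / (M + 1) = e / 2 / (M + 1) + e / 2 / (M + 1).
      by rewrite -mulrDl -splitr.
    exact: ltrD.
  apply: (@le_lt_trans _ _ ((M + 1) * rnorm ((p m).1 - (p n).1))).
    by rewrite ler_wpM2r// lerDl.
  by rewrite mulrC -ltr_pdivlMr.
exists y => e e0; have [N1 N1e] := pc e e0; have [N2 N2e] := yc e e0.
exists (p (maxn N1 N2)); split; first by have [] := pP (maxn N1 N2).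
  by apply: N1e; rewrite leq_maxl.
by apply: N2e; rewrite leq_maxr.
Qed.

(** The extension is the closure of the relation [Gam]: total by density and completeness, single
    valued because the bound passes to the closure and forces y = 0 over x = 0. Hence a map
    prescribed on generators needs no separate proof of well-definedness; the norm estimate on
    combinations does that work. *)
Lemma bounded_extension : exists f : X -> Y, [/\ linear f,
  forall x, rnorm (f x) <= M * rnorm x & forall p, Gam p -> f p.1 = p.2].
Proof.
have [f fP] := choice Gap_ex.
have uniq x y y' : Gap x y -> Gap x y' -> y = y'.
  move=> xy xy'; have := Gap_bound (Gap_lin (-1) xy xy').
  rewrite !scaleN1r addNr rnorm0 mulr0 addrC => h; apply/esym/eqP.
  by rewrite -subr_eq0; apply/eqP/rnorm_eq0/eqP; rewrite eq_le h rnorm_ge0.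
exists f; split=> [a x y|x|p Gp].
- by apply: (uniq _ _ _ (fP _)); exact: Gap_lin.
- exact: Gap_bound.
- by apply: (uniq _ _ _ (fP _)) => e e0; exists p; rewrite !subrr !rnorm0.
Qed.

End Extension.

(** * Hilbert spaces *)

Lemma sqr_rnorm_le R (a b : R) : 0 <= a -> 0 <= b -> a ^+ 2 <= b ^+ 2 -> a <= b.
Proof. by move=> a0 b0; rewrite ler_pXn2r// nnegrE. Qed.

Lemma rnorm_le_sqr R (V W : normedModType R[i]) (x : V) (M : R) (y : W) : 0 <= M ->
  rnorm x ^+ 2 <= M ^+ 2 * rnorm y ^+ 2 -> rnorm x <= M * rnorm y.
Proof.
move=> M0 h; apply: sqr_rnorm_le; rewrite ?mulr_ge0//.
by rewrite exprMn.
Qed.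

Section RealInner.
Variables (R : realType) (H : hilbertType R).
Implicit Types x y z : H.

Lemma inner_xx x : inner x x = (rnorm x ^+ 2)%:C.
Proof. by rewrite inner_norm rnormE rcX. Qed.

Lemma Re_inner_xx x : complex.Re (inner x x) = rnorm x ^+ 2.
Proof. by rewrite inner_xx. Qed.

Lemma inner_normalize x : x <> 0 ->
  inner ((rnorm x)^-1%:C *: x) ((rnorm x)^-1%:C *: x) = 1.
Proof.
move=> /rnorm_gt0 x0; rewrite innerZl innerZr inner_xx conjc_real -!rcM mulrA -expr2 -exprMn.
by rewrite mulVf ?gt_eqF// expr1n.
Qed.

Lemma sqr_rnormD x y : rnorm (x + y) ^+ 2 =
  rnorm x ^+ 2 + rnorm y ^+ 2 + 2 * complex.Re (inner x y).
Proof.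
rewrite -!Re_inner_xx innerDl !innerDr !raddfD/= (inner_conj x y).
by case: (inner x y) => a b /=; ring.
Qed.

Lemma sqr_rnormB x y : rnorm (x - y) ^+ 2 =
  rnorm x ^+ 2 + rnorm y ^+ 2 - 2 * complex.Re (inner x y).
Proof.
by rewrite sqr_rnormD rnormN innerNr; case: (inner x y) => a b /=; ring.
Qed.

Lemma pythagoras x y : inner x y = 0 ->
  rnorm (x + y) ^+ 2 = rnorm x ^+ 2 + rnorm y ^+ 2.
Proof. by move=> xy; rewrite sqr_rnormD xy /= mulr0 addr0. Qed.

Lemma parallelogram x y :
  rnorm (x + y) ^+ 2 + rnorm (x - y) ^+ 2 = 2 * (rnorm x ^+ 2 + rnorm y ^+ 2).
Proof. by rewrite sqr_rnormD sqr_rnormB; ring. Qed.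

Lemma rCauchySchwarz x y : complex.Re `|inner x y| <= rnorm x * rnorm y.
Proof. by have := Defs.CauchySchwarz x y; rewrite -(rc_norm (inner x y)) !rnormE -rcM lecR. Qed.

Lemma inner_suml (I : Type) (s : seq I) (P : pred I) (F : I -> H) z :
  inner (\sum_(i <- s | P i) F i) z = \sum_(i <- s | P i) inner (F i) z.
Proof.
by apply: (big_morph (fun x => inner x z)) => [x y|]; rewrite ?innerDl ?inner0l.
Qed.

Lemma inner0r z : inner z 0 = 0.
Proof. by rewrite inner_conj inner0l rmorph0. Qed.

Lemma innerBl x y z : inner (x - y) z = inner x z - inner y z.
Proof. by rewrite innerDl innerNl. Qed.

Lemma innerBr x y z : inner z (x - y) = inner z x - inner z y.
Proof. by rewrite innerDr innerNr. Qed.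

Lemma inner_sumr (I : Type) (s : seq I) (P : pred I) (F : I -> H) z :
  inner z (\sum_(i <- s | P i) F i) = \sum_(i <- s | P i) inner z (F i).
Proof.
by apply: (big_morph (inner z)) => [x y|]; rewrite ?innerDr ?inner0r.
Qed.

Lemma inner_sym0 x y : inner x y = 0 -> inner y x = 0.
Proof. by move=> xy; rewrite inner_conj xy rmorph0. Qed.

Lemma closure_ortho (S : set H) y x :
  (forall z, S z -> inner z y = 0) -> closure S x -> inner x y = 0.
Proof.
move=> Sy /closureP Sx; apply: normr0_eq0; rewrite -rc_norm; congr _%:C.
apply/eqP; rewrite eq_le -ler0c rc_norm normr_ge0 andbT.
apply/ler_addgt0Pr => e e0; rewrite add0r.
have y1 : 0 < rnorm y + 1 by rewrite ltr_wpDl// rnorm_ge0.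
have [z Sz xz] := Sx _ (divr_gt0 e0 y1).
rewrite -[inner x y]subr0 -(Sy z Sz) -innerBl.
apply: le_trans (rCauchySchwarz _ _) _; move: xz; rewrite ltr_pdivlMr// => /ltW.
by apply: le_trans; rewrite ler_wpM2l// lerDl.
Qed.

Lemma dense_ortho (S : set H) x :
  dense S -> (forall z, S z -> inner z x = 0) -> x = 0.
Proof.
move=> /dense_closure Sd Sx; apply: inner_eq0 => y; apply: inner_sym0.
exact: closure_ortho Sx _.
Qed.

Lemma span_ortho (S : set H) y x :
  (forall z, S z -> inner z y = 0) -> span S x -> inner x y = 0.
Proof.
move=> Sy; apply: (@span_min _ _ S [set x | inner x y = 0]) => //.
split=> [|a u v /= u0 v0]; first exact: inner0l.
by rewrite inner_linear u0 v0 mulr0 addr0.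
Qed.

(** The projection theorem. A sequence in [M] minimising the distance to x is Cauchy by the
    parallelogram law, and x minus its limit p is orthogonal to [M], so x = p lies in the
    closure. *)
Lemma linear_dense (M : set H) : linear_set M ->
  (forall y, (forall m, M m -> inner y m = 0) -> y = 0) -> dense M.
Proof.
move=> Ml M0; apply/dense_closure => x.
pose d := inf [set rnorm (x - m) | m in M].
have hi : has_inf [set rnorm (x - m) | m in M].
  split; first by exists (rnorm (x - 0)), 0 => //; case: Ml.
  by exists 0 => _ [m _ <-]; exact: rnorm_ge0.
have dle m : M m -> d <= rnorm (x - m).
  by move=> Mm; apply: ge_inf; [case: hi|exists m].
have d0 : 0 <= d.
  by apply: lb_le_inf; [case: hi|move=> _ [m _ <-]; exact: rnorm_ge0].
have /choice[u uP] : forall n : nat,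
    exists m, M m /\ rnorm (x - m) < d + n.+1%:R^-1.
  move=> n; have [|_ [m Mm <-] md] := @inf_adherent _ _ n.+1%:R^-1 _ hi.
    by rewrite invr_gt0.
  by exists m.
have [e e0|p pu] := @rcauchy_cvg _ H u.
  (* If the distances to u m and u n are below d + b and d + a with a, b < 1, their squares are at
     most d^2 + b (2 d + 1) and d^2 + a (2 d + 1). As the midpoint is at distance at least d, the
     parallelogram law bounds |u m - u n|^2 by 2 (a + b) (2 d + 1), which is below e^2 once a and b
     are below e^2 / k. *)
  pose k := 4 * (2 * d + 1); have k0 : 0 < k by rewrite /k; lra.
  have m0 : 0 < Num.min 1 (e ^+ 2 / k) by rewrite lt_min ltr01 divr_gt0 ?exprn_gt0.
  have [N Ne] := inv_small m0; exists N => m n Nm Nn.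
  have [Mm dm] := uP m; have [Mn dn] := uP n.
  have mid : d <= rnorm (x - 2^-1 *: (u m + u n)).
    by apply: dle; apply: linear_setZ => //; exact: linear_setD.
  have := parallelogram (x - u m) (x - u n).
  have -> : x - u m - (x - u n) = u n - u m.
    by rewrite opprB addrC addrA subrK.
  have -> : x - u m + (x - u n) = 2%:R *: (x - 2^-1 *: (u m + u n)).
    rewrite scalerBr scalerA divff ?pnatr_eq0// scale1r scaler_nat mulr2n.
    by rewrite addrACA -opprD.
  have n2 : complex.Re `|2%:R : R[i]| = 2 by rewrite normr_nat -(rmorph_nat (real_complex R)).
  rewrite rnormZ n2 exprMn (rdistC (u n)).
  have := Ne _ Nm; have := Ne _ Nn; rewrite !lt_min !ltr_pdivlMr//.
  move=> /andP[a1 ak] /andP[b1 bk] h.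
  rewrite -(@ltr_pXn2r _ 2)// ?nnegrE ?(ltW e0)//.
  have sq r c : 0 <= r -> r < d + c -> c < 1 -> 0 <= c -> r ^+ 2 <= d ^+ 2 + c * (2 * d + 1).
    by move=> r0 rc c1 c0; have : r ^+ 2 <= (d + c) ^+ 2;
      [rewrite ler_pXn2r ?nnegrE//; lra|nra].
  have hm := sq _ _ (rnorm_ge0 _) dm b1 ltac:(by rewrite invr_ge0).
  have hn := sq _ _ (rnorm_ge0 _) dn a1 ltac:(by rewrite invr_ge0).
  have hd : d ^+ 2 <= rnorm (x - 2^-1 *: (u m + u n)) ^+ 2 by rewrite ler_pXn2r ?nnegrE.
  move: (n.+1%:R^-1) (m.+1%:R^-1) h hm hn hd ak bk => a b; rewrite /k.
  move: (rnorm (u m - u n)) (rnorm (x - u m)) (rnorm (x - u n)) (rnorm _) => t v w y.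
  lra.
have pM : closure M p.
  by apply/closureP => e /pu[N NE]; exists (u N); [case: (uP N)|exact: NE].
have dcl y : closure M y -> d <= rnorm (x - y).
  move=> /closureP My; apply/ler_addgt0Pr => e /My[m Mm ym]; apply: le_trans (dle m Mm) _.
  by apply: le_trans (rdistD y _ _) _; rewrite lerD2l ltW.
have px : rnorm (x - p) <= d.
  apply/ler_addgt0Pr => e e0; have e2 : 0 < e / 2 by rewrite divr_gt0.
  have [N1 N1e] := pu _ e2; have [N2 N2e] := inv_small e2.
  have [_] := uP (maxn N1 N2).
  have := N1e _ (leq_maxl N1 N2); have := N2e _ (leq_maxr N1 N2).
  have := rdistD (u (maxn N1 N2)) x p; rewrite (rdistC p).
  by move: (_.+1%:R^-1) => w; lra.
have -> : x = p; last exact: pM.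
apply: subr0_eq; apply: M0 => m Mm.
have [->|/eqP m0] := eqVneq m 0; first exact: inner0r.
(* The point p + c m still lies in the closure of [M], so it is no nearer to x than p; Pythagoras
   then forces c m = 0. *)
set c := inner (x - p) m / inner m m.
have mm : inner m m != 0 by rewrite inner_norm expf_neq0// normr_eq0; exact/eqP.
have xpE : x - p = (x - p - c *: m) + c *: m by rewrite subrK.
have : inner (x - p - c *: m) (c *: m) = 0.
  by rewrite innerZr innerBl innerZl /c divfK// subrr mulr0.
move=> /pythagoras; rewrite -xpE => h.
have : rnorm (x - p) <= rnorm (x - p - c *: m).
  apply: le_trans px _; rewrite -addrA -opprD; apply: dcl.
  by apply: linear_setD (closure_linear Ml) pM _; apply: subset_closure; exact: linear_setZ.
rewrite -(@ler_pXn2r _ 2) ?nnegrE// h gerDl => cm.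
have /eqP : rnorm (c *: m) ^+ 2 = 0 by apply/eqP; rewrite eq_le cm sqr_ge0.
rewrite expf_eq0/= => /eqP/rnorm_eq0/eqP; rewrite scaler_eq0 => /orP[|/eqP//].
by rewrite mulf_eq0 invr_eq0 (negbTE mm) orbF => /eqP.
Qed.

(** If only 0 is orthogonal to the kernel, the kernel is dense and phi vanishes. Otherwise take y <>
    0 orthogonal to it: x - (phi x / phi y) y lies in the kernel for every x, and pairing with y
    gives phi x. *)
Lemma riesz (phi : H -> R[i]) (M : R) :
  (forall a x y, phi (a *: x + y) = a * phi x + phi y) -> 0 <= M ->
  (forall x, complex.Re `|phi x| <= M * rnorm x) ->
  exists y, forall x, phi x = inner x y.
Proof.
move=> pl M0 pM.
have p0 : phi 0 = 0 by have := pl (-1) 0 0; rewrite scaler0 addr0 mulN1r addNr.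
have pZ a x : phi (a *: x) = a * phi x by rewrite -[_ *: _]addr0 pl p0 addr0.
have pB x y : phi (x - y) = phi x - phi y.
  by rewrite addrC -scaleN1r pl mulN1r addrC.
pose K := [set x | phi x = 0].
have Kl : linear_set K by split=> // a x y /= x0 y0; rewrite /K/= pl x0 y0 mulr0 addr0.
have [K0|] := pselect (forall y, (forall m, K m -> inner y m = 0) -> y = 0).
  exists 0 => x; rewrite inner0r; apply: normr0_eq0; rewrite -rc_norm.
  congr _%:C; apply/eqP; rewrite eq_le -ler0c rc_norm normr_ge0 andbT.
  apply/ler_addgt0Pr => e e0; rewrite add0r.
  have M1 : 0 < M + 1 by lra.
  have /denseP/(_ x _ (divr_gt0 e0 M1))[k Kk xk] := linear_dense Kl K0.
  have -> : phi x = phi (x - k) by rewrite pB Kk subr0.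
  apply: le_trans (pM _) _; move: xk; rewrite ltr_pdivlMr// => h.
  by have := rnorm_ge0 (x - k); nra.
move/existsNP => [y /not_implyP[yK y0]].
have py : phi y != 0.
  apply/eqP => py; apply: y0; apply: rnorm_eq0; have := Re_inner_xx y.
  by rewrite (yK y)//= => /esym/eqP; rewrite expf_eq0/= => /eqP.
have yy : inner y y != 0 by rewrite inner_norm expf_neq0// normr_eq0; exact/eqP.
exists (conjc (phi y / inner y y) *: y) => x; rewrite innerZr conjcK.
have : inner y (x - (phi x / phi y) *: y) = 0.
  by apply: yK; rewrite /K/= pB pZ divfK// subrr.
move/inner_sym0; rewrite innerBl innerZl => /eqP; rewrite subr_eq0 => /eqP ->.
by field; rewrite py yy.
Qed.

End RealInner.

(** An extension by continuity comes without the adjoint that [bop] demands; with this, a norm bound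
    alone produces an element of [bop]. *)
Lemma bounded_adjoint R (X Y : hilbertType R) (f : X -> Y) (M : R) :
  linear f -> 0 <= M -> (forall x, rnorm (f x) <= M * rnorm x) ->
  exists g : Y -> X, forall x y, inner (f x) y = inner x (g y).
Proof.
move=> fl M0 fM.
suff /choice[g gP] : forall y, exists z, forall x, inner (f x) y = inner x z.
  by exists g => x y; exact: gP.
move=> y; have [z zP] := @riesz _ X (fun x => inner (f x) y) (M * rnorm y)
  ltac:(by move=> a u v /=; rewrite fl inner_linear)
  ltac:(by rewrite mulr_ge0)
  ltac:(by move=> x; apply: le_trans (rCauchySchwarz _ _) _;
           rewrite mulrAC ler_wpM2r//).
by exists z.
Qed.

Lemma bounded_bop R (H : hilbertType R) (f : H -> H) (M : R) :
  linear f -> 0 <= M -> (forall x, rnorm (f x) <= M * rnorm x) ->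
  exists T : bop H, forall x, T x = f x.
Proof.
move=> fl M0 fM; have [g gP] := bounded_adjoint fl M0 fM.
by exists (@mkbop _ _ f g M fl M0 fM gP).
Qed.

Lemma bop_extension R (H : hilbertType R) (Gam : set (H * H)) (M : R) :
  linear_set Gam -> 0 <= M -> dense [set p.1 | p in Gam] ->
  (forall p, Gam p -> rnorm p.2 <= M * rnorm p.1) ->
  exists2 T : bop H, bnorm T <= M & forall x y, Gam (x, y) -> T x = y.
Proof.
move=> Gl M0 Gd GM; have [f [fl fM fG]] := bounded_extension Gl M0 Gd GM.
have [T TE] := bounded_bop fl M0 fM; exists T.
  by apply: bnorm_le => // x; rewrite TE.
by move=> x y /fG; rewrite TE.
Qed.

Section BopTotal.
Variables (R : realType) (H K : hilbertType R).

Lemma eq_bounded (f g : H -> K) (M N : R) (S : set H) : linear f -> linear g ->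
  (forall x, rnorm (f x) <= M * rnorm x) -> (forall x, rnorm (g x) <= N * rnorm x) ->
  dense (span S) -> (forall x, S x -> f x = g x) -> forall x, f x = g x.
Proof.
move=> fl gl fM gN Sd fg x; apply: subr0_eq.
apply: rnorm_small => e e0.
have fgS y : span S y -> f y - g y = 0.
  apply: (@span_image _ _ _ (fun x => f x - g x) S [set 0]) => [a u v||u Su].
  - by rewrite fl gl scalerBr addrACA -opprD.
  - by split=> // a u v /= -> ->; rewrite scaler0 addr0.
  - by rewrite /= fg// subrr.
have MN : 0 < `|M| + `|N| + 1 by rewrite ltr_wpDl// addr_ge0.
have /denseP/(_ x _ (divr_gt0 e0 MN))[y Sy] := Sd; rewrite ltr_pdivlMr// => xy.
rewrite -[f x - g x]subr0 -(fgS y Sy).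
have -> : f x - g x - (f y - g y) = f (x - y) - g (x - y).
  by rewrite (linear_funB fl) (linear_funB gl) !opprB addrACA [RHS]addrACA [- g x - _]addrC.
apply: le_lt_trans xy; apply: le_trans (rnormB _ _) _; rewrite !mulrDr mulr1.
apply: ler_wpDr => //; rewrite ![rnorm (x - y) * _]mulrC lerD//.
  by apply: le_trans (fM _) _; rewrite ler_wpM2r// ler_norm.
by apply: le_trans (gN _) _; rewrite ler_wpM2r// ler_norm.
Qed.

End BopTotal.

Lemma eq_bop R (H : hilbertType R) (S T : bop H) (P : set H) :
  dense (span P) -> (forall x, P x -> S x = T x) -> S = T.
Proof.
move=> Pd ST; apply: bopP; apply: (eq_bounded (bop_linear S) (bop_linear T)) Pd ST.
  exact: le_bnorm.
exact: le_bnorm.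
Qed.

(** * Tensor products *)

Lemma inner_inj_total R (X : hilbertType R) (S : set X) x y :
  dense (span S) -> (forall z, S z -> inner z x = inner z y) -> x = y.
Proof.
move=> Sd xy; apply: subr0_eq.
apply: (dense_ortho Sd) => z; apply: span_ortho => u Su.
by rewrite innerBr xy// subrr.
Qed.

(** Moving f, then g, to the other side by an adjoint turns the identity into an equality of
    vectors, which a total set detects; thus [S] is replaced by the whole space in one argument at a
    time. *)
Lemma inner_total R (X Y : hilbertType R) (f g : X -> Y) (M N : R)
    (S : set X) (c : R[i]) :
  linear f -> linear g -> 0 <= M -> 0 <= N ->
  (forall x, rnorm (f x) <= M * rnorm x) -> (forall x, rnorm (g x) <= N * rnorm x) ->
  dense (span S) ->
  (forall x y, S x -> S y -> inner (f x) (g y) = c * inner x y) ->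
  forall x y, inner (f x) (g y) = c * inner x y.
Proof.
move=> fl gl M0 N0 fM gN Sd fg x y.
have [f' fE] := bounded_adjoint fl M0 fM; have [g' gE] := bounded_adjoint gl N0 gN.
have fgS z w : S w -> inner (f z) (g w) = c * inner z w.
  move=> Sw; rewrite fE -[c]conjcK -innerZr; congr (inner z _).
  by apply: (inner_inj_total Sd) => u Su; rewrite -fE innerZr conjcK fg.
rewrite inner_conj gE.
have -> : g' (f x) = c *: x.
  apply: (inner_inj_total Sd) => u Su; rewrite -gE inner_conj fgS//.
  by rewrite innerZr rmorphM/= -inner_conj.
by rewrite innerZr rmorphM/= conjcK -inner_conj.
Qed.

Lemma bounded_closure_mem R (V W : normedModType R[i]) (f : V -> W) (M : R)
    (S : set V) (T : set W) : linear f -> (forall x, rnorm (f x) <= M * rnorm x) ->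
  (forall x, S x -> closure T (f x)) -> forall x, closure S x -> closure T (f x).
Proof.
move=> fl fM ST x /closureP Sx; rewrite (proj1 (closure_id _) (@closed_closure _ T)).
apply/closureP => e e0; have M1 : 0 < `|M| + 1 by rewrite ltr_wpDl.
have [y Sy] := Sx _ (divr_gt0 e0 M1); rewrite ltr_pdivlMr// => xy.
exists (f y); first exact: ST.
rewrite -(linear_funB fl); apply: le_lt_trans (fM _) _; apply: le_lt_trans xy.
rewrite mulrDr mulr1 [M * _]mulrC ler_wpDr//.
by rewrite ler_wpM2l// ler_norm.
Qed.

Lemma bounded_closure R (V W : normedModType R[i]) (f : V -> W) (M : R)
    (S : set V) (T : set W) :
  linear f -> (forall x, rnorm (f x) <= M * rnorm x) -> linear_set T ->
  dense (span S) -> (forall x, S x -> closure T (f x)) -> forall x, closure T (f x).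
Proof.
move=> fl fM Tl /dense_closure Sd ST x.
by apply: (bounded_closure_mem fl fM _ (Sd x)); exact: span_image (closure_linear Tl) ST.
Qed.

Section Orthogonal.
Variables (R : realType) (H : hilbertType R).

Lemma ortho_sum (I : eqType) (s : seq I) (F : I -> H) : uniq s ->
  (forall i j, i \in s -> j \in s -> i != j -> inner (F i) (F j) = 0) ->
  rnorm (\sum_(i <- s) F i) ^+ 2 = \sum_(i <- s) rnorm (F i) ^+ 2.
Proof.
elim: s => [_ _|i s IH /= /andP[ins us] Fo]; first by rewrite !big_nil rnorm0 expr0n.
rewrite !big_cons pythagoras ?IH// => [j k js ks|].
  by apply: Fo; rewrite in_cons ?js ?ks orbT.
rewrite inner_sumr big_seq big1// => j js.
apply: Fo; rewrite ?in_cons ?eqxx ?js ?orbT//.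
by apply: contraNneq ins => ->.
Qed.

Definition orthonormal_seq (t : seq H) : Prop :=
  uniq t /\ forall f g, f \in t -> g \in t -> inner f g = (f == g)%:R.

(** The list [s] may be linearly dependent: a vector equal to its projection [p] contributes
    nothing, so [t] can be shorter than [s]. *)
Lemma gram_schmidt (s : seq H) : exists2 t, orthonormal_seq t &
  forall y, y \in s -> y = \sum_(f <- t) inner y f *: f.
Proof.
elim: s => [|y s [t [ut to] ts]]; first by exists [::].
set p := \sum_(f <- t) inner y f *: f.
have po f : f \in t -> inner (y - p) f = 0.
  move=> ft; rewrite innerBl inner_suml (bigD1_seq f)//= innerZl (to f f)// eqxx mulr1.
  rewrite big_seq_cond big1 ?addr0 ?subrr// => g /andP[gt gf].
  by rewrite innerZl (to g f)// (negbTE gf) mulr0.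
have [yp|yp] := eqVneq (y - p) 0.
  exists t => // z; rewrite in_cons => /predU1P[->|/ts//].
  by apply/eqP; rewrite -subr_eq0 yp.
have r0 : 0 < rnorm (y - p) by apply: rnorm_gt0; exact/eqP.
have rC : (rnorm (y - p))%:C != 0 by rewrite (eq_complex _ 0)/= gt_eqF.
set e := (rnorm (y - p))^-1%:C *: (y - p).
have e1 : inner e e = 1 by apply: inner_normalize; exact/eqP.
have eo f : f \in t -> inner e f = 0 by move=> ft; rewrite innerZl po// mulr0.
have et : e \notin t.
  by apply/negP => et; have /eqP := eo _ et; rewrite e1 oner_eq0.
have ye : inner y e *: e = y - p.
  have -> : inner y e = inner (y - p) e.
    rewrite innerBl [X in _ - X](_ : _ = 0) ?subr0// inner_suml big_seq big1// => f ft.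
    by rewrite innerZl (inner_sym0 (eo f ft)) mulr0.
  have -> : y - p = (rnorm (y - p))%:C *: e by rewrite scalerA -rcM mulfV ?gt_eqF// scale1r.
  by rewrite innerZl e1 mulr1.
exists (e :: t).
  split=> [|f g]; first by rewrite /= et.
  rewrite !in_cons => /predU1P[->|ft] /predU1P[->|gt].
  - by rewrite e1 eqxx.
  - by rewrite eo// (_ : e == g = false)//; apply: contraNF et => /eqP ->.
  - rewrite (inner_sym0 (eo f ft)) (_ : f == e = false)//.
    by apply: contraNF et => /eqP <-.
  - exact: to.
move=> z; rewrite in_cons big_cons => /predU1P[->|zs]; first by rewrite ye subrK.
have -> : inner z e = 0; last by rewrite scale0r add0r; exact: ts.
rewrite (ts z zs) inner_suml big_seq big1// => f ft.
by rewrite innerZl (inner_sym0 (eo f ft)) mulr0.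
Qed.

End Orthogonal.

(** The norm of a combination is determined by the Gram matrix of its terms, so scaling the matrix
    by m^2 scales the norm by m exactly. Translations use m = 1, reassociation with a fixed v uses m
    = |v|. *)
Lemma scaled_extension R (X Y : hilbertType R) (S : set (X * Y)) (m : R) :
  0 <= m ->
  (forall p q, S p -> S q -> inner p.2 q.2 = (m ^+ 2)%:C * inner p.1 q.1) ->
  dense (span [set p.1 | p in S]) ->
  exists f : X -> Y, [/\ linear f, forall x, rnorm (f x) <= m * rnorm x &
    forall x y, S (x, y) -> f x = y].
Proof.
move=> m0 Sm Sd.
have [||f [fl fM fS]] := @bounded_extension _ X Y (span S) m (span_linear S) m0.
- exact: dense_span_fst.
- move=> _ [n [c [p [Sp ->]]]]; apply: rnorm_le_sqr => //.
  rewrite -lecR (rcM (m ^+ 2)) -!inner_xx.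
  rewrite fst_sum snd_sum !inner_suml mulr_sumr le_eqVlt; apply/orP; left; apply/eqP.
  apply: eq_bigr => i _; rewrite !inner_sumr mulr_sumr; apply: eq_bigr => j _.
  by rewrite !innerZl !innerZr Sm//; ring.
exists f; split=> // x y Sxy; exact: (fS (x, y) (sub_span Sxy)).
Qed.

Section TensorTheory.
Variables (R : realType) (H K : hilbertType R) (t : tensor_space H K).
Implicit Types (x : H) (y : K).

Lemma tsDl x x' y : ts_map t (x + x') y = ts_map t x y + ts_map t x' y.
Proof. exact: (linear_funD (ts_linearl t y)). Qed.
Lemma tsDr x y y' : ts_map t x (y + y') = ts_map t x y + ts_map t x y'.
Proof. exact: (linear_funD (ts_linearr t x)). Qed.
Lemma tsZl a x y : ts_map t (a *: x) y = a *: ts_map t x y.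
Proof. exact: (linear_funZ _ _ (ts_linearl t y)). Qed.
Lemma tsZr a x y : ts_map t x (a *: y) = a *: ts_map t x y.
Proof. exact: (linear_funZ _ _ (ts_linearr t x)). Qed.
Lemma ts0l y : ts_map t 0 y = 0.
Proof. exact: (linear_fun0 (ts_linearl t y)). Qed.
Lemma tsBr x y y' : ts_map t x (y - y') = ts_map t x y - ts_map t x y'.
Proof. exact: (linear_funB (ts_linearr t x)). Qed.
Lemma ts_suml I (s : seq I) (P : pred I) (F : I -> H) y :
  ts_map t (\sum_(i <- s | P i) F i) y = \sum_(i <- s | P i) ts_map t (F i) y.
Proof. exact: (linear_fun_sum _ _ _ (ts_linearl t y)). Qed.
Lemma ts_sumr I (s : seq I) (P : pred I) x (F : I -> K) :
  ts_map t x (\sum_(i <- s | P i) F i) = \sum_(i <- s | P i) ts_map t x (F i).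
Proof. exact: (linear_fun_sum _ _ _ (ts_linearr t x)). Qed.

Lemma rnorm_ts x y : rnorm (ts_map t x y) = rnorm x * rnorm y.
Proof.
apply/eqP; rewrite -(@eqrXn2 _ 2) ?mulr_ge0//.
rewrite exprMn -!Re_inner_xx ts_inner !inner_xx -rcM; exact/eqP.
Qed.

Definition elementary : set t := [set z | exists x y, z = ts_map t x y].

Lemma elementary_dense : dense (span elementary).
Proof.
apply/denseP => z e e0; have /denseP/(_ z e e0)[u [n [x [y ->]]] zu] := @ts_dense _ _ _ t.
exists (\sum_i ts_map t (x i) (y i)) => //.
apply: linear_set_sum => // i _.
by apply: sub_span; exists (x i), (y i).
Qed.

Lemma eq_bop_ts (S T : bop t) :
  (forall x y, S (ts_map t x y) = T (ts_map t x y)) -> S = T.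
Proof.
by move=> ST; apply: (eq_bop elementary_dense) => _ [x [y ->]].
Qed.

Lemma ts_total (X : set H) (Y : set K) : dense (span X) -> dense (span Y) ->
  dense (span [set z | exists x y, [/\ X x, Y y & z = ts_map t x y]]).
Proof.
move=> Xd Yd; set E := [set z | _]; have El := span_linear E.
have XE x : X x -> forall y, closure (span E) (ts_map t x y).
  move=> Xx; apply: (bounded_closure (ts_linearr t x) (M := rnorm x)) Yd _ => //.
    by move=> y; rewrite rnorm_ts.
  by move=> y Yy; apply: subset_closure; apply: sub_span; exists x, y.
have allE x y : closure (span E) (ts_map t x y).
  move: x; apply: (bounded_closure (ts_linearl t y) (M := rnorm y)) Xd _ => //.
    by move=> x; rewrite rnorm_ts mulrC.
  by move=> x Xx; exact: XE.
apply/dense_closure => z.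
apply: (@bounded_closure _ _ _ idfun 1 elementary) => //.
- by move=> u; rewrite mul1r.
- exact: elementary_dense.
- by move=> _ [x [y ->]]; exact: allE.
Qed.

(** Expanding the y i in an orthonormal family rewrites the sum as a sum of z_f (x) f with
    orthogonal terms. The operator then acts on each z_f separately, and the squared norms are
    compared term by term. *)
Lemma ts_bound (S : bop H) n (x : 'I_n -> H) (y : 'I_n -> K) :
  rnorm (\sum_i ts_map t (S (x i)) (y i)) <=
  bnorm S * rnorm (\sum_i ts_map t (x i) (y i)).
Proof.
have [s [us so] sE] := gram_schmidt [seq y i | i : 'I_n].
have yE i : y i = \sum_(f <- s) inner (y i) f *: f.
  by apply: sE; exact: map_f (mem_enum _ _).
have E (T : bop H) : \sum_i ts_map t (T (x i)) (y i) =
    \sum_(f <- s) ts_map t (T (\sum_i inner (y i) f *: x i)) f.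
  under eq_bigr => i _ do rewrite (yE i) ts_sumr.
  rewrite exchange_big/=; apply: eq_bigr => f _.
  rewrite (linear_fun_sum _ _ _ (bop_linear T)) ts_suml; apply: eq_bigr => i _.
  by rewrite bopZ tsZl tsZr.
rewrite (E S) (E (@bid R H)); apply: rnorm_le_sqr; first exact: bnorm_ge0.
have o (T : bop H) : rnorm (\sum_(f <- s) ts_map t (T (\sum_i inner (y i) f *: x i)) f) ^+ 2
    = \sum_(f <- s) rnorm (T (\sum_i inner (y i) f *: x i)) ^+ 2.
  rewrite ortho_sum// => [|f g fs gs fg].
    rewrite big_seq [RHS]big_seq; apply: eq_bigr => f fs; rewrite rnorm_ts exprMn.
    by rewrite -[rnorm f ^+ 2]Re_inner_xx so// eqxx mulr1.
  by rewrite ts_inner so// (negbTE fg) mulr0.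
rewrite !o mulr_sumr; apply: ler_sum => f _.
by rewrite -exprMn ler_pXn2r ?nnegrE ?mulr_ge0 ?le_bnorm.
Qed.

Lemma optensl_ex (S : bop H) : exists2 W : bop t, bnorm W <= bnorm S &
  forall x y, W (ts_map t x y) = ts_map t (S x) y.
Proof.
pose E := [set p : t * t | exists x y, p = (ts_map t x y, ts_map t (S x) y)].
have [||W WS WE] := @bop_extension _ t (span E) (bnorm S) (span_linear E) (bnorm_ge0 S).
- apply: dense_span_fst; apply: dense_span_mono elementary_dense => _ [x [y ->]].
  by apply: sub_span; exists (ts_map t x y, ts_map t (S x) y) => //; exists x, y.
- move=> _ [n [c [p [Ep ->]]]].
  have /choice[x] := Ep; move/choice=> [y pE].
  have E1 : (\sum_i c i *: p i).1 = \sum_i ts_map t (c i *: x i) (y i).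
    by rewrite fst_sum; apply: eq_bigr => i _; rewrite pE tsZl.
  have E2 : (\sum_i c i *: p i).2 = \sum_i ts_map t (S (c i *: x i)) (y i).
    by rewrite snd_sum; apply: eq_bigr => i _; rewrite pE bopZ tsZl.
  by rewrite E1 E2; exact: ts_bound.
- by exists W => // x y; apply: WE; apply: sub_span; exists x, y.
Qed.

End TensorTheory.

(** The same space with its factors read in the other order, so that results on the left factor
    yield those on the right one. *)
Definition ts_swap R (H K : hilbertType R) (t : tensor_space H K) :
  tensor_space K H.
Proof.
refine (@TensorSpace _ K H t (fun y x => ts_map t x y) _ _ _ _).
- exact: ts_linearr.
- exact: ts_linearl.
- by move=> y x y' x'; rewrite ts_inner mulrC.
- apply/denseP => z e e0; have /denseP/(_ z e e0)[u [n [x [y ->]]] zu] := @ts_dense _ _ _ t.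
  by exists (\sum_i ts_map t (x i) (y i)) => //; exists n, y, x.
Defined.

Section Optens.
Variables (R : realType) (H K : hilbertType R) (t : tensor_space H K).
Implicit Types (S : bop H) (T : bop K).

Lemma optens_ex S T : exists2 W : bop t, bnorm W <= bnorm S * bnorm T &
  forall x y, W (ts_map t x y) = ts_map t (S x) (T y).
Proof.
have [W1 W1S W1E] := optensl_ex t S; have [W2 W2T W2E] := optensl_ex (ts_swap t) T.
exists (bcomp W1 W2).
  apply: le_trans (bnormM _ _) _; apply: ler_pM => //; exact: bnorm_ge0.
by move=> x y; rewrite -[RHS]W1E -[X in W1 X](W2E y x).
Qed.

Lemma optensE S T x y : optens t S T (ts_map t x y) = ts_map t (S x) (T y).
Proof.
have [W _ WE] := optens_ex S T.
by have := @xgetPex _ 0 [set W : bop t | forall x y,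
  W (ts_map t x y) = ts_map t (S x) (T y)] (ex_intro _ W WE) x y.
Qed.

Lemma bnorm_optens S T : bnorm (optens t S T) <= bnorm S * bnorm T.
Proof.
have [W WM WE] := optens_ex S T; suff -> : optens t S T = W by [].
by apply: eq_bop_ts => x y; rewrite optensE WE.
Qed.

Lemma optensM S T S' T' :
  optens t S T ** optens t S' T' = optens t (S ** S') (T ** T').
Proof. by apply: eq_bop_ts => x y; rewrite /cmul/= !optensE. Qed.

Lemma optens1 : optens t cone cone = cone.
Proof. by apply: eq_bop_ts => x y; rewrite optensE. Qed.

Lemma optens_star S T : star (optens t S T) = optens t (star S) (star T).
Proof.
apply: eq_bop_ts => x y; apply: inner_inj_total (@elementary_dense _ _ _ t) _ => _ [u [v ->]].
by rewrite /star/= -badjE !optensE !ts_inner !badjE.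
Qed.

Lemma optens_linearl T : linear ((optens t)^~ T).
Proof. by move=> a S S'; apply: eq_bop_ts => x y; rewrite baddE bscaleE !optensE tsDl tsZl. Qed.

Lemma optens_linearr S : linear (optens t S).
Proof. by move=> a T T'; apply: eq_bop_ts => x y; rewrite baddE bscaleE !optensE tsDr tsZr. Qed.

End Optens.

(** * Orthonormal bases *)

Notation cabs a := (complex.Re `|a|).

Section CAbs.
Variable R : realType.
Implicit Types a b : R[i].

Lemma cabs_ge0 a : 0 <= cabs a.
Proof. by rewrite -ler0c rc_norm. Qed.

Lemma cabsD a b : cabs (a + b) <= cabs a + cabs b.
Proof. by rewrite -lecR rcD !rc_norm ler_normD. Qed.

Lemma cabsM a b : cabs (a * b) = cabs a * cabs b.
Proof. by apply: complexI; rewrite rcM !rc_norm normrM. Qed.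

Lemma cabs_real (r : R) : cabs r%:C = `|r|.
Proof. by rewrite normc_def /= expr0n addr0 sqrtr_sqr. Qed.

Lemma cabsB a b : cabs (a - b) = cabs (b - a).
Proof. by rewrite distrC. Qed.

Lemma cabs_eq0 a : cabs a = 0 -> a = 0.
Proof. by move=> a0; apply: normr0_eq0; rewrite -rc_norm a0. Qed.

Lemma cabs_le_ReIm a : cabs a <= `|complex.Re a| + `|complex.Im a|.
Proof.
case: a => x y; rewrite normc_def /=.
rewrite -[leRHS]ger0_norm ?addr_ge0// -sqrtr_sqr ler_wsqrtr// sqrrD.
by rewrite !real_normK ?num_real// lerD2r lerDl mulrn_wge0// mulr_ge0.
Qed.

Lemma Re_le_cabs a : `|complex.Re a| <= cabs a.
Proof.
by case: a => x y; rewrite normc_def /= -sqrtr_sqr ler_wsqrtr// lerDl sqr_ge0.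
Qed.

Lemma Im_le_cabs a : `|complex.Im a| <= cabs a.
Proof.
by case: a => x y; rewrite normc_def /= -sqrtr_sqr ler_wsqrtr// lerDr sqr_ge0.
Qed.

Lemma sqr_cabs a : (cabs a ^+ 2)%:C = a * conjc a.
Proof. by rewrite rcX rc_norm sqr_normc. Qed.

Lemma conjc_realM (r : R) a : conjc (r%:C * a) = r%:C * conjc a.
Proof. by rewrite rmorphM; congr (_ * _); exact: conjc_real. Qed.

End CAbs.
#[global] Hint Extern 0 (is_true (0 <= cabs _)) => exact: cabs_ge0 : core.

(** Each pair of [E] imposes on (x, y) one equation between continuous functions, so the adjoint
    graph is closed. *)
Lemma adjoint_graph_closed R (H : hilbertType R) (D E : set (H * H)) :
  D `<=` adjoint_graph E -> closure D `<=` adjoint_graph E.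
Proof.
move=> DE [x y] /closure_pairP Dxy u v Euv /=.
apply: subr0_eq; apply: cabs_eq0; apply/eqP.
rewrite eq_le cabs_ge0 andbT; apply/ler_addgt0Pr => e e0; rewrite add0r.
have M0 : 0 < rnorm v + rnorm u + 1 by rewrite ltr_wpDl// addr_ge0// rnorm_ge0.
have [p [Dp xp yp]] := Dxy _ (divr_gt0 e0 M0).
have -> : inner v x - inner u y = inner v (x - p.1) - inner u (y - p.2).
  by rewrite !innerBr (DE p Dp u v Euv) opprB addrA subrK.
apply: le_trans (cabsD _ _) _; rewrite normrN.
apply: le_trans (lerD (rCauchySchwarz _ _) (rCauchySchwarz _ _)) _.
move: xp yp; rewrite !ltr_pdivlMr// => xp yp.
have := rnorm_ge0 (x - p.1); have := rnorm_ge0 (y - p.2).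
move: M0 xp yp; set a := rnorm v; set b := rnorm u => M0.
have a0 : 0 <= a by exact: rnorm_ge0.
have b0 : 0 <= b by exact: rnorm_ge0.
move=> h1 h2 h3 h4.
have [c1|c1] := leP (rnorm (x - p.1)) (rnorm (y - p.2)); nra.
Qed.

Lemma adjoint_graph_flip R (H : hilbertType R) (D E : set (H * H)) :
  D `<=` adjoint_graph E -> E `<=` adjoint_graph D.
Proof.
move=> DE [x y] Exy u v Duv /=; rewrite inner_conj -(DE _ Duv _ _ Exy) /=.
by rewrite -inner_conj.
Qed.

Section Basis.
Variables (R : realType) (H : hilbertType R) (I : choiceType) (e : I -> H).

Definition orthonormal_basis : Prop :=
  (forall i j, inner (e i) (e j) = (i == j)%:R) /\ dense (span (range e)).

Hypothesis onb : orthonormal_basis.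
Let eij := proj1 onb.
Let ed := proj2 onb.

Definition psum (s : seq I) (x : H) := \sum_(i <- s) inner x (e i) *: e i.

Lemma basis_dense : dense (span (range e)). Proof. exact: ed. Qed.

Lemma rnorm_basis i : rnorm (e i) = 1.
Proof.
apply/eqP; rewrite -(@eqrXn2 _ 2)// -Re_inner_xx eij eqxx.
by rewrite expr1n.
Qed.

Lemma eq_coef x y : (forall i, inner x (e i) = inner y (e i)) -> x = y.
Proof.
move=> xy; apply: (inner_inj_total ed) => _ [i _ <-].
by rewrite inner_conj xy -inner_conj.
Qed.

Lemma psum_linear s : linear (psum s).
Proof.
move=> a x y; rewrite /psum scaler_sumr -big_split; apply: eq_bigr => i _.
by rewrite inner_linear scalerDl scalerA.
Qed.

Lemma psum_coef s x i : uniq s -> inner (psum s x) (e i) = (i \in s)%:R * inner x (e i).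
Proof.
move=> us; rewrite inner_suml; have [si|si] := boolP (i \in s).
  rewrite (bigD1_seq i)//= innerZl eij eqxx mulr1 mul1r big1 ?addr0// => j ji.
  by rewrite innerZl eij (negbTE ji) mulr0.
rewrite mul0r big_seq big1// => j js; rewrite innerZl eij.
by rewrite (_ : j == i = false) ?mulr0//; apply: contraNF si => /eqP <-.
Qed.

Lemma sqr_psum s x : uniq s ->
  rnorm (psum s x) ^+ 2 = \sum_(i <- s) cabs (inner x (e i)) ^+ 2.
Proof.
move=> us; rewrite ortho_sum// => [|i j _ _ ij]; last first.
  by rewrite innerZl innerZr eij (negbTE ij) !mulr0.
by apply: eq_bigr => i _; rewrite rnormZ rnorm_basis mulr1.
Qed.

Lemma psum_ortho s x : uniq s -> inner (x - psum s x) (psum s x) = 0.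
Proof.
move=> us; rewrite [X in inner _ X]/psum inner_sumr big_seq big1// => i si.
by rewrite innerZr innerBl psum_coef// si mul1r subrr mulr0.
Qed.

Lemma sqr_rnorm_psum s x : uniq s ->
  rnorm x ^+ 2 = rnorm (x - psum s x) ^+ 2 + rnorm (psum s x) ^+ 2.
Proof. by move=> us; rewrite -pythagoras ?psum_ortho// subrK. Qed.

Lemma psum_compl_le s x : uniq s -> rnorm (x - psum s x) <= rnorm x.
Proof.
move=> us; apply: sqr_rnorm_le => //.
by rewrite (sqr_rnorm_psum x us) lerDl sqr_ge0.
Qed.

Lemma bessel s x : uniq s -> \sum_(i <- s) cabs (inner x (e i)) ^+ 2 <= rnorm x ^+ 2.
Proof. by move=> us; rewrite -sqr_psum// (sqr_rnorm_psum x us) lerDr sqr_ge0. Qed.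

(** The index type carries no order, so the expansion converges along finite subsets. If y is a
    finite combination close to x and s contains its indices, [psum s] fixes y, and x - psum s x =
    (x - y) - psum s (x - y) is no longer than x - y. *)
Lemma psum_approx x (eps : R) : 0 < eps -> exists2 s, uniq s &
  forall s', uniq s' -> {subset s <= s'} -> rnorm (x - psum s' x) < eps.
Proof.
move=> e0; have /denseP/(_ x eps e0)[_ [n [c [f [fe ->]]]] xy] := ed.
have /choice[i iP] : forall k, exists i, e i = f k.
  by move=> k; have [i _] := fe k; exists i.
exists (undup [seq i k | k : 'I_n]); first exact: undup_uniq.
move=> s us sub; set y := \sum_k _ in xy; apply: le_lt_trans xy.
have -> : x - psum s x = (x - y) - psum s (x - y); last exact: psum_compl_le.
suff ys : psum s y = y.
  by rewrite (linear_funB (psum_linear s)) ys opprB addrA subrK.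
rewrite (linear_fun_sum _ _ _ (psum_linear s)); apply: eq_bigr => k _.
rewrite (linear_funZ _ _ (psum_linear s)); congr (_ *: _).
apply: eq_coef => j; rewrite psum_coef// -iP eij.
have [<-|kj] := eqVneq (i k) j; last by rewrite mulr0.
by rewrite sub ?mul1r// mem_undup; exact: map_f (mem_enum _ _).
Qed.

Lemma parseval_le (B : R) y :
  (forall s, uniq s -> \sum_(i <- s) cabs (inner y (e i)) ^+ 2 <= B) ->
  rnorm y ^+ 2 <= B.
Proof.
move=> yB; have B0 : 0 <= B by have := yB [::] isT; rewrite big_nil.
suff : rnorm y <= Num.sqrt B.
  by rewrite -(@ler_pXn2r _ 2) ?nnegrE ?sqrtr_ge0// sqr_sqrtr.
apply/ler_addgt0Pr => eps eps0; have [s us sE] := psum_approx y eps0.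
rewrite -[y](subrK (psum s y)) addrC; apply: le_trans (rnormD _ _) _.
apply: lerD; last by rewrite ltW// sE.
rewrite -(@ler_pXn2r _ 2) ?nnegrE ?sqrtr_ge0// sqr_sqrtr//.
by rewrite sqr_psum// yB.
Qed.

Lemma coef_bound (M : R) x y : 0 <= M ->
  (forall i, cabs (inner y (e i)) <= M * cabs (inner x (e i))) ->
  rnorm y <= M * rnorm x.
Proof.
move=> M0 yx; apply: rnorm_le_sqr => //; apply: parseval_le => s us.
apply: (@le_trans _ _ (M ^+ 2 * \sum_(i <- s) cabs (inner x (e i)) ^+ 2)).
  rewrite mulr_sumr; apply: ler_sum => i _; rewrite -exprMn.
  by rewrite ler_pXn2r ?nnegrE ?mulr_ge0.
by rewrite ler_wpM2l ?sqr_ge0// bessel.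
Qed.

Lemma diag_bop (c : I -> R) (M : R) : 0 <= M -> (forall i, `|c i| <= M) ->
  exists T : bop H, forall x i, inner (T x) (e i) = (c i)%:C * inner x (e i).
Proof.
move=> M0 cM.
pose Gam := [set p : H * H | forall i, inner p.2 (e i) = (c i)%:C * inner p.1 (e i)].
have Gl : linear_set Gam.
  split=> [i|a p q Gp Gq i]; first by rewrite !inner0l mulr0.
  by rewrite !inner_linear Gp Gq; ring.
have Gd : dense [set p.1 | p in Gam].
  move: ed => /denseP ed'; apply/denseP => x eps /(ed' x)[y Sy xy]; exists y => //.
  move: y Sy {xy}; apply: span_min; first exact: linear_set_fst.
  move=> _ [i _ <-].
  exists (e i, (c i)%:C *: e i) => // j /=; rewrite innerZl eij.
  by have [->|] := eqVneq i j; rewrite ?mulr0.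
have [|T _ TG] := bop_extension Gl M0 Gd.
  move=> p Gp; apply: coef_bound => // i; rewrite Gp cabsM cabs_real.
  by rewrite ler_wpM2r.
have Te j : T (e j) = (c j)%:C *: e j.
  apply: TG => i /=; rewrite innerZl eij.
  by have [->|] := eqVneq j i; rewrite ?mulr0.
(* Through the adjoint, the claim for all x becomes the single vector identity that the adjoint of T
   multiplies e i by c i, tested against the basis. *)
exists T => x i; rewrite badjE -[(c i)%:C]conjcK -innerZr; congr (inner x _).
apply: (inner_inj_total ed) => _ [j _ <-].
rewrite -badjE Te innerZl innerZr eij conjcK.
by have [->|] := eqVneq j i; rewrite ?mulr0.
Qed.

End Basis.

(** * Operators with an eigenbasis *)

Lemma ultra_bounded_limit R (T : Type) (F : set_system T) (phi : T -> R)
    (M : R) : UltraFilter F -> F [set x | `|phi x| <= M] ->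
  exists a, forall d, 0 < d -> F [set x | `|phi x - a| < d].
Proof.
move=> FU FM; have FP : ProperFilter F by exact: ultra_proper.
have [|a [_ acl]] := @segment_compact R (- M) M (phi @ F) _.
  suff : F (phi @^-1` `[- M, M]%classic) by [].
  by apply: filterS FM => x; rewrite /preimage/= in_itv/= ler_norml.
exists a => d d0.
have [//|Fn] := in_ultra_setVsetC [set x | `|phi x - a| < d] FU.
have [||_ [[x nx <-] /= xa]] := acl [set phi x | x in ~` [set x | `|phi x - a| < d]]
    [set y | `|a - y| < d].
- suff : F (phi @^-1` [set phi x | x in ~` [set x | `|phi x - a| < d]]) by [].
  by apply: filterS Fn => x nx; exists x.
- exact: (@nbhsx_ballx _ R^o a d d0).
- by exfalso; apply: nx; rewrite /= distrC.
Qed.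

Lemma ultra_bounded_climit R (T : Type) (F : set_system T)
    (phi : T -> R[i]) (M : R) : UltraFilter F -> F [set x | cabs (phi x) <= M] ->
  exists a, forall d, 0 < d -> F [set x | cabs (phi x - a) < d].
Proof.
move=> FU FM; have FP : ProperFilter F by exact: ultra_proper.
have [|a aP] := @ultra_bounded_limit R T F (fun x => complex.Re (phi x)) M FU.
  by apply: filterS FM => x; apply: le_trans; exact: Re_le_cabs.
have [|b bP] := @ultra_bounded_limit R T F (fun x => complex.Im (phi x)) M FU.
  by apply: filterS FM => x; apply: le_trans; exact: Im_le_cabs.
exists (a +i* b)%C => d d0; have d2 : 0 < d / 2 by rewrite divr_gt0.
apply: filterS (filterI (aP _ d2) (bP _ d2)) => x [/= xa xb].
rewrite [ltRHS]splitr; apply: le_lt_trans (cabs_le_ReIm _) _.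
by case: (phi x) xa xb => u v /= ? ?; exact: ltrD.
Qed.

Section Diagonal.
Variables (R : realType) (H : hilbertType R) (I : choiceType) (e : I -> H).
Hypothesis onb : orthonormal_basis e.
Let eij := proj1 onb.
Variables (T : bop H) (c : I -> R).
Hypothesis Tc : forall x i, inner (T x) (e i) = (c i)%:C * inner x (e i).

Lemma diag_self_adjoint x y : inner (T x) y = inner x (T y).
Proof.
rewrite badjE; congr (inner x _); apply: (eq_coef onb) => i.
rewrite -badjEr Tc inner_conj.
have -> : T (e i) = (c i)%:C *: e i.
  apply: (eq_coef onb) => j; rewrite Tc innerZl eij.
  by have [->|] := eqVneq i j; rewrite ?mulr0.
by rewrite innerZl conjc_realM -inner_conj.
Qed.

(* Along an ultrafilter on the closed image of the unit ball every coefficient converges, and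
   the tails outside finitely many basis vectors are uniformly small. *)
Lemma diag_compact : (forall eps, 0 < eps -> finite_set [set i | eps <= `|c i|]) ->
  compact_operator T.
Proof.
move=> cfin; rewrite /compact_operator; set K := closure _.
rewrite compact_ultra => F UF FK.
have PF : ProperFilter F by exact: ultra_proper.
have tail (eps : R) (s : seq I) : 0 < eps -> uniq s ->
    (forall i, eps <= `|c i| -> i \in s) ->
    forall x, K x -> rnorm (x - psum e s x) <= eps.
  move=> e0 us es x /closureP Kx; apply/ler_addgt0Pr => d d0.
  have [_ [z z1 <-] xz] := Kx _ d0.
  have -> : x - psum e s x = (T z - psum e s (T z)) +
      ((x - T z) - psum e s (x - T z)).
    by rewrite (linear_funB (psum_linear e s)) opprB addrACA [T z + _]addrC subrK addKr.
  apply: le_trans (rnormD _ _) _; apply: lerD; last first.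
    exact: le_trans (psum_compl_le onb _ us) (ltW xz).
  have z1' : rnorm z <= 1 by rewrite rnorm_le.
  apply: (@le_trans _ _ (eps * rnorm z)); last by rewrite ler_piMr// ltW.
  apply: (coef_bound onb); first exact: ltW.
  move=> i; rewrite innerBl (psum_coef onb)// Tc.
  have [si|si] := boolP (i \in s).
    by rewrite mul1r subrr normr0 mulr_ge0// ltW.
  rewrite mul0r subr0 cabsM cabs_real ler_wpM2r//.
  by rewrite leNgt; apply: contraNN si => /ltW; exact: es.
have coefB i x : K x -> cabs (inner x (e i)) <= bnorm T.
  move=> /closureP Kx; apply/ler_addgt0Pr => d d0.
  have [_ [z z1 <-] xz] := Kx _ d0.
  have z1' : rnorm z <= 1 by rewrite rnorm_le.
  apply: le_trans (rCauchySchwarz _ _) _; rewrite (rnorm_basis onb) mulr1.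
  rewrite -[x](subrK (T z)) addrC; apply: le_trans (rnormD _ _) _.
  apply: lerD; last exact: ltW.
  by apply: le_trans (le_bnorm _ _) _; rewrite ler_piMr// bnorm_ge0.
have /choice[a aP] : forall i, exists a, forall d, 0 < d ->
    F [set x | cabs (inner x (e i) - a) < d].
  move=> i; apply: (@ultra_bounded_climit _ _ _ _ (bnorm T)).
  by apply: filterS FK => x; exact: coefB.
have Fc : cauchy F.
  apply/real_cauchyP => eps e0; have e2 : 0 < eps / 2 by rewrite divr_gt0.
  have /finite_seqP[s0 s0E] := cfin _ e2.
  pose s := undup s0; have us : uniq s by exact: undup_uniq.
  have sE i : eps / 2 <= `|c i| -> i \in s.
    move=> ci; rewrite mem_undup.
    by have : [set i | eps / 2 <= `|c i|] i by []; rewrite s0E.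
  exists (\sum_(i <- s) a i *: e i).
  have m0 : (0 : R) < (size s).+1%:R by [].
  (* The successor allows an empty [s] and makes the total of [size s] errors strictly smaller than
     eps / 2. *)
  pose d := eps / 2 / (size s).+1%:R.
  have d0 : 0 < d by rewrite divr_gt0.
  have Fs : F [set x | forall i, i \in s -> cabs (inner x (e i) - a i) < d].
    elim: (s) => [|i r IH]; first by apply: filterS filterT.
    apply: filterS (filterI IH (aP i d d0)) => x [xr xi] j.
    by rewrite in_cons => /predU1P[->//|]; exact: xr.
  apply: filterS (filterI Fs FK) => x [xs Kx] /=.
  apply: le_lt_trans (rdistD (psum e s x) _ _) _; rewrite [ltRHS]splitr.
  apply: ltr_leD; last by rewrite rdistC; exact: tail.
  rewrite /psum -sumrB; apply: le_lt_trans (rnorm_sum _ _ _) _.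
  apply: (@le_lt_trans _ _ (\sum_(i <- s) d)).
    rewrite big_seq [leRHS]big_seq; apply: ler_sum => i si.
    by rewrite -scalerBl rnormZ (rnorm_basis onb) mulr1 cabsB ltW// xs.
  rewrite big_const_seq count_predT iter_addr_0 -[d *+ _]mulr_natr.
  by rewrite /d -mulrA gtr_pMr// mulrC ltr_pdivrMr// mul1r ltr_nat.
have /cvg_ex[p Fp] : cvg F by exact: cauchy_cvg.
exists p; split=> //; rewrite /K (proj1 (closure_id _) (@closed_closure _ _)) => B Bp.
exact: (@filter_ex _ F _ _ (filterI FK (Fp B Bp))).
Qed.

End Diagonal.

(** Indices are counted, not values: the last clause bounds multiplicities too. [D] may be a core
    that is not closed. *)
Definition eigenbasis R (H : hilbertType R) (D : set (H * H))
    (I : choiceType) (e : I -> H) (t : I -> R) : Prop :=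
  [/\ orthonormal_basis e, forall i, D (e i, (t i)%:C *: e i) &
      forall b, finite_set [set i | `|t i| <= b]].

Section EigenbasisSpectral.
Variables (R : realType) (H : hilbertType R) (D0 : set (H * H)).
Variables (I : choiceType) (e : I -> H) (t : I -> R).
Hypotheses (D0l : linear_set D0) (D0s : D0 `<=` adjoint_graph D0)
  (De : eigenbasis D0 e t).
Let onb : orthonormal_basis e. Proof. by case: De. Qed.
Let D0e i : D0 (e i, (t i)%:C *: e i). Proof. by case: De. Qed.
Let tfin b : finite_set [set i | `|t i| <= b]. Proof. by case: De. Qed.
Let D := closure D0.

Let Dsym : D `<=` adjoint_graph D.
Proof. exact/adjoint_graph_closed/adjoint_graph_flip/adjoint_graph_closed. Qed.

(** Truncating x and y to one common finite set of indices gives an element of the core, because the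
    truncation of y is the image of that of x. Since pairing with the e i shows that adjoint pairs
    have this form, the closure contains the adjoint. *)
Let D_coef x y : (forall i, inner y (e i) = (t i)%:C * inner x (e i)) -> D (x, y).
Proof.
move=> xy; apply/closure_pairP => eps e0.
have [s us sx] := psum_approx onb x e0; have [r ur ry] := psum_approx onb y e0.
have u : uniq (undup (s ++ r)) by exact: undup_uniq.
exists (\sum_(i <- undup (s ++ r)) inner x (e i) *: (e i, (t i)%:C *: e i)); split.
- by apply: linear_set_sum => // i _; exact: linear_setZ.
- by rewrite fst_sum; apply: sx => // i si; rewrite mem_undup mem_cat si.
- rewrite snd_sum /=.
  rewrite (eq_bigr (fun i => inner y (e i) *: e i)) => [|i _].
    by apply: ry => // i ri; rewrite mem_undup mem_cat ri orbT.
  by rewrite xy scalerA mulrC.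
Qed.

Lemma eigenbasis_self_adjoint : self_adjoint D.
Proof.
split.
  apply/dense_closure => x; apply: closure_subset (proj1 (dense_closure _) (basis_dense onb) x).
  apply: span_min => [|_ [i _ <-]]; last first.
    by exists ((t i)%:C *: e i); apply: subset_closure.
  have Dl := closure_linear D0l; split; first by exists 0; case: Dl.
  by move=> a x1 x2 [y1 h1] [y2 h2]; exists (a *: y1 + y2); exact: (proj2 Dl a _ _ h1 h2).
apply/seteqP; split=> [|[x y] Dxy]; first exact: Dsym.
apply: D_coef => i; have /= := Dxy _ _ (subset_closure (D0e i)).
by rewrite innerZl inner_conj => h; rewrite inner_conj -h conjc_realM -!inner_conj.
Qed.

Lemma eigenbasis_compact_resolvent : compact_resolvent D.
Proof.
pose q i : R := (Num.sqrt (1 + t i ^+ 2))^-1.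
have t1 i : 1 <= 1 + t i ^+ 2 by rewrite lerDl sqr_ge0.
have t10 i : 0 < 1 + t i ^+ 2 by apply: lt_le_trans (t1 i).
have s0 i : 0 < Num.sqrt (1 + t i ^+ 2) by rewrite sqrtr_gt0.
have s1 i : 1 <= Num.sqrt (1 + t i ^+ 2) by rewrite -[leLHS]sqrtr1 ler_wsqrtr.
have q0 i : 0 < q i by rewrite invr_gt0.
have q1 i : q i <= 1 by rewrite invf_le1.
have q2 i : q i ^+ 2 * (1 + t i ^+ 2) = 1.
  by rewrite exprVn sqr_sqrtr ?ltW// mulVf// gt_eqF.
(* A square root of the intended Q: with Q defined as its square, positivity follows from
   self-adjointness of [Rt]. *)
have [Rt RtE] : exists T : bop H,
    forall x i, inner (T x) (e i) = (Num.sqrt (q i))%:C * inner x (e i).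
  apply: (diag_bop onb (M := 1)) => // i; rewrite ger0_norm ?sqrtr_ge0//.
  by rewrite -[leRHS]sqrtr1 ler_wsqrtr.
(* [Y] is D Q^2. Its square has eigenvalues (t^2 q^2) q^2, a product of two factors at most 1, as
   q^2 (1 + t^2) = 1. *)
have [Y YE] : exists T : bop H,
    forall x i, inner (T x) (e i) = (t i * q i ^+ 2)%:C * inner x (e i).
  apply: (diag_bop onb (M := 1)) => // i.
  rewrite -(@ler_pXn2r _ 2) ?nnegrE// expr1n real_normK ?num_real//.
  have -> : (t i * q i ^+ 2) ^+ 2 = t i ^+ 2 * q i ^+ 2 * q i ^+ 2 by ring.
  have h : t i ^+ 2 * q i ^+ 2 <= 1.
    by rewrite -(q2 i) mulrC ler_wpM2l ?sqr_ge0// lerDr.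
  have h' : q i ^+ 2 <= 1 by rewrite -(q2 i) ler_peMr ?sqr_ge0.
  exact: mulr_ile1 (mulr_ge0 (sqr_ge0 _) (sqr_ge0 _)) (sqr_ge0 _) h h'.
have QE x i : inner ((Rt ** Rt) x) (e i) = (q i)%:C * inner x (e i).
  by rewrite /cmul/= !RtE mulrA -rcM -expr2 sqr_sqrtr// ltW.
exists (Rt ** Rt).
  split=> x.
    by rewrite /cmul/= (diag_self_adjoint onb RtE) inner_norm exprn_ge0.
  exists (Y x), (x - (Rt ** Rt) ((Rt ** Rt) x)); split; last by rewrite addrC subrK.
  - by apply: D_coef => i; rewrite YE !QE !mulrA -!rcM.
  - apply: D_coef => i; rewrite YE innerBl !QE !mulrA -!rcM.
    rewrite -{1}[inner x (e i)]mul1r -mulrBl -(rmorph1 (real_complex R)) -rmorphB.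
    by congr (_ * _); congr (_%:C); rewrite -(q2 i); ring.
apply: (diag_compact onb QE) => eps eps0.
apply: sub_finite_set (tfin eps^-1) => i /=; rewrite ger0_norm ?(ltW (q0 i))// => h.
apply: (@le_trans _ _ (Num.sqrt (1 + t i ^+ 2))).
  by rewrite -sqrtr_sqr ler_wsqrtr// lerDr ler01.
by move: h; rewrite -lef_pV2 ?posrE// invrK.
Qed.

End EigenbasisSpectral.

(** * Self-adjoint operators with compact resolvent *)

Lemma rnorm_sqr_le0 R (V : normedModType R[i]) (x : V) :
  rnorm x ^+ 2 <= 0 -> x = 0.
Proof.
move=> x0; have /eqP : rnorm x ^+ 2 = 0 by apply/eqP; rewrite eq_le x0 sqr_ge0.
by rewrite expf_eq0/= => /eqP/rnorm_eq0.
Qed.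

Lemma adjoint_graph_linear R (H : hilbertType R) (D : set (H * H)) :
  linear_set (adjoint_graph D).
Proof.
split=> [u v _|a p q Dp Dq u v Duv] /=; first by rewrite !inner0r.
by rewrite !innerDr !innerZr (Dp _ _ Duv) (Dq _ _ Duv).
Qed.

(** Polarisation: the quadratic form is real at x, y, x + y and x + i y, which gives two real
    equations for the real and imaginary parts. *)
Lemma positive_self_adjoint R (H : hilbertType R) (T : bop H) :
  positive_operator T -> forall x y, inner (T x) y = inner x (T y).
Proof.
move=> Tpos x y.
have Treal z : complex.Im (inner (T z) z) = 0.
  have := Tpos z; rewrite lecE /= => /andP[/eqP->]//.
have := Treal (x + y); have := Treal (x + 'i%C *: y).
rewrite !bopD bopZ !innerDl !innerDr !innerZl !innerZr.
have := Treal x; have := Treal y; rewrite (inner_conj (T y) x).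
case: (inner (T x) x) => a1 b1; case: (inner (T y) y) => a2 b2.
case: (inner (T x) y) => a3 b3; case: (inner (T y) x) => a4 b4 /=.
move=> -> -> h1 h2; apply/eqP; rewrite eq_complex /=; apply/andP.
by split; apply/eqP; lra.
Qed.

(** A cluster point replaces a convergent subsequence: it is enough that indices beyond any N bring
    T (x n) close to z. *)
Lemma compact_operator_cluster R (H : hilbertType R) (T : bop H)
    (x : nat -> H) : compact_operator T -> (forall n, rnorm (x n) <= 1) ->
  exists z, forall (d : R) N, 0 < d -> exists2 n, (N <= n)%N & rnorm (z - T (x n)) < d.
Proof.
move=> Tc x1.
have [|z [_ zc]] := Tc ((fun n => T (x n)) @ \oo).
  exists 0%N => // n _; apply: subset_closure; exists (x n) => //=.
  by have := x1 n; rewrite rnorm_le.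
exists z => d N d0.
have [|_ [[n Nn <-] /= zn]] :=
    zc [set T (x n) | n in [set n | (N <= n)%N]] _ _ (rball_nbhs z d0).
  by exists N => // n Nn; exists n.
by exists n.
Qed.

Section CompactResolvent.
Variables (R : realType) (H : hilbertType R) (D : set (H * H)).
Hypotheses (Dsa : self_adjoint D) (Dc : compact_resolvent D).
Implicit Types (x y u v : H).

Definition eigenvector v := exists t : R, D (v, t%:C *: v).

Lemma self_adjoint_linear : linear_set D.
Proof. by rewrite (proj2 Dsa); exact: adjoint_graph_linear. Qed.

Lemma self_adjoint_sym x y u v : D (x, y) -> D (u, v) -> inner v x = inner u y.
Proof. by rewrite {1}(proj2 Dsa) => Dxy Duv; exact: (Dxy u v Duv). Qed.

Lemma self_adjoint_fun x y z : D (x, y) -> D (x, z) -> y = z.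
Proof.
move=> xy xz; apply: subr0_eq.
apply: (dense_ortho (proj1 Dsa)) => u [v uv].
by rewrite innerBr -(self_adjoint_sym xy uv) -(self_adjoint_sym xz uv) subrr.
Qed.

Let Dl := self_adjoint_linear.

Let DZ a x y : D (x, y) -> D (a *: x, a *: y).
Proof. by move=> h; exact: (linear_setZ a Dl h). Qed.

(** Injectivity of 1 + D^2: pairing D^2 x = - x with x gives |D x|^2 = - |x|^2. *)
Let resolvent_uniq x y z : D (x, y) -> D (y, z) -> x + z = 0 -> x = 0.
Proof.
move=> xy yz xz; apply: rnorm_sqr_le0.
have h := self_adjoint_sym xy yz.
have := Re_inner_xx x; have := Re_inner_xx y; rewrite -h.
have -> : z = - x by apply/eqP; rewrite -addr_eq0 addrC xz.
by rewrite innerNl raddfN /= => hy hx; rewrite -hx -oppr_ge0 hy sqr_ge0.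
Qed.

Section Resolvent.
Variable Q : bop H.
Hypotheses (QD : is_inv_sqrt_resolvent D Q) (Qc : compact_operator Q).

Let Qs : forall x y, inner (Q x) y = inner x (Q y).
Proof. exact/positive_self_adjoint/(proj1 QD). Qed.

(** Only Q^2 is tied to D by an equation, and injectivity of 1 + D^2 yields Q^2 v = q^2 v. Then w =
    Q v - q v satisfies Q w = - q w, and positivity of Q leaves only w = 0. *)
Lemma inv_sqrt_eigen v (t : R) : D (v, t%:C *: v) ->
  Q v = ((Num.sqrt (1 + t ^+ 2))^-1)%:C *: v.
Proof.
move=> vt; set q := _^-1.
have t10 : 0 < 1 + t ^+ 2 by apply: ltr_pwDl; rewrite ?sqr_ge0.
have q0 : 0 < q by rewrite invr_gt0 sqrtr_gt0.
have q2 : q ^+ 2 * (1 + t ^+ 2) = 1.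
  by rewrite exprVn sqr_sqrtr ?ltW// mulVf// gt_eqF.
have QQ : Q (Q v) = (q ^+ 2)%:C *: v.
  have [y [z [h1 h2 h3]]] := (proj2 QD) v.
  have g1 := DZ (q ^+ 2)%:C vt; have g2 := DZ ((q ^+ 2)%:C * t%:C) vt.
  apply: subr0_eq.
  have k1 := linear_setB Dl h1 g1.
  rewrite -scalerA in g2; have k2 := linear_setB Dl h2 g2.
  apply: resolvent_uniq k1 k2 _.
  rewrite /= addrACA h3 -opprD scalerA -scalerDl -!rcM -rcD.
  have -> : q ^+ 2 + q ^+ 2 * t * t = 1 by rewrite -q2; ring.
  rewrite scale1r.
  by rewrite subrr.
apply: subr0_eq; set w := Q v - _.
have Qw : Q w = - (q%:C *: w).
  rewrite /w bopB bopZ QQ scalerBr scalerA -rcM -expr2 opprB.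
  by [].
have := proj1 QD w; rewrite Qw innerNl innerZl inner_xx -rcM -rmorphN ler0c.
by rewrite oppr_ge0 pmulr_rle0//; exact: rnorm_sqr_le0.
Qed.

Let D0 y : D (0, y) -> y = 0.
Proof. by move=> h; apply: self_adjoint_fun h _; case: Dl. Qed.

Lemma inv_sqrt_inj x : Q x = 0 -> x = 0.
Proof.
move=> Qx; have [y [z []]] := (proj2 QD) x; rewrite Qx bop0x.
by move=> /D0 -> /D0 -> <-; rewrite addr0.
Qed.

(* Q^2 y = l^2 y means D^2 y = m^2 y with m^2 = l^-2 - 1, so y is a combination of the
   eigenvectors D y + m y and D y - m y, and is itself an eigenvector when m = 0. *)
Lemma eigenvector_sqr y (l : R) : 0 < l -> Q (Q y) = (l ^+ 2)%:C *: y ->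
  span eigenvector y.
Proof.
move=> l0 QQ.
have [->|/eqP y0] := eqVneq y 0; first exact: (proj1 (span_linear _)).
have [a [b []]] := (proj2 QD) y; rewrite QQ => h1 h2 h3.
have l2 : 0 < l ^+ 2 by rewrite exprn_gt0.
have K x : (l ^- 2)%:C *: ((l ^+ 2)%:C *: x) = x.
  by rewrite scalerA -rcM mulVf ?gt_eqF// scale1r.
have {}h1 := DZ (l ^- 2)%:C h1; rewrite K in h1.
have {}h2 := DZ (l ^- 2)%:C h2.
pose m2 := l ^- 2 - 1.
have bE : (l ^- 2)%:C *: b = m2%:C *: y.
  rewrite /m2 rmorphB rmorph1 scalerBl scale1r -[X in _ = _ - X]K -scalerBr.
  by rewrite -[X in _ = _ *: (X - _)]h3 addrC addKr.
rewrite bE in h2; move: (_ *: a) h1 h2 => a' h1 h2.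
have m20 : 0 <= m2.
  have := self_adjoint_sym h1 h2; rewrite innerZl !inner_xx -rcM => /complexI h.
  have y2 : 0 < rnorm y ^+ 2 by rewrite exprn_gt0// rnorm_gt0.
  by rewrite -(pmulr_lge0 _ y2) h sqr_ge0.
pose m := Num.sqrt m2; have mm : m * m = m2 by rewrite -expr2 sqr_sqrtr.
have [m0|m0] := eqVneq m 0.
  have m2z : m2 = 0 by rewrite -mm m0 mul0r.
  have a0 : a' = 0.
    have := self_adjoint_sym h1 h2; rewrite m2z scale0r inner0l inner_xx.
    rewrite -[0 in LHS](rmorph0 (real_complex R)) => /complexI /esym/eqP.
    by rewrite expf_eq0/= => /eqP/rnorm_eq0.
  by apply: sub_span; exists 0; rewrite scale0r -a0.
have e1 : eigenvector (a' + m%:C *: y).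
  exists m; rewrite scalerDr scalerA -rcM mm [X in D (_, X)]addrC.
  exact: linear_setD Dl h2 (DZ m%:C h1).
have e2 : eigenvector (a' - m%:C *: y).
  exists (- m); rewrite scalerBr scalerA -rcM mulNr mm !rmorphN !scaleNr opprK [X in D (_, X)]addrC.
  exact: linear_setB Dl h2 (DZ m%:C h1).
have -> : y = ((2 * m)^-1)%:C *: ((a' + m%:C *: y) - (a' - m%:C *: y)).
  rewrite opprB addrACA [a' + _]addrC addrACA subrr addr0 -scalerDl -rcD scalerA.
  by rewrite -rcM -[m + m]mulr2n -[m *+ 2]mulr_natl mulVf ?scale1r// mulf_neq0// pnatr_eq0.
apply: linear_setZ => //.
by apply: linear_setB => //; exact: sub_span.
Qed.

(* Q maps the orthogonal complement M of the eigenvectors to itself. If M is not 0, let l be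
   the supremum of |Q x| over the unit ball of M: the images under Q of a maximising sequence
   cluster at some z in M, z <> 0, with Q^2 z = l^2 z, contradicting [eigenvector_sqr]. *)
Lemma eigenvector_dense : dense (span eigenvector).
Proof.
apply: linear_dense => //.
apply: contrapT => /existsNP[y /not_implyP[yE y0]].
pose M := [set x | forall v, eigenvector v -> inner x v = 0].
have Ml : linear_set M.
  split=> [v _|a u v Mu Mv w ew]; first exact: inner0l.
  by rewrite inner_linear Mu// Mv// mulr0 addr0.
have My : M y by move=> v ev; apply: yE; exact: sub_span.
have MQ x : M x -> M (Q x).
  move=> Mx v ev; have [t vt] := ev.
  by rewrite Qs (inv_sqrt_eigen vt) innerZr Mx// mulr0.
pose B := [set rnorm (Q x) | x in [set x | M x /\ rnorm x <= 1]].
have Bs : has_sup B.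
  split; first by exists (rnorm (Q 0)), 0 => //; split; [case: Ml|rewrite rnorm0].
  exists (bnorm Q) => _ [x [_ x1] <-]; apply: le_trans (le_bnorm _ _) _.
  by rewrite ler_piMr// bnorm_ge0.
pose l := sup B.
have lM x : M x -> rnorm (Q x) <= l * rnorm x.
  move=> Mx; have [->|/eqP x0] := eqVneq x 0; first by rewrite bop0x rnorm0 mulr0.
  have x1 := rnorm_gt0 x0; rewrite -ler_pdivrMr//; apply: ub_le_sup; first by case: Bs.
  have E z : rnorm ((rnorm x)^-1%:C *: z) = (rnorm x)^-1 * rnorm z.
    by rewrite rnormZ ger0_norm// ler0c invr_ge0 ltW.
  exists ((rnorm x)^-1%:C *: x); last by rewrite bopZ E mulrC.
  by split; [exact: (linear_setZ _ Ml Mx)|rewrite E mulVf ?gt_eqF].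
have l0 : 0 < l.
  have Qy : Q y <> 0 by move/inv_sqrt_inj.
  rewrite -(pmulr_lgt0 _ (rnorm_gt0 y0)).
  exact: lt_le_trans (rnorm_gt0 Qy) (lM _ My).
have /choice[x xP] : forall n : nat, exists x : H,
    [/\ M x, rnorm x <= 1 & l - n.+1%:R^-1 < rnorm (Q x)].
  move=> n; have [|_ [x [Mx x1] <-] lx] := @sup_adherent _ _ n.+1%:R^-1 _ Bs.
    by rewrite invr_gt0.
  by exists x.
have [z zP] := compact_operator_cluster (x := x) Qc ltac:(by move=> n; case: (xP n)).
pose T := Q ** Q - (l ^+ 2)%:C *: (cone : bop H).
have TE u : T u = Q (Q u) - (l ^+ 2)%:C *: u by rewrite bsubE.
(* Write b = |Q x_n| and d = 1 / (n + 1). Expanding the square, with |Q^2 x_n| <= l b and |x_n| <=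
   1, gives at most l^2 b^2 + l^4 - 2 l^2 b^2 = l^2 (l^2 - b^2), and b > l - d bounds this by 2 l^3
   d. *)
have Tx n : rnorm (T (x n)) ^+ 2 <= 2 * l ^+ 3 * n.+1%:R^-1.
  have [Mx x1 lx] := xP n; rewrite TE sqr_rnormB rnormZ.
  have -> : complex.Re (inner (Q (Q (x n))) ((l ^+ 2)%:C *: x n)) =
      l ^+ 2 * rnorm (Q (x n)) ^+ 2.
    by rewrite innerZr conjc_real Qs inner_xx -rcM.
  rewrite cabs_real ger0_norm ?sqr_ge0//.
  have h1 := lM _ (MQ _ Mx); have h2 := rnorm_ge0 (Q (Q (x n))).
  have h3 := rnorm_ge0 (Q (x n)); have h4 := rnorm_ge0 (x n).
  have d0 : (0 : R) <= n.+1%:R^-1 by rewrite invr_ge0.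
  move: (n.+1%:R^-1) d0 lx => d d0 lx.
  move: (rnorm (Q (Q (x n)))) (rnorm (Q (x n))) (rnorm (x n)) h1 h2 h3 h4 lx x1.
  move=> a b c h1 h2 h3 h4 lx x1.
  have h5 : a ^+ 2 <= l ^+ 2 * b ^+ 2.
    by rewrite -exprMn ler_pXn2r ?nnegrE// mulr_ge0// ltW.
  have h6 : (l ^+ 2 * c) ^+ 2 <= (l ^+ 2) ^+ 2.
    rewrite ler_pXn2r ?nnegrE ?mulr_ge0 ?(ltW l0)//.
    by rewrite ler_piMr ?sqr_ge0.
  have h7 : l ^+ 2 * (l ^+ 2 - b ^+ 2) <= l ^+ 2 * (2 * l * d).
    rewrite ler_wpM2l ?sqr_ge0//.
    have [bl|bl] := leP l b.
      have : 0 <= 2 * l * d.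
        by rewrite !mulr_ge0// ltW.
      nra.
    nra.
  nra.
have Tz : T z = 0.
  apply: rnorm_small => eps e0.
  have Q1 : 0 < bnorm Q + 1 by rewrite ltr_wpDl// bnorm_ge0.
  have T1 : 0 < bnorm T + 1 by rewrite ltr_wpDl// bnorm_ge0.
  pose eta := eps / 2 / (bnorm Q + 1).
  have eta0 : 0 < eta by rewrite !divr_gt0.
  have l3 : 0 < 2 * l ^+ 3 by rewrite mulr_gt0// exprn_gt0.
  have [N NE] := inv_small (divr_gt0 (exprn_gt0 2 eta0) l3).
  have dT : 0 < eps / 2 / (bnorm T + 1) by rewrite !divr_gt0.
  have [k Nk zk] := zP _ N dT.
  (* T is a polynomial in Q and commutes with it. The first term is small because z clusters, the
     second because T (x k) tends to 0. *)
  have -> : T z = T (z - Q (x k)) + Q (T (x k)).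
    rewrite (bopB T) (TE (Q (x k))) (TE (x k)) (bopB Q) bopZ subrK.
    by [].
  apply: le_lt_trans (rnormD _ _) _; rewrite [ltRHS]splitr; apply: ltrD.
    apply: le_lt_trans (le_bnorm _ _) _; move: zk; rewrite ltr_pdivlMr//.
    by apply: le_lt_trans; rewrite mulrC ler_wpM2l// lerDl.
  apply: le_lt_trans (le_bnorm _ _) _.
  have : rnorm (T (x k)) < eta.
    rewrite -(@ltr_pXn2r _ 2) ?nnegrE ?(ltW eta0)//.
    apply: le_lt_trans (Tx k) _; have := NE k Nk.
    by rewrite ltr_pdivlMr// mulrC.
  rewrite ltr_pdivlMr//; apply: le_lt_trans.
  by rewrite mulrC ler_wpM2l// lerDl.
have Mz : M z.
  move=> v ev; apply: (@closure_ortho _ _ (range (Q \o x))) => [_ [n _ <-]|].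
    by apply: MQ => //; case: (xP n).
  by apply/closureP => d d0; have [n _ zn] := zP d 0%N d0; exists (Q (x n)) => //; exists n.
have z0 : z = 0.
  have zE : span eigenvector z.
    by apply: (eigenvector_sqr l0); apply/eqP; rewrite -subr_eq0 -TE Tz.
  apply: rnorm_sqr_le0; rewrite -Re_inner_xx.
  rewrite (span_ortho (S := eigenvector) _ zE)// => v ev.
  exact/inner_sym0/Mz.
(* With z = 0 the cluster property makes |Q x_n| < l / 2 for some n >= N, whereas the maximising
   sequence has |Q x_n| > l - 1 / (n + 1) > l / 2. *)
have [N NE] := inv_small (divr_gt0 l0 (ltr0Sn _ 1)).
have [n Nn] := zP (l / 2) N (divr_gt0 l0 (ltr0Sn _ 1)).
have [_ _] := xP n; have := NE n Nn; rewrite z0 sub0r rnormN.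
by move: (n.+1%:R^-1) => d; lra.
Qed.

(** Q multiplies each e n by a number at least d = (1 + b^2)^(-1/2), so the orthogonal vectors Q (e
    n) are pairwise at distance at least d and cannot cluster, against compactness. *)
Lemma eigenvector_finite (e : nat -> H) (t : nat -> R) (b : R) :
  (forall i j, inner (e i) (e j) = (i == j)%:R) ->
  (forall i, D (e i, (t i)%:C *: e i)) -> ~ (forall i, `|t i| <= b).
Proof.
move=> eo De tb.
have e1 n : rnorm (e n) <= 1.
  by apply: sqr_rnorm_le => //; rewrite -Re_inner_xx eo eqxx expr1n.
pose q n := (Num.sqrt (1 + t n ^+ 2))^-1.
have Qe n : Q (e n) = (q n)%:C *: e n by exact: inv_sqrt_eigen.
have b0 : 0 < 1 + b ^+ 2 by apply: ltr_pwDl; rewrite ?sqr_ge0.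
pose d := (Num.sqrt (1 + b ^+ 2))^-1.
have d0 : 0 < d by rewrite invr_gt0 sqrtr_gt0.
have qd n : d <= q n.
  rewrite lef_pV2 ?posrE ?sqrtr_gt0// ?ler_wsqrtr ?lerD2l//.
    by rewrite -(real_normK (num_real (t n))) ler_pXn2r ?nnegrE// (le_trans _ (tb n)).
  by apply: ltr_pwDl; rewrite ?sqr_ge0.
have [z zP] := compact_operator_cluster Qc e1.
have [n _ zn] := zP (d / 2) 0%N (divr_gt0 d0 (ltr0Sn _ 1)).
have [m nm zm] := zP (d / 2) n.+1 (divr_gt0 d0 (ltr0Sn _ 1)).
have : rnorm (Q (e n) - Q (e m)) < d.
  apply: le_lt_trans (rdistD z _ _) _; rewrite rdistC [ltRHS]splitr; exact: ltrD.
apply/negP; rewrite -leNgt; apply: sqr_rnorm_le; rewrite ?(ltW d0)//.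
have nm0 : inner (e n) (e m) = 0 by rewrite eo ltn_eqF.
rewrite sqr_rnormB !Qe innerZl innerZr nm0.
rewrite [X in complex.Re X](_ : _ = 0); last by rewrite mulr0 mulr0.
rewrite mulr0 subr0.
rewrite !rnormZ !cabs_real.
have e1' k : rnorm (e k) = 1.
  by apply/eqP; rewrite -(@eqrXn2 _ 2)// -Re_inner_xx eo eqxx expr1n.
rewrite !e1' !mulr1 !real_normK ?num_real//.
by rewrite ler_wpDr ?sqr_ge0// ler_pXn2r ?nnegrE ?(ltW d0)// (le_trans (ltW d0)).
Qed.

End Resolvent.

Let orthonormal_eigenvectors (S : set H) := S `<=` eigenvector /\
  forall u v, S u -> S v -> inner u v = (u == v)%:R.

Let eigenvectorZ a v : eigenvector v -> eigenvector (a *: v).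
Proof. by move=> [t vt]; exists t; rewrite scalerA mulrC -scalerA; exact: DZ. Qed.

(** Zorn gives a maximal orthonormal set of eigenvectors. For an eigenvector v of eigenvalue r,
    subtract its projection p on the finitely many members of eigenvalue r. The remainder is again
    an eigenvector for r; it is orthogonal to those members by construction and to the others by
    symmetry of D. Maximality makes it 0, so all eigenvectors lie in the span, and these are
    total. *)
Lemma eigenbasis_ex : exists (I : choiceType) (e : I -> H) (t : I -> R),
  eigenbasis D e t.
Proof.
have [Q QD Qc] := Dc.
have [|S [[SE So] Smax]] := @Zorn_bigcup H orthonormal_eigenvectors.
  move=> F FP Ft; split=> [v [X FX Xv]|u v [X FX Xu] [Y FY Yv]].
    exact: (proj1 (FP X FX)).
  by have [XY|YX] := Ft X Y FX FY;
    [apply: (proj2 (FP Y FY)) => //; exact: XY|apply: (proj2 (FP X FX)) => //; exact: YX].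
have /choice[t tP] : forall i : S, exists t : R, D (val i, t%:C *: val i).
  by move=> i; apply: SE; exact: set_valP.
have eo (i j : S) : inner (val i) (val j) = (i == j)%:R by rewrite So//; exact: set_valP.
have tfin b : finite_set [set i | `|t i| <= b].
  apply: contrapT => /infiniteP/card_leP[f].
  pose g n : S := val (f (SigSub (mem_setT n))).
  apply: (@eigenvector_finite Q QD Qc (fun n => val (g n)) (t \o g) b) => [i j|i|i].
  - rewrite eo; congr (nat_of_bool _)%:R; apply/eqP/eqP => [/val_inj/inj|->//].
    by move=> /(_ (mem_setT _) (mem_setT _)) [].
  - exact: tP.
  - by have := set_valP (f (SigSub (mem_setT i))).
exists S, val, t; split=> //; split=> //.
apply: linear_dense => //.
move=> y yS; apply: (dense_ortho (eigenvector_dense QD Qc)) => z.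
apply: span_ortho => v [r vr]; apply: inner_sym0.
have /finite_seqP[s0 s0E] := tfin `|r|.
pose s := undup s0; have us : uniq s by exact: undup_uniq.
have sE i : t i = r -> i \in s.
  move=> ti; rewrite mem_undup.
  have : [set i | `|t i| <= `|r|] i by rewrite /= ti.
  by rewrite s0E.
pose s' := [seq i <- s | t i == r].
pose p := \sum_(i <- s') inner v (val i) *: val i.
have us' : uniq s' by exact: filter_uniq.
have pS : span (range (val : S -> H)) p.
  apply: linear_set_sum => // i _.
  by apply: linear_setZ => //; apply: sub_span; exists i.
have pr : D (p, r%:C *: p).
  rewrite /p scaler_sumr; have Dp : forall i, i \in s' ->
      D (inner v (val i) *: val i, r%:C *: (inner v (val i) *: val i)).
    move=> i; rewrite mem_filter => /andP[/eqP <- _].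
    by rewrite scalerA mulrC -scalerA; exact: DZ.
  elim: (s') Dp => [_|i q IH Dp]; first by rewrite !big_nil; exact: (proj1 Dl).
  rewrite !big_cons; apply: (linear_setD Dl (x := (_, _)) (y := (_, _))).
    by apply: Dp; rewrite mem_head.
  by apply: IH => j jq; apply: Dp; rewrite in_cons jq orbT.
have Dw : D (v - p, r%:C *: (v - p)) by rewrite scalerBr; exact: (linear_setB Dl vr pr).
have wr : eigenvector (v - p) by exists r.
have wo (i : S) : inner (v - p) (val i) = 0.
  have [ir|ir] := eqVneq (t i) r.
    have is' : i \in s' by rewrite mem_filter ir eqxx sE.
    rewrite innerBl inner_suml (bigD1_seq i)//= innerZl eo eqxx mulr1.
    rewrite big1 ?addr0 ?subrr// => j ji.
    by rewrite innerZl eo (negbTE ji) mulr0.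
  have := self_adjoint_sym (tP i) Dw; rewrite innerZl innerZr conjc_real => /eqP.
  rewrite -subr_eq0 -mulrBl -rmorphB mulf_eq0 => /orP[|/eqP//].
  by rewrite (inj_eq (@complexI R) _ 0) subr_eq0 eq_sym (negbTE ir).
have [vp|/eqP vp] := eqVneq (v - p) 0.
  by apply: yS; move/eqP: vp; rewrite subr_eq0 => /eqP ->.
exfalso.
pose w := (rnorm (v - p))^-1%:C *: (v - p).
have ww : inner w w = 1 by exact: inner_normalize.
have wS u : S u -> inner w u = 0.
  by move=> Su; have := wo (SigSub (mem_set Su)) => /= h; rewrite innerZl h mulr0.
have wnS : ~ S w by move/wS => h; have /eqP := ww; rewrite h eq_sym oner_eq0.
have neq u : S u -> (u == w) = false by move=> Su; apply/eqP => uw; apply: wnS; rewrite -uw.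
apply: (Smax (S `|` [set w])).
  by split; [exact: subsetUl|move=> /(_ w) h; apply: wnS; apply: h; right].
split=> [u [/SE//|->]|u v' [Su|->] [Sv|->]]; first exact: eigenvectorZ.
- exact: So.
- by rewrite (inner_sym0 (wS u Su)) neq.
- by rewrite (wS v' Sv) eq_sym neq.
- by rewrite ww eqxx.
Qed.

End CompactResolvent.

(** * The product operator *)

Section HsumTheory.
Variables (R : realType) (H : hilbertType R).
Implicit Types x : hsum H H.

Lemma sqr_rnorm_hsum x : rnorm x ^+ 2 = rnorm x.1 ^+ 2 + rnorm x.2 ^+ 2.
Proof.
by apply: complexI; rewrite rcD !rcX -!rnormE; exact: sqr_hsum_norm.
Qed.

Lemma rnorm_fst_le x : rnorm x.1 <= rnorm x.
Proof.
by apply: sqr_rnorm_le => //; rewrite sqr_rnorm_hsum lerDl sqr_ge0.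
Qed.

Lemma rnorm_snd_le x : rnorm x.2 <= rnorm x.
Proof.
by apply: sqr_rnorm_le => //; rewrite sqr_rnorm_hsum lerDr sqr_ge0.
Qed.

Lemma rnorm_hsum_le x : rnorm x <= rnorm x.1 + rnorm x.2.
Proof.
apply: sqr_rnorm_le; rewrite ?addr_ge0//.
by rewrite sqr_rnorm_hsum; have := rnorm_ge0 x.1; have := rnorm_ge0 x.2; nra.
Qed.

Lemma hsum_inner_def (x y : hsum H H) : inner x y = inner x.1 y.1 + inner x.2 y.2.
Proof. by []. Qed.

Lemma hsum_op_ex (A B C E : bop H) : exists T : bop (hsum H H),
  (forall x, T x = (A x.1 + B x.2, C x.1 + E x.2)) /\
  bnorm T <= bnorm A + bnorm B + (bnorm C + bnorm E).
Proof.
set M := _ + _; pose f x : hsum H H := (A x.1 + B x.2, C x.1 + E x.2).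
have fl : linear f.
  by move=> a x y; apply: injective_projections; rewrite /= !bop_linear scalerDr addrACA.
have M0 : 0 <= M by rewrite !addr_ge0.
have fM x : rnorm (f x) <= M * rnorm x.
  apply: le_trans (rnorm_hsum_le _) _; rewrite /M !mulrDl.
  apply: lerD; apply: le_trans (rnormD _ _) _; apply: lerD.
  - by apply: le_trans (le_bnorm _ _) _; rewrite ler_wpM2l ?rnorm_fst_le.
  - by apply: le_trans (le_bnorm _ _) _; rewrite ler_wpM2l ?rnorm_snd_le.
  - by apply: le_trans (le_bnorm _ _) _; rewrite ler_wpM2l ?rnorm_fst_le.
  - by apply: le_trans (le_bnorm _ _) _; rewrite ler_wpM2l ?rnorm_snd_le.
have [T TE] := bounded_bop fl M0 fM.
by exists T; split=> [x|]; [rewrite TE|apply: bnorm_le => // x; rewrite TE; exact: fM].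
Qed.

Definition hsum_op (A B C E : bop H) : bop (hsum H H) := sval (cid (hsum_op_ex A B C E)).

Lemma hsum_opE A B C E x : hsum_op A B C E x = (A x.1 + B x.2, C x.1 + E x.2).
Proof. by rewrite /hsum_op; case: cid => T []. Qed.

Lemma hsum_split (x y : H) : ((x, y) : hsum H H) = ((x, 0) : hsum H H) + ((0, y) : hsum H H).
Proof. by apply: injective_projections; rewrite /= ?addr0 ?add0r. Qed.

Lemma hsum_inl_linear : linear (fun x : H => (x, 0) : hsum H H).
Proof. by move=> a x y; apply: injective_projections; rewrite //= scaler0 addr0. Qed.

Lemma hsum_inr_linear : linear (fun x : H => (0, x) : hsum H H).
Proof. by move=> a x y; apply: injective_projections; rewrite //= scaler0 addr0. Qed.

Lemma rnorm_hsum_inl (x : H) : rnorm ((x, 0) : hsum H H) <= 1 * rnorm x.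
Proof. by apply: le_trans (rnorm_hsum_le _) _; rewrite /= rnorm0 addr0 mul1r. Qed.

Lemma rnorm_hsum_inr (x : H) : rnorm ((0, x) : hsum H H) <= 1 * rnorm x.
Proof. by apply: le_trans (rnorm_hsum_le _) _; rewrite /= rnorm0 add0r mul1r. Qed.

Definition dbl (T : bop H) : bop (hsum H H) := hsum_op T 0 0 T.

Lemma dblE T x : dbl T x = (T x.1, T x.2).
Proof. by rewrite hsum_opE !bzeroE addr0 add0r. Qed.

Lemma bnorm_dbl T : bnorm (dbl T) <= 2 * bnorm T.
Proof.
have -> : 2 * bnorm T = bnorm T + bnorm (0 : bop H) + (bnorm (0 : bop H) + bnorm T).
  by rewrite -rnorm_bop -(rnorm_bop (0 : bop H)) rnorm0; ring.
by rewrite /dbl /hsum_op; case: cid => S [].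
Qed.

Lemma dbl_linear : linear dbl.
Proof. by move=> a S T; apply: bopP => x; rewrite baddE bscaleE !dblE. Qed.

Lemma dblM S T : dbl (S ** T) = dbl S ** dbl T.
Proof. by apply: bopP => x; rewrite [RHS]/= !dblE. Qed.

Lemma dbl1 : dbl cone = cone.
Proof. by apply: bopP => x; rewrite dblE; case: x. Qed.

Lemma dbl_star T : dbl (star T) = star (dbl T).
Proof.
apply: bopP => x; apply: inner_injr => y.
by rewrite -(badjE (dbl T)) !dblE !hsum_inner_def /= !badjE.
Qed.

End HsumTheory.

Definition symmetric_graph R (H : hilbertType R) (D : set (H * H)) :=
  D `<=` adjoint_graph D.

Section ProductOperator.
Variables (R : realType) (H K : hilbertType R) (t : tensor_space H K).
Implicit Types (D : set (H * H)) (E : set (K * K)) (c : R[i]).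

Definition tensor_gen D E c : set (t * t) :=
  [set p | exists x x' y y',
    [/\ D (x, x'), E (y, y') &
        p = (ts_map t x y, ts_map t x' y + c *: ts_map t x y')]].

(** The span form allows linear arguments on generators; the scalars of a combination are absorbed
    by the left factors. *)
Lemma tensor_sumE D E c : linear_set D ->
  tensor_sum D E c = span (tensor_gen D E c).
Proof.
move=> Dl; apply/seteqP; split=> [[p1 p2] [n [x [x' [y [y' [h1 h2 /= -> ->]]]]]]|].
  have -> : (\sum_i ts_map t (x i) (y i),
      \sum_i (ts_map t (x' i) (y i) + c *: ts_map t (x i) (y' i))) =
      \sum_i (ts_map t (x i) (y i), ts_map t (x' i) (y i) + c *: ts_map t (x i) (y' i)).
    by apply: injective_projections; rewrite ?fst_sum ?snd_sum.
  apply: linear_set_sum => // i _.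
  by apply: sub_span; exists (x i), (x' i), (y i), (y' i).
move=> _ [n [a [p [pg ->]]]].
have /choice[x /choice[x' /choice[y /choice[y' pE]]]] := pg.
exists n, (fun i => a i *: x i), (fun i => a i *: x' i), y, y'; split=> [i|i||].
- by have [h _ _] := pE i; exact: (linear_setZ _ Dl h).
- by have [] := pE i.
- by rewrite fst_sum; apply: eq_bigr => i _; have [_ _ ->] := pE i; rewrite tsZl.
- rewrite snd_sum; apply: eq_bigr => i _; have [_ _ ->] := pE i; rewrite !tsZl /= scalerDr !scalerA.
  by rewrite [c * _]mulrC.
Qed.

Lemma tensor_sum_linear D E c : linear_set D ->
  linear_set (tensor_sum D E c : set (t * t)).
Proof. by move=> Dl; rewrite tensor_sumE. Qed.

(** Taking adjoints replaces c by its conjugate, so the entries with c = - i and c = i are adjoint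
    to each other; this is why the off-diagonal matrix is symmetric. *)
Lemma tensor_sum_adjoint D E c p q : linear_set D ->
  symmetric_graph D -> symmetric_graph E ->
  tensor_sum D E c p -> tensor_sum D E (conjc c) q ->
  inner (p.2 : t) q.1 = inner (p.1 : t) q.2.
Proof.
move=> Dl s1 s2; rewrite !tensor_sumE// => Sp Sq; move: p Sp.
apply: (@span_min _ _ _ [set p | inner p.2 q.1 = inner p.1 q.2]) => [|p Sp].
  split=> [|a u v /= hu hv]; first by rewrite /= !inner0l.
  by rewrite !inner_linear hu hv.
move: q Sq; apply: (@span_min _ _ _ [set q | inner p.2 q.1 = inner p.1 q.2]) => [|q].
  split=> [|a u v /= hu hv]; first by rewrite /= !inner0r.
  by rewrite !innerDr !innerZr hu hv.
move=> [a [a' [b [b' [h1 h2 ->]]]]]; move: Sp => [x [x' [y [y' [k1 k2 ->]]]]] /=.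
rewrite innerDl innerDr innerZl innerZr !ts_inner conjcK.
by rewrite (s1 _ h1 _ _ k1) (s2 _ h2 _ _ k2).
Qed.

(** Only the right factors are approximated. The left vectors x and x' stay fixed and enter the
    error through the constant [M]. *)
Lemma tensor_sum_closure D E c : linear_set D ->
  tensor_sum D (closure E) c `<=` closure (tensor_sum D E c : set (t * t)).
Proof.
move=> Dl; rewrite !tensor_sumE//; apply: span_min.
  exact/closure_linear/span_linear.
move=> _ [x [x' [y [y' [h1 /closure_pairP h2 ->]]]]]; apply/closure_pairP => e e0.
pose M := rnorm x + rnorm x' + cabs c * rnorm x.
have M0 : 0 <= M by rewrite !addr_ge0 ?mulr_ge0.
have M1 : 0 < M + 1 by rewrite ltr_wpDl.
have [[z z'] [D2z /=]] := h2 _ (divr_gt0 e0 M1).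
rewrite !ltr_pdivlMr// => yz yz'.
exists (ts_map t x z, ts_map t x' z + c *: ts_map t x z'); split=> /=.
- by apply: sub_span; exists x, x', z, z'.
- rewrite -tsBr rnorm_ts; apply: le_lt_trans yz; rewrite mulrC.
  apply: ler_wpM2l => //; rewrite /M -!addrA lerDl.
  by rewrite !addr_ge0 ?mulr_ge0.
- rewrite opprD addrACA -tsBr -scalerBr -tsBr.
  apply: le_lt_trans (rnormD _ _) _; rewrite rnormZ !rnorm_ts.
  have := rnorm_ge0 x; have := rnorm_ge0 x'; have := cabs_ge0 c.
  have := rnorm_ge0 (y - z); have := rnorm_ge0 (y' - z'); move: yz yz'; rewrite /M.
  move: (rnorm (y - z)) (rnorm (y' - z')) (rnorm x) (rnorm x') (cabs c).
  move=> a b u v k yz yz' b0 a0 k0 v0 u0.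
  have ku : 0 <= k * u by rewrite mulr_ge0.
  have -> : v * a + k * (u * b) = v * a + (k * u) * b by ring.
  move: (k * u) ku yz yz' => w w0 yz yz'.
  have [ab|ab] := leP a b; nra.
Qed.

Definition product_core D E : set (hsum t t * hsum t t) := [set p |
  tensor_sum D E (- 'i%C) (p.1.2, p.2.1) /\
  tensor_sum D E 'i%C (p.1.1, p.2.2)].

Lemma product_core_linear D E : linear_set D -> linear_set (product_core D E).
Proof.
move=> Dl; have h c : linear_set (tensor_sum D E c : set (t * t)).
  exact: tensor_sum_linear.
split=> [|a p q [p1 p2] [q1 q2]]; first by split; [case: (h (- 'i%C))|case: (h 'i%C)].
by split; [exact: (proj2 (h _) a _ _ p1 q1)|exact: (proj2 (h _) a _ _ p2 q2)].
Qed.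

Lemma product_core_sym D E : linear_set D ->
  symmetric_graph D -> symmetric_graph E -> symmetric_graph (product_core D E).
Proof.
move=> Dl s1 s2 p [p1 p2] u v [q1 q2]; rewrite !hsum_inner_def.
have ci : conjc 'i%C = - 'i%C :> R[i] by apply/eqP; rewrite eq_complex /= oppr0 !eqxx.
have cni : conjc (- 'i%C) = 'i%C :> R[i] by rewrite -ci conjcK.
have h1 : inner v.1 p.1.1 = inner u.2 p.2.2.
  by apply: (tensor_sum_adjoint (p := (u.2, v.1)) (q := (p.1.1, p.2.2)) Dl s1 s2 q1); rewrite cni.
have h2 : inner v.2 p.1.2 = inner u.1 p.2.1.
  by apply: (tensor_sum_adjoint (p := (u.1, v.2)) (q := (p.1.2, p.2.1)) Dl s1 s2 q2); rewrite ci.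
by rewrite h1 h2 addrC.
Qed.

(** This reconciles the two sides of the theorem: the equivariant construction uses M_ell on its
    core, while the length triple, as a spectral triple, carries the closure. *)
Lemma product_operator_closure D E : linear_set D ->
  product_operator t D (closure E) = product_operator t D E.
Proof.
move=> Dl; apply/seteqP; split.
  rewrite [X in _ `<=` X](proj1 (closure_id _) (@closed_closure _ _)).
  apply: closure_subset => -[[u1 u2] [v1 v2]] [/= h1 h2].
  have /closure_pairP k1 := tensor_sum_closure Dl h1.
  have /closure_pairP k2 := tensor_sum_closure Dl h2.
  apply/closure_pairP => e e0; have e2 : 0 < e / 2 by rewrite divr_gt0.
  have [[a2 b1] [/= T1 ua2 vb1]] := k1 _ e2; have [[a1 b2] [/= T2 ua1 vb2]] := k2 _ e2.
  exists ((a1, a2), (b1, b2)); split=> //=.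
    by apply: le_lt_trans (rnorm_hsum_le _) _; rewrite [ltRHS]splitr; exact: ltrD.
  by apply: le_lt_trans (rnorm_hsum_le _) _; rewrite [ltRHS]splitr; exact: ltrD.
have sub c : tensor_sum D E c `<=` (tensor_sum D (closure E) c : set (t * t)).
  move=> p [n [x [x' [y [y' [h1 h2 h3 h4]]]]]].
  by exists n, x, x', y, y'; split=> // i; apply: subset_closure.
by apply: closure_subset => p [h1 h2]; split; exact: sub.
Qed.

Lemma product_operator_odd D E x y : linear_set D ->
  product_operator t D E (x, y) ->
  product_operator t D E (standard_grading t x, - standard_grading t y).
Proof.
move=> Dl /closure_pairP xy; apply/closure_pairP => e e0.
have [[u v] [[h1 h2] /= xu yv]] := xy e e0.
have g (w : hsum t t) : rnorm (standard_grading t w) = rnorm w.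
  apply/eqP; rewrite -(@eqrXn2 _ 2)// !sqr_rnorm_hsum /=.
  by rewrite rnormN.
have gB (w z : hsum t t) : standard_grading t w - standard_grading t z = standard_grading t (w - z).
  by rewrite /standard_grading; congr (_, _) => /=; rewrite opprD.
exists (standard_grading t u, - standard_grading t v); split.
- split; rewrite /standard_grading /=.
    by have := linear_setN (tensor_sum_linear _ _ Dl) h1.
  by rewrite opprK.
- by rewrite /= gB g.
- by rewrite /= -opprD rnormN gB g.
Qed.

End ProductOperator.

Lemma rcV R (r : R) : (r^-1)%:C = (r%:C)^-1.
Proof. exact: fmorphV. Qed.

Section ProductEigenbasis.
Variables (R : realType) (H K : hilbertType R) (t : tensor_space H K).
Variables (D1 : set (H * H)) (D2 : set (K * K)).
Variables (I J : choiceType) (e : I -> H) (s : I -> R) (f : J -> K) (r : J -> R).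
Hypotheses (eb : eigenbasis D1 e s) (fb : eigenbasis D2 f r) (D1l : linear_set D1).

Let z i j : R[i] := (s i +i* r j)%C.
Let m i j : R := cabs (z i j).
Let theta i j : R[i] := if m i j == 0 then 1 else z i j / (m i j)%:C.
Let h : R := (Num.sqrt 2)^-1.
Let w i j := ts_map t (e i) (f j).

Let hh : h * h = 2^-1.
Proof. by rewrite -expr2 exprVn sqr_sqrtr. Qed.

Let z0 i j : m i j = 0 -> z i j = 0. Proof. exact: cabs_eq0. Qed.

Let theta1 i j : theta i j * conjc (theta i j) = 1.
Proof.
rewrite -sqr_cabs /theta; case: ifPn => [_|m0]; first by rewrite normr1 expr1n.
rewrite cabsM -rcV cabs_real normfV -/(m i j) [`|m i j|]ger0_norm ?cabs_ge0//.
by rewrite mulfV// expr1n.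
Qed.

Let ztheta i j : z i j = (m i j)%:C * theta i j.
Proof.
rewrite /theta; case: ifPn => [/eqP m0|m0]; first by rewrite m0 mul0r z0.
by rewrite mulrCA divff ?mulr1// (inj_eq (@complexI R) _ 0).
Qed.

Let zbar i j : conjc (z i j) * theta i j = (m i j)%:C.
Proof.
by rewrite ztheta conjc_realM -mulrA [conjc _ * _]mulrC theta1 mulr1.
Qed.

Let sgn (b : bool) : R := (-1) ^+ b.

(* On the span of (w, 0) and (0, w), w = e_i (x) f_j, the product operator is the matrix
   (0, conj z; z, 0) with z = s_i + i r_j. Its eigenvalues are |z| and -|z|, on the vectors
   (1, z/|z|) and (1, -z/|z|) over sqrt 2; z/|z| is replaced by 1 when z = 0. *)
Definition product_basis (p : I * J * bool) : hsum t t :=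
  let: (i, j, b) := p in (h%:C *: w i j, (h * sgn b)%:C *: (theta i j *: w i j)).

Definition product_eigenvalue (p : I * J * bool) : R :=
  let: (i, j, b) := p in sgn b * m i j.

Let w_inner i j i' j' : inner (w i j) (w i' j') = ((i == i') && (j == j'))%:R.
Proof.
have [[eo _] _ _] := eb; have [[fo _] _ _] := fb.
by rewrite ts_inner eo fo; do 2 case: (_ == _); rewrite /= ?mulr1 ?mulr0.
Qed.

Lemma product_eigenbasis : eigenbasis (product_core D1 D2 : set (hsum t t * hsum t t))
  product_basis product_eigenvalue.
Proof.
have [[eo ed] De fine] := eb; have [[fo fd] Df finf] := fb.
split; first split.
- move=> [[i j] b] [[i' j'] b']; rewrite hsum_inner_def /= !innerZl !innerZr.
  rewrite w_inner !conjc_real !xpair_eqE.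
  have [/andP[/eqP <- /eqP <-]|] := boolP ((i == i') && (j == j')); last first.
    by move=> _; rewrite !mulr0 addr0.
  rewrite !mulr1 [theta i j * _]mulrCA theta1 mulr1 -!rcM -rcD hh.
  have -> : 2^-1 + h * sgn b * (h * sgn b') = 2^-1 * (1 + sgn b * sgn b').
    by rewrite -hh; ring.
  rewrite /sgn; case: b; case: b'; rewrite /= ?expr1 ?expr0.
  + by rewrite mulN1r opprK -[1 + 1]/(2%:R : R) mulVf ?pnatr_eq0.
  + by rewrite mulN1r subrr mulr0.
  + by rewrite mul1r subrr mulr0.
  + by rewrite mul1r -[1 + 1]/(2%:R : R) mulVf ?pnatr_eq0.
- set S := range _; have Sl := span_linear S.
  have h0 : h != 0 by rewrite invr_eq0 sqrtr_eq0 -ltNge.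
  have t0 i j : theta i j != 0.
    apply/eqP => th; have /eqP := theta1 i j.
    by rewrite th mul0r eq_sym oner_eq0.
  (* The two basis vectors over (i, j) share their first component and have opposite second ones.
     Their sum and difference recover (w, 0) and (0, w), the latter up to the phase [theta], which
     has modulus 1. *)
  have g1 i j : span S ((w i j, 0) : hsum t t).
    have -> : ((w i j, 0) : hsum t t) = h%:C *:
        (product_basis (i, j, false) + product_basis (i, j, true)).
      apply: injective_projections => /=.
        rewrite -scalerDl scalerA -rcD -rcM mulrDr hh.
        have -> : 2^-1 + 2^-1 = 1 :> R by lra.
        by rewrite scale1r.
      by rewrite /sgn expr0 expr1 mulr1 mulrN1 rmorphN scaleNr subrr scaler0.
    by apply: linear_setZ => //; apply: linear_setD => //; apply: sub_span; eexists.
  have g2 i j : span S ((0, w i j) : hsum t t).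
    have -> : ((0, w i j) : hsum t t) = (h%:C / theta i j) *:
        (product_basis (i, j, false) - product_basis (i, j, true)).
      apply: injective_projections => /=; first by rewrite subrr scaler0.
      rewrite /sgn expr0 expr1 mulr1 mulrN1 rmorphN scaleNr opprK -scalerDl !scalerA.
      have e2 : h%:C * (h%:C + h%:C) = 1 :> R[i].
        by rewrite -rcD -rcM mulrDr hh -(rmorph1 (real_complex R)); congr (_%:C); lra.
      by rewrite -[LHS]scale1r; congr (_ *: _); rewrite -e2; field; exact: t0.
    by apply: linear_setZ => //; apply: linear_setB => //; apply: sub_span; eexists.
  have wd := @ts_total _ _ _ t _ _ ed fd.
  have c1 x : closure (span S) ((x, 0) : hsum t t).
    apply: (bounded_closure (@hsum_inl_linear _ t) (@rnorm_hsum_inl _ t) Sl wd) => _ [_ [_ [[i _ <-] [j _ <-] ->]]].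
    exact/subset_closure/g1.
  have c2 x : closure (span S) ((0, x) : hsum t t).
    apply: (bounded_closure (@hsum_inr_linear _ t) (@rnorm_hsum_inr _ t) Sl wd) => _ [_ [_ [[i _ <-] [j _ <-] ->]]].
    exact/subset_closure/g2.
  apply/dense_closure => -[x y]; rewrite hsum_split.
  exact: linear_setD (closure_linear Sl) _ _.
- move=> [[i j] b]; have Te c : tensor_sum D1 D2 c (w i j, ((s i)%:C + c * (r j)%:C) *: w i j).
    rewrite tensor_sumE//; apply: sub_span.
    exists (e i), ((s i)%:C *: e i), (f j), ((r j)%:C *: f j); split=> //.
    by rewrite tsZl tsZr scalerA -scalerDl.
  have zE : (s i)%:C + 'i%C * (r j)%:C = z i j.
    by apply/eqP; rewrite eq_complex /=; apply/andP; split; apply/eqP; ring.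
  have zcE : (s i)%:C + - 'i%C * (r j)%:C = conjc (z i j).
    by apply/eqP; rewrite eq_complex /=; apply/andP; split; apply/eqP; ring.
  split=> /=.
  + have Tl := tensor_sum_linear t D2 (- 'i%C) D1l.
    have := linear_setZ ((h * sgn b)%:C * theta i j) Tl (Te (- 'i%C)).
    rewrite zcE; congr (tensor_sum _ _ _ (_, _)); first by rewrite /= scalerA.
    rewrite /= !scalerA; congr (_ *: _).
    by rewrite -mulrA [theta i j * _]mulrC zbar -!rcM; congr (_%:C); ring.
  + have Tl := tensor_sum_linear t D2 'i%C D1l.
    have := linear_setZ h%:C Tl (Te 'i%C).
    rewrite zE; congr (tensor_sum _ _ _ (_, _)).
    rewrite /= !scalerA; congr (_ *: _).
    rewrite ztheta !mulrA -!rcM; congr (_%:C * _).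
    have b1 : sgn b * sgn b = 1 by rewrite -expr2 sqrr_sign.
    by rewrite -[LHS]mulr1 -b1; ring.
- move=> b.
  (* Both |s i| and |r j| are at most |z i j|, so a bound on the product eigenvalue confines each
     index to a finite set. *)
  have F := finite_setX (finite_setX (fine b) (finf b)) (@finite_finset bool setT).
  apply: sub_finite_set F => -[[i j] c] /=.
  have -> : `|sgn c * m i j| = m i j.
    by rewrite normrM /sgn normrX normrN1 expr1n mul1r ger0_norm ?cabs_ge0.
  move=> mb; split=> //; split; apply: le_trans mb; first exact: (Re_le_cabs (z i j)).
  exact: (Im_le_cabs (z i j)).
Qed.

Hypotheses (s1 : symmetric_graph D1) (s2 : symmetric_graph D2).

Lemma product_operator_self_adjoint : self_adjoint (product_operator t D1 D2).
Proof.
exact: eigenbasis_self_adjoint (product_core_linear t D2 D1l)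
  (product_core_sym D1l s1 s2) product_eigenbasis.
Qed.

Lemma product_operator_compact_resolvent : compact_resolvent (product_operator t D1 D2).
Proof.
exact: eigenbasis_compact_resolvent (product_core_linear t D2 D1l)
  product_eigenbasis.
Qed.

End ProductEigenbasis.

(** * Bounded commutators and their algebra *)

Section Commutators.
Variables (R : realType) (H : hilbertType R).
Implicit Types (D : set (H * H)) (S T B C : bop H).

(* [D, T] is a restriction of the bounded operator C. *)
Definition commutes_mod D T C : Prop := forall x y, D (x, y) -> D (T x, T y + C x).

Lemma commutes_mod_bounded D T C : self_adjoint D -> commutes_mod D T C ->
  bounded_commutator D T.
Proof.
move=> Dsa TC; split=> [x [y /TC h]|]; first by exists (T y + C x).
exists `|C| => x y z xy xz; rewrite (self_adjoint_fun Dsa xz (TC _ _ xy)) addrC addKr.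
rewrite !rnormE -rcM lecR; exact: le_bnorm.
Qed.

(** The commutator is bounded on the dense domain and extends to an operator [C]. With [C] named,
    the property passes to sums, products, tensor products and closures, for which the bare estimate
    is inconvenient. *)
Lemma bounded_commutes_mod D T : self_adjoint D -> bounded_commutator D T ->
  exists C, commutes_mod D T C.
Proof.
move=> Dsa [Td [M TM]]; have Dl := self_adjoint_linear Dsa.
pose Gam : set (H * H) := [set p | exists y z, [/\ D (p.1, y), D (T p.1, z) & p.2 = z - T y]].
have Gl : linear_set Gam.
  split; first by exists 0, 0; rewrite /= bop0x subrr; split=> //; case: Dl.
  move=> a p q [y [z [h1 h2 h3]]] [y' [z' [k1 k2 k3]]].
  exists (a *: y + y'), (a *: z + z'); split.
  - exact: (proj2 Dl a _ _ h1 k1).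
  - by rewrite /= bop_linear; exact: (proj2 Dl a _ _ h2 k2).
  - by rewrite /= h3 k3 bop_linear scalerBr opprD addrACA.
have M0 : 0 <= `|M| by [].
have [|p [y [z [h1 h2 h3]]]|C _ CG] := bop_extension Gl (cabs_ge0 M).
- apply/denseP => x e e0; have [/denseP/(_ x e e0)[u [y uy] xu] _] := Dsa.
  exists u => //; have [z Tz] : dom D (T u) by apply: Td; exists y.
  by exists (u, z - T y) => //; exists y, z.
- rewrite h3 -lecR rcM rc_norm -!rnormE; apply: le_trans (TM _ _ _ h1 h2) _.
  (* The bound [M] is a complex number. Away from x = 0 the estimate itself makes it real and
     nonnegative, hence at most its modulus. *)
  have [->|x0] := eqVneq p.1 0; first by rewrite normr0 !mulr0.
  rewrite ler_pM2r ?normr_gt0//; apply: real_ler_norm.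
  have : 0 <= M * `|p.1| by apply: le_trans (TM _ _ _ h1 h2).
  by rewrite pmulr_lge0 ?normr_gt0//; exact: ger0_real.
exists C => x y xy; have [z Tz] : dom D (T x) by apply: Td; exists y.
have -> : C x = z - T y by apply: CG; exists y, z.
by rewrite addrC subrK.
Qed.

Lemma commutes_mod_closure D T C : commutes_mod D T C -> commutes_mod (closure D) T C.
Proof.
move=> TC x y /closure_pairP xy; apply/closure_pairP => e e0.
pose M := bnorm T + bnorm C + 1.
have M0 : 0 < M by rewrite ltr_wpDl// addr_ge0// bnorm_ge0.
have [[u v] [uv /=]] := xy _ (divr_gt0 e0 M0); rewrite !ltr_pdivlMr// => xu yv.
have bT := bnorm_ge0 T; have bC := bnorm_ge0 C.
have nx := rnorm_ge0 (x - u); have ny := rnorm_ge0 (y - v).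
exists (T u, T v + C u); split=> /=; first exact: TC.
- rewrite -bopB; apply: le_lt_trans (le_bnorm _ _) _; apply: le_lt_trans xu.
  by rewrite mulrC ler_wpM2l// /M -addrA lerDl addr_ge0 ?ler01.
- rewrite opprD addrACA -!bopB; apply: le_lt_trans (rnormD _ _) _.
  apply: le_lt_trans (lerD (le_bnorm _ _) (le_bnorm _ _)) _.
  move: xu yv; rewrite /M.
  by have [ab|ab] := leP (rnorm (x - u)) (rnorm (y - v)); nra.
Qed.

Lemma commutes_modD D S T B C a : linear_set D -> commutes_mod D S B ->
  commutes_mod D T C -> commutes_mod D (a *: S + T) (a *: B + C).
Proof.
move=> Dl SB TC x y xy; rewrite !baddE !bscaleE addrACA -scalerDr.
exact: (proj2 Dl a _ _ (SB _ _ xy) (TC _ _ xy)).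
Qed.

Lemma commutes_modM D S T B C : linear_set D -> commutes_mod D S B ->
  commutes_mod D T C -> commutes_mod D (S ** T) (S ** C + B ** T).
Proof.
move=> Dl SB TC x y /TC/SB; congr (D (_, _)).
by rewrite baddE /cmul/= bopD addrA.
Qed.

Lemma commutes_mod0 D : linear_set D -> commutes_mod D 0 0.
Proof. by move=> [D0 _] x y _; rewrite !bzeroE addr0. Qed.

Lemma commutes_mod_span (S : set (H * H)) T C :
  (forall x y, S (x, y) -> span S (T x, T y + C x)) -> commutes_mod (span S) T C.
Proof.
move=> STC x y xy; pose F (p : H * H) : H * H := (T p.1, T p.2 + C p.1).
have Fl : linear F.
  move=> k p q; apply: injective_projections; rewrite /F /= !bop_linear//.
  by rewrite scalerDr addrACA.
by apply: (span_image Fl (span_linear _) _ xy) => -[u v]; exact: STC.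
Qed.

End Commutators.

Section ProductCommutator.
Variables (R : realType) (H K : hilbertType R) (t : tensor_space H K).
Variables (D1 : set (H * H)) (D2 : set (K * K)) (a B : bop H) (b C : bop K).
Hypotheses (D1l : linear_set D1) (aB : commutes_mod D1 a B) (bC : commutes_mod D2 b C).

(** Leibniz rule: the commutator of D1 (x) 1 + c (1 (x) D2) with a (x) b is [D1, a] (x) b + c (a (x)
    [D2, b]). *)
Lemma tensor_sum_commutes c : commutes_mod (tensor_sum D1 D2 c : set (t * t))
  (optens t a b) (optens t B b + c *: optens t a C).
Proof.
rewrite tensor_sumE//; apply: commutes_mod_span => _ _ [u [u' [v [v' [h1 h2 [-> ->]]]]]].
apply: sub_span; exists (a u), (a u' + B u), (b v), (b v' + C v); split.
- exact: aB.
- exact: bC.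
- rewrite baddE bscaleE bopD bopZ !optensE tsDl tsDr scalerDr.
  by congr (_, _); rewrite addrACA.
Qed.

Lemma product_commutes : commutes_mod (product_operator t D1 D2) (dbl (optens t a b))
  (hsum_op 0 (optens t B b + (- 'i%C) *: optens t a C)
           (optens t B b + 'i%C *: optens t a C) 0).
Proof.
apply: commutes_mod_closure => x y [h1 h2].
have k1 := tensor_sum_commutes h1; have k2 := tensor_sum_commutes h2.
rewrite !dblE hsum_opE !bzeroE add0r addr0.
by split.
Qed.

End ProductCommutator.

(** * Star-homomorphisms *)

Lemma expr_small R (r e : R) : 0 <= r -> r < 1 -> 0 < e ->
  exists N, r ^+ N < e.
Proof.
move=> r0 r1 e0; have [->|rn0] := eqVneq r 0; first by exists 1%N; rewrite expr1.
have {r0 rn0} r0 : 0 < r by rewrite lt_neqAle eq_sym rn0.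
pose d := r^-1 - 1.
have d0 : 0 < d by rewrite subr_gt0 invf_gt1.
have rd : r^-1 = d + 1 by rewrite subrK.
(* Bernoulli's inequality for r^-1 = 1 + d. *)
have bern n : 1 + d * n%:R <= r^-1 ^+ n.
  elim: n => [|n IH]; first by rewrite mulr0 addr0 expr0.
  rewrite exprS {1}rd -natr1.
  have : 0 <= (n%:R : R) by [].
  move: (r^-1 ^+ n) (n%:R) IH => x m xm m0.
  apply: le_trans _ (ler_wpM2l (addr_ge0 (ltW d0) ler01) xm).
  have -> : (d + 1) * (1 + d * m) = 1 + d * (m + 1) + d * d * m by ring.
  by rewrite lerDl !mulr_ge0// ltW.
have [N NE] := inv_small (mulr_gt0 e0 d0).
exists N.+1; rewrite -[r]invrK exprVn invf_plt ?posrE ?exprn_gt0 ?invr_gt0//.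
apply: lt_le_trans (bern _); apply: (@lt_le_trans _ _ (d * N.+1%:R)); last first.
  by rewrite lerDr ler01.
have := NE N (leqnn N); rewrite invf_plt ?posrE ?mulr_gt0// invfM => h.
by rewrite mulrC -ltr_pdivrMr.
Qed.

Section CstarTheory.
Variables (R : realType) (E : cstarType R).
Implicit Types a b c : E.

Lemma cmul0r a : 0 ** a = 0.
Proof. by apply: (@addIr _ (0 ** a)); rewrite -cmulDl !add0r. Qed.
Lemma cmulr0 a : a ** 0 = 0.
Proof. by apply: (@addIr _ (a ** 0)); rewrite -cmulDr !add0r. Qed.
Lemma cmulZl (k : R[i]) a b : (k *: a) ** b = k *: (a ** b).
Proof. by rewrite cscaleAl. Qed.
Lemma cmulZr (k : R[i]) a b : a ** (k *: b) = k *: (a ** b).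
Proof. by rewrite cscaleAr. Qed.
Lemma cmulNl a b : (- a) ** b = - (a ** b).
Proof. by rewrite -scaleN1r cmulZl scaleN1r. Qed.
Lemma cmulNr a b : a ** (- b) = - (a ** b).
Proof. by rewrite -scaleN1r cmulZr scaleN1r. Qed.
Lemma cmulBl a b c : (a - b) ** c = a ** c - b ** c.
Proof. by rewrite cmulDl cmulNl. Qed.
Lemma cmulBr a b c : a ** (b - c) = a ** b - a ** c.
Proof. by rewrite cmulDr cmulNr. Qed.
Lemma star0 : star (0 : E) = 0.
Proof. by have := starZ 0 (0 : E); rewrite scale0r => ->; rewrite conjc0 scale0r. Qed.
Lemma starN a : star (- a) = - star a.
Proof. by rewrite -scaleN1r starZ rmorphN rmorph1 scaleN1r. Qed.
Lemma starB a b : star (a - b) = star a - star b.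
Proof. by rewrite starD starN. Qed.
Lemma star1 : star cone = cone :> E.
Proof. by have := starM (star (cone : E)) cone; rewrite cmulr1 !starK cmulr1. Qed.

Lemma rnormM a b : rnorm (a ** b) <= rnorm a * rnorm b.
Proof. by rewrite -lecR rcM -!rnormE; exact: cnormM. Qed.

Lemma rnorm_starM a : rnorm (star a ** a) = rnorm a ^+ 2.
Proof. by apply: (@complexI R); rewrite rcX -!rnormE; exact: cstar_norm. Qed.

Lemma rnorm_star_ge a : rnorm a <= rnorm (star a).
Proof.
have [->|/eqP a0] := eqVneq a 0; first by rewrite rnorm0 rnorm_ge0.
rewrite -(ler_pM2r (rnorm_gt0 a0)) -expr2 -rnorm_starM; exact: rnormM.
Qed.

Lemma rnorm_star a : rnorm (star a) = rnorm a.
Proof.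
by apply/eqP; rewrite eq_le rnorm_star_ge andbT -{2}[a]starK rnorm_star_ge.
Qed.

(** The partial sums of the geometric series obey b_(n+1) = 1 + b_n a, and in the limit b = 1 + b a,
    a left inverse of 1 - a. *)
Lemma neumann a : rnorm a < 1 -> exists b, b ** (cone - a) = cone.
Proof.
move=> a1; pose b n : E := iter n (fun x => cone + x ** a) 0.
have a0 := rnorm_ge0 a.
have bS n : b n.+1 = cone + b n ** a by [].
(* The fixed point of C = |1| + C |a|, hence a bound preserved by the recursion. *)
pose C := rnorm (cone : E) / (1 - rnorm a).
have C0 : 0 <= C by rewrite divr_ge0// subr_ge0 ltW.
have bC n : rnorm (b n) <= C.
  elim: n => [|n IH]; first by rewrite rnorm0.
  rewrite bS; apply: le_trans (rnormD _ _) _.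
  have -> : C = rnorm (cone : E) + C * rnorm a by rewrite /C; field; rewrite subr_eq0 gt_eqF.
  rewrite lerD2l; apply: le_trans (rnormM _ _) _; exact: ler_wpM2r.
have bd n k : rnorm (b (n + k)%N - b n) <= rnorm a ^+ n * C.
  elim: n => [|n IH]; first by rewrite expr0 mul1r subr0.
  rewrite addSn !bS opprD addrACA subrr add0r -cmulBl exprSr -mulrA [rnorm a * C]mulrC mulrA.
  apply: le_trans (rnormM _ _) _; exact: ler_wpM2r.
have [e e0|l lP] := @rcauchy_cvg _ E b.
  have eC : 0 < e / 2 / (C + 1) by rewrite !divr_gt0// ltr_wpDl.
  have [N NE] := expr_small a0 a1 eC; exists N => m n Nm Nn.
  have h k : (N <= k)%N -> rnorm (b k - b N) < e / 2.
    move=> Nk; rewrite -(subnKC Nk); apply: le_lt_trans (bd _ _) _.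
    move: NE; rewrite ltr_pdivlMr ?ltr_wpDl//; apply: le_lt_trans.
    by rewrite ler_wpM2l ?exprn_ge0// lerDl ler01.
  apply: le_lt_trans (rdistD (b N) _ _) _; rewrite [ltRHS]splitr.
  by apply: ltrD; rewrite 1?rdistC; [rewrite rdistC|]; exact: h.
exists l; apply/subr0_eq/rnorm_small => e e0.
have [N NE] := lP (e / 2) (divr_gt0 e0 (ltr0Sn _ 1)).
have -> : l ** (cone - a) - cone = (l - b N.+1) - (l - b N) ** a.
  by rewrite bS cmulBr cmulr1 cmulBl opprB opprD !addrA subrK addrAC.
apply: le_lt_trans (rnormB _ _) _; rewrite [ltRHS]splitr; apply: ltrD.
  by apply: NE; exact: leqnSn.
apply: le_lt_trans (rnormM _ _) _; apply: le_lt_trans (NE N (leqnn N)).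
by rewrite ler_piMr// ltW.
Qed.

Lemma star_hom0 (F : cstarType R) (S : set E) (f : E -> F) :
  star_hom S f -> S 0 -> f 0 = 0.
Proof.
move=> [_ fl _ _] S0; have := fl 1 0 0 S0 S0; rewrite !scale1r addr0 => h.
by apply: (@addIr _ (f 0)); rewrite add0r -h.
Qed.

Lemma star_homZ (F : cstarType R) (f : E -> F) (k : R[i]) a :
  star_hom setT f -> f (k *: a) = k *: f a.
Proof.
by move=> fh; have [_ fl _ _] := fh; rewrite -[k *: a]addr0 fl// (star_hom0 fh)// addr0.
Qed.

Lemma star_homD (F : cstarType R) (f : E -> F) a b :
  star_hom setT f -> f (a + b) = f a + f b.
Proof. by move=> [_ fl _ _]; rewrite -[a]scale1r fl// !scale1r. Qed.

Lemma star_homB (F : cstarType R) (f : E -> F) a b :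
  star_hom setT f -> f (a - b) = f a - f b.
Proof. by move=> fh; rewrite star_homD// -scaleN1r star_homZ// scaleN1r. Qed.

(* If |pi a| = l > |a|, then 1 - l^-2 a^* a is invertible by the Neumann series, whereas
   1 - l^-2 (pi a)^* (pi a) is not bounded below. *)
Lemma star_hom_contractive (K : hilbertType R) (pi : E -> bop K) a :
  star_hom setT pi -> bnorm (pi a) <= rnorm a.
Proof.
move=> ph; have [p1 pl pM ps] := ph; rewrite leNgt; apply/negP => al.
set l := bnorm (pi a) in al.
have l0 : 0 < l by apply: le_lt_trans al; exact: rnorm_ge0.
have l2 : 0 < l ^+ 2 by rewrite exprn_gt0.
pose h := (l ^- 2)%:C *: (star a ** a).
have h1 : rnorm h < 1.
  rewrite rnormZ cabs_real ger0_norm ?invr_ge0 ?ltW// rnorm_starM mulrC.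
  by rewrite ltr_pdivrMr// mul1r ltr_pXn2r ?nnegrE// ltW.
have [b bh] := neumann h1.
(* Adding 1 ensures C >= 1, so that 1 - C^-2 has a real square root. *)
pose C := bnorm (pi b) + 1.
have C1 : 1 <= C by rewrite lerDr bnorm_ge0.
have C0 : 0 < C by apply: lt_le_trans C1.
(* For y = pi (1 - h) x one has x = pi b y, so |x| <= C |y|, while expanding the square gives |y|^2
   <= |x|^2 - l^-2 |pi a x|^2. Together they bound pi a by a number strictly below l, its norm. *)
have key x : rnorm (pi a x) ^+ 2 <= (l ^+ 2 * (1 - C ^- 2)) * rnorm x ^+ 2.
  have xE : x = pi b (x - (l ^- 2)%:C *: badj (pi a) (pi a x)).
    have := congr1 (fun y => pi y x) bh; rewrite p1 pM// star_homB// p1 star_homZ//.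
    rewrite pM// ps// => hx; rewrite -[LHS]/((cone : bop K) x) -hx.
    by rewrite /cmul /= scaleN1r.
  set y := x - _ in xE.
  have xy : rnorm x ^+ 2 <= C ^+ 2 * rnorm y ^+ 2.
    rewrite -exprMn ler_pXn2r ?nnegrE ?mulr_ge0 ?(ltW C0)//.
    rewrite {1}xE; apply: le_trans (le_bnorm _ _) _.
    by rewrite ler_wpM2r// lerDl ler01.
  have yE : rnorm y ^+ 2 <= rnorm x ^+ 2 - l ^- 2 * rnorm (pi a x) ^+ 2.
    rewrite sqr_rnormB innerZr conjc_real -badjE inner_xx -rcM /=.
    rewrite rnormZ cabs_real ger0_norm ?invr_ge0 ?(ltW l2)// exprMn.
    have : rnorm (badj (pi a) (pi a x)) ^+ 2 <= l ^+ 2 * rnorm (pi a x) ^+ 2.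
      rewrite -exprMn ler_pXn2r ?nnegrE ?mulr_ge0 ?(ltW l0)//.
      by rewrite /l -bnorm_adj; exact: le_bnorm.
    move=> k; have : (l ^- 2) ^+ 2 * rnorm (badj (pi a) (pi a x)) ^+ 2 <=
        l ^- 2 * rnorm (pi a x) ^+ 2.
      apply: le_trans (ler_wpM2l _ k) _; first by rewrite exprn_ge0// invr_ge0 ltW.
      by rewrite mulrA [_ ^+ 2 * l ^+ 2](_ : _ = l ^- 2)//; field; rewrite gt_eqF.
    lra.
  rewrite mulrAC -mulrA -ler_pdivrMl//.
  have : C ^- 2 * rnorm x ^+ 2 <= rnorm y ^+ 2 by rewrite ler_pdivrMl// exprn_gt0.
  lra.
have C2 : 0 <= 1 - C ^- 2.
  by rewrite subr_ge0 invf_le1 ?exprn_gt0// exprn_ege1.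
have := @bnorm_le _ _ (pi a) (l * Num.sqrt (1 - C ^- 2))
  ltac:(by rewrite mulr_ge0 ?sqrtr_ge0 ?(ltW l0)).
rewrite -/l => /(_ _)/wrap[x|].
  apply: rnorm_le_sqr; first by rewrite mulr_ge0 ?sqrtr_ge0 ?(ltW l0).
  by rewrite exprMn sqr_sqrtr.
apply/negP; rewrite -ltNge gtr_pMr// -[ltRHS]sqrtr1 ltr_sqrt//.
by rewrite gtrDl oppr_lt0 invr_gt0 exprn_gt0.
Qed.

End CstarTheory.

Lemma unitary_bnorm R (K : hilbertType R) (u : bop K) :
  star u ** u = cone -> bnorm u <= 1.
Proof.
move=> uu; apply: bnorm_le => // y; rewrite mul1r.
apply: sqr_rnorm_le => //.
by rewrite -lecR -!inner_xx badjE -[badj u (u y)]/((star u ** u) y) uu.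
Qed.

Lemma optensl_star_hom R (H K : hilbertType R) (t : tensor_space H K) :
  star_hom setT (fun a => optens t a cone).
Proof.
split=> [|k a b _ _|a b _ _|a _]; first exact: optens1.
- exact: (optens_linearl t cone k a b).
- by rewrite optensM cmulr1.
- by rewrite optens_star star1.
Qed.

(** * The convolution algebra *)

Lemma fsbigTE (T : choiceType) (Z : nmodType) (F : T -> Z) (s : seq T) : uniq s ->
  (forall x, F x <> 0 -> x \in s) -> \sum_(x \in [set: T]) F x = \sum_(x <- s) F x.
Proof.
move=> us Fs; rewrite (fsbigE s)// => [|x _ xs].
  by apply: eq_bigl => x; exact: in_setT.
by apply: contrapT => /Fs; exact/negP.
Qed.

Section ConvolutionAlgebra.
Variables (R : realType) (A : cstarType R) (G : groupType).
Variables (rho : G -> A -> A) (sigma : G -> G -> A).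
Hypothesis sys : twisted_system rho sigma.
Implicit Types (f g : G -> A) (a b : A) (x y z : G) (S : set A).

Local Notation conv := (conv rho sigma).
Local Notation convstar := (convstar rho sigma).
Local Notation single := (@single R A G).

Let rho_hom x : star_hom setT (rho x). Proof. by case: sys => /(_ x)[]. Qed.
Let rho1 a : rho 1%g a = a. Proof. by case: sys => _ _ _ _ []. Qed.
Let sigma1l x : sigma 1%g x = cone. Proof. by case: sys => _ _ _ _ [/(_ x)[]]. Qed.
Let rho0 x : rho x 0 = 0. Proof. exact: (star_hom0 (rho_hom x)). Qed.
Let rhoD x a b : rho x (a + b) = rho x a + rho x b.
Proof. exact: (star_homD _ _ (rho_hom x)). Qed.
Let rho_one x : rho x cone = cone. Proof. by case: (rho_hom x). Qed.
Let sigmaU x y : unitary (sigma x y). Proof. by case: sys. Qed.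

Lemma Cc_mono S : Cc S `<=` Cc (G := G) (setT : set A).
Proof. by move=> f [ff _]; split. Qed.

Lemma Cc_support S f : Cc S f -> exists2 s : seq G, uniq s & forall x, f x <> 0 -> x \in s.
Proof.
move=> [/finite_seqP[s sE] _]; exists (undup s); first exact: undup_uniq.
by move=> x fx; rewrite mem_undup; have : [set x | f x <> 0] x by []; rewrite sE.
Qed.

Lemma Cc_support2 S T f g : Cc S f -> Cc T g ->
  exists2 s : seq G, uniq s & forall x, x \notin s -> f x = 0 /\ g x = 0.
Proof.
move=> /Cc_support[s _ fs] /Cc_support[r _ gr].
exists (undup (s ++ r)) => [|x]; first exact: undup_uniq.
rewrite mem_undup mem_cat negb_or => /andP[xs xr].
by split; apply: contrapT; [move/fs; exact/negP|move/gr; exact/negP].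
Qed.

Lemma Cc_of_support S f (s : seq G) : (forall x, f x <> 0 -> x \in s) ->
  (forall x, S (f x)) -> Cc S f.
Proof.
by move=> fs fS; split=> //; apply: sub_finite_set (finite_seq s) => x; exact: fs.
Qed.

Lemma Cc_single S a x : S 0 -> S a -> Cc S (single a x).
Proof.
move=> S0 Sa; apply: (@Cc_of_support _ _ [:: x]) => y; rewrite /Defs.single.
  by case: eqP => [-> _|//]; rewrite mem_head.
by case: ifP.
Qed.

Lemma Cc_linear S (k : R[i]) f g : linear_set S -> Cc S f -> Cc S g ->
  Cc S (fun x => k *: f x + g x).
Proof.
move=> Sl Sf Sg; have [s _ fgs] := Cc_support2 Sf Sg.
apply: (@Cc_of_support _ _ s) => x; last by apply: (proj2 Sl); [case: Sf|case: Sg].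
by apply: contra_notT => /fgs[-> ->]; rewrite scaler0 addr0.
Qed.

Lemma CcD S f g : linear_set S -> Cc S f -> Cc S g -> Cc S (fun x => f x + g x).
Proof.
move=> Sl Sf Sg; have := Cc_linear 1 Sl Sf Sg.
by congr (Cc S _); apply/funext => x; rewrite scale1r.
Qed.

Lemma Cc0 S : S 0 -> Cc (G := G) S (fun=> 0).
Proof. by move=> S0; apply: (@Cc_of_support _ _ [::]). Qed.

Definition erase f x : G -> A := fun y => if y == x then 0 else f y.

Lemma erase_split f x : f = fun y => single (f x) x y + erase f x y.
Proof.
apply/funext => y; rewrite /Defs.single /erase.
by case: eqP => [->|]; rewrite ?addr0 ?add0r.
Qed.

Lemma erase_support f x (s : seq G) : (forall y, f y <> 0 -> y \in x :: s) ->
  forall y, erase f x y <> 0 -> y \in s.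
Proof.
by move=> fs y; rewrite /erase; case: eqP => [//|yx /fs]; rewrite in_cons => /predU1P[].
Qed.

(** Peeling off one point of the support at a time reduces additive identities on C_c(G, S) to the
    generators a delta_x. *)
Lemma Cc_ind S (P : (G -> A) -> Prop) : S 0 -> P (fun=> 0) ->
  (forall a x f, S a -> Cc S f -> P f -> P (fun y => single a x y + f y)) ->
  forall f, Cc S f -> P f.
Proof.
move=> S0 P0 Ps f Sf; have [s _ fs] := Cc_support Sf.
elim: s f Sf fs => [|x s IH] f Sf fs.
  suff -> : f = (fun=> 0) by [].
  by apply/funext => x; apply: contrapT => /fs.
have f's := erase_support fs.
have Sf' : Cc S (erase f x).
  by apply: (Cc_of_support f's) => y; rewrite /erase; case: ifP => // _; case: Sf.
by rewrite (erase_split f x); apply: Ps => //; [case: Sf|exact: IH].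
Qed.

Lemma convE f g (s : seq G) z : uniq s -> (forall x, f x <> 0 -> x \in s) ->
  conv f g z = \sum_(x <- s) f x ** rho x (g (x^-1 * z)%g) ** sigma x (x^-1 * z)%g.
Proof.
move=> us fs; apply: fsbigTE => // x fx; apply: fs => fx0; apply: fx.
by rewrite fx0 !cmul0r.
Qed.

Lemma conv0l g : conv (fun=> 0) g = fun=> 0.
Proof. by apply/funext => z; rewrite (@convE _ _ [::])// big_nil. Qed.

Lemma conv0r f : Cc setT f -> conv f (fun=> 0) = fun=> 0.
Proof.
move=> /Cc_support[s us fs]; apply/funext => z; rewrite (convE _ _ us fs) big1// => x _.
by rewrite rho0 cmulr0 cmul0r.
Qed.

Lemma convDl f f' g : Cc setT f -> Cc setT f' ->
  conv (fun x => f x + f' x) g = fun z => conv f g z + conv f' g z.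
Proof.
move=> fC f'C; have [s us fs] := Cc_support2 fC f'C; apply/funext => z.
rewrite !(convE _ _ us); try by move=> x; apply: contra_notT => /fs[h1 h2]; rewrite ?h1 ?h2 ?addr0.
by rewrite -big_split; apply: eq_bigr => x _; rewrite !cmulDl.
Qed.

Lemma convDr f g g' : Cc setT f ->
  conv f (fun x => g x + g' x) = fun z => conv f g z + conv f g' z.
Proof.
move=> /Cc_support[s us fs]; apply/funext => z; rewrite !(convE _ _ us fs) -big_split.
by apply: eq_bigr => x _; rewrite rhoD cmulDr cmulDl.
Qed.

Lemma conv_single a x b y : conv (single a x) (single b y) =
  single (a ** rho x b ** sigma x y) (x * y)%g.
Proof.
apply/funext => z; rewrite (@convE _ _ [:: x])//; last first.
  by move=> w; rewrite /Defs.single; case: eqP => // -> _; rewrite mem_head.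
rewrite big_seq1 /Defs.single eqxx -(inj_eq (mulgI x)) mulVKg.
have [->|_] := eqVneq z (x * y)%g; first by rewrite mulKg.
by rewrite rho0 cmulr0 cmul0r.
Qed.

Lemma convstarD f g : convstar (fun x => f x + g x) =
  fun x => convstar f x + convstar g x.
Proof.
by apply/funext => x; rewrite /Defs.convstar starD rhoD cmulDr.
Qed.

Lemma convstar0 : convstar (fun=> 0) = fun=> 0.
Proof. by apply/funext => x; rewrite /Defs.convstar star0 rho0 cmulr0. Qed.

Lemma convstar_single a x : convstar (single a x) =
  single (star (sigma x^-1%g x) ** rho x^-1%g (star a)) x^-1%g.
Proof.
apply/funext => z; rewrite /Defs.convstar /Defs.single -(inj_eq invg_inj) invgK.
have [->|_] := eqVneq z x^-1%g; first by rewrite invgK.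
by rewrite star0 rho0 cmulr0.
Qed.

Section Closed.
Variable S : set A.
Hypotheses (Ss : star_subalgebra S) (S_rho : forall x a, S a -> S (rho x a))
  (S_sigma : forall x y, S (sigma x y)).

Lemma star_subalgebra_linear (E : cstarType R) (T : set E) : star_subalgebra T -> linear_set T.
Proof.
move=> [T1 Tl _ _]; split=> //.
by have := Tl (-1) cone cone T1 T1; rewrite scaleN1r addNr.
Qed.

Let Sl := star_subalgebra_linear Ss.
Let SM a b : S a -> S b -> S (a ** b). Proof. by case: Ss => _ _ h _; exact: h. Qed.
Let Sstar a : S a -> S (star a). Proof. by case: Ss => _ _ _ h; exact: h. Qed.

Lemma Cc_conv f g : Cc S f -> Cc S g -> Cc S (conv f g).
Proof.
move=> Sf Sg; move: f Sf; apply: Cc_ind => [||a x f Sa Sf IH]; first exact: (proj1 Sl).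
  by rewrite conv0l; apply: Cc0; exact: (proj1 Sl).
have Sax : Cc S (single a x) by apply: Cc_single => //; exact: (proj1 Sl).
rewrite convDl; [|exact: Cc_mono Sax|exact: Cc_mono Sf].
apply: CcD => //; move: g Sg {IH}; apply: Cc_ind => [||b y g Sb Sg IH].
- exact: (proj1 Sl).
- by rewrite conv0r; [apply: Cc0; exact: (proj1 Sl)|exact: Cc_mono Sax].
- rewrite convDr; last exact: Cc_mono Sax.
  apply: CcD => //; rewrite conv_single; apply: Cc_single; first exact: (proj1 Sl).
  by apply: SM => //; apply: SM => //; exact: S_rho.
Qed.

Lemma Cc_convstar f : Cc S f -> Cc S (convstar f).
Proof.
move: f; apply: Cc_ind => [||a x f Sa Sf IH]; first exact: (proj1 Sl).
  by rewrite convstar0; apply: Cc0; exact: (proj1 Sl).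
rewrite convstarD; apply: CcD => //; rewrite convstar_single.
apply: Cc_single; first exact: (proj1 Sl).
by apply: SM; [exact: Sstar|apply: S_rho; exact: Sstar].
Qed.

End Closed.

Lemma Cc_convT f g : Cc setT f -> Cc setT g -> Cc setT (conv f g).
Proof. exact: Cc_conv. Qed.

Lemma Cc_convstarT f : Cc setT f -> Cc setT (convstar f).
Proof. exact: Cc_convstar. Qed.

Lemma CcT_linear (k : R[i]) f g : Cc setT f -> Cc setT g -> Cc setT (fun x => k *: f x + g x).
Proof. exact: Cc_linear. Qed.

Lemma CcT_single a x : Cc setT (single a x).
Proof. exact: Cc_single. Qed.

Section Representation.
Variables (K : hilbertType R) (Theta : (G -> A) -> bop K).
Hypothesis TR : Cc_representation rho sigma Theta.

Lemma Cc_repD f g : Cc setT f -> Cc setT g -> Theta (fun x => f x + g x) = Theta f + Theta g.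
Proof.
have [_ Tl _ _] := TR => Sf Sg; have := Tl 1 f g Sf Sg; rewrite scale1r => <-.
by congr (Theta _); apply/funext => x; rewrite scale1r.
Qed.

Lemma Cc_rep0 : Theta (fun=> 0) = 0.
Proof.
have h := @Cc0 setT I; apply: (@addrI _ (Theta (fun=> 0))); rewrite -Cc_repD//.
rewrite [RHS]addr0; congr (Theta _); apply/funext => x; exact: addr0.
Qed.

Lemma Cc_repB f g : Cc setT f -> Cc setT g -> Theta (fun x => f x - g x) = Theta f - Theta g.
Proof.
have [_ Tl _ _] := TR => Sf Sg; have := Tl (-1) g f Sg Sf.
rewrite scaleN1r addrC => <-; congr (Theta _); apply/funext => x.
by rewrite scaleN1r addrC.
Qed.

Lemma Cc_rep_unit : star_hom setT (fun a => Theta (single a 1%g)).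
Proof.
have [T1 Tl TM Ts] := TR; split=> [//|k a b _ _|a b _ _|a _].
- rewrite -Tl; [|exact: CcT_single..]; congr (Theta _); apply/funext => y.
  by rewrite /Defs.single; case: ifP => // _; rewrite scaler0 addr0.
- by rewrite -TM; [|exact: CcT_single..]; rewrite conv_single rho1 sigma1l cmulr1 mulg1.
- rewrite -Ts; last exact: CcT_single.
  by rewrite convstar_single invg1 sigma1l star1 cmul1r rho1.
Qed.

Lemma Cc_rep_group x : bnorm (Theta (single cone x)) <= 1.
Proof.
have [T1 Tl TM Ts] := TR; set u := Theta _.
apply: unitary_bnorm; rewrite /u -Ts; last exact: CcT_single.
rewrite -TM; [|exact/Cc_convstarT/CcT_single|exact: CcT_single].
rewrite convstar_single conv_single mulVg star1 !rho_one !cmulr1.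
by rewrite (proj1 (sigmaU _ _)).
Qed.

(** a delta_x is the product of a delta_e and 1 delta_x: the first factor is contracted because a ->
    Theta (a delta_e) is a representation of A, and the second is sent to an isometry. *)
Lemma Cc_rep_single a x : bnorm (Theta (single a x)) <= rnorm a.
Proof.
have [T1 Tl TM Ts] := TR.
have -> : single a x = conv (single a 1%g) (single cone x).
  by rewrite conv_single rho1 sigma1l !cmulr1 mul1g.
rewrite TM; [|exact: CcT_single..].
apply: le_trans (bnormM _ _) _; rewrite -[leRHS]mulr1.
apply: ler_pM; rewrite ?Cc_rep_group//.
exact: (star_hom_contractive a Cc_rep_unit).
Qed.

(** The l^1 bound does not depend on [Theta]; it is what makes the enveloping norm finite. *)
Lemma Cc_rep_bound f (s : seq G) : uniq s -> (forall x, f x <> 0 -> x \in s) ->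
  bnorm (Theta f) <= \sum_(x <- s) rnorm (f x).
Proof.
elim: s f => [|x s IH] f /=.
  move=> _ fs; rewrite big_nil (_ : f = fun=> 0) ?Cc_rep0 -?rnorm_bop ?rnorm0//.
  by apply/funext => y; apply: contrapT => /fs.
move=> /andP[xs us] fs; rewrite big_cons.
have f's := erase_support fs.
have Sf' : Cc setT (erase f x) by exact: Cc_of_support f's _.
rewrite {1}(erase_split f x) Cc_repD//; last exact: CcT_single.
rewrite -rnorm_bop; apply: le_trans (rnormD _ _) _; rewrite !rnorm_bop.
apply: lerD; first exact: Cc_rep_single.
apply: le_trans (IH _ us f's) _; rewrite big_seq [leRHS]big_seq.
apply: ler_sum => y ys; rewrite /erase; case: eqP => [yx|//].
by move: xs; rewrite -yx ys.
Qed.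

End Representation.

End ConvolutionAlgebra.

Section IntegratedForm.
Variables (R : realType) (A : cstarType R) (G : groupType).
Variables (rho : G -> A -> A) (sigma : G -> G -> A).
Hypothesis sys : twisted_system rho sigma.
Variables (K : hilbertType R) (pi : A -> bop K) (U : G -> bop K).
Hypothesis cov : twisted_covariant rho sigma pi U.
Local Notation single := (@single R A G).

Let ph : star_hom setT pi. Proof. by case: cov. Qed.
Let UU x : unitary (U x). Proof. by case: cov. Qed.
Let sigma1l x : sigma 1%g x = cone. Proof. by case: sys => _ _ _ _ [/(_ x)[]]. Qed.

Lemma covariant_unit : U 1%g = cone.
Proof.
have [[p1 _ _ _] _ UM _] := cov; have := UM 1%g 1%g.
rewrite mulg1 sigma1l p1 cmul1r => h.
by have := congr1 (cmul (star (U 1%g))) h; rewrite cmulA (proj1 (UU _)) cmul1r.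
Qed.

(** This is U_(x^-1) U_x = pi(sigma(x^-1, x)) solved for the adjoint of U_x; it explains the cocycle
    factor in [convstar]. *)
Lemma covariant_inv x : star (pi (sigma x^-1%g x)) ** U x^-1%g = star (U x).
Proof.
have [[p1 pl pM ps] _ UM _] := cov; have := UM x^-1%g x.
rewrite mulVg covariant_unit cmulr1 => <-.
by rewrite starM -cmulA (proj1 (UU x^-1%g)) cmulr1.
Qed.

Lemma integratedE f (s : seq G) : uniq s -> (forall x, f x <> 0 -> x \in s) ->
  integrated pi U f = \sum_(x <- s) pi (f x) ** U x.
Proof.
move=> us fs; apply: fsbigTE => // x fx; apply: fs => fx0; apply: fx.
by rewrite fx0 (star_hom0 ph)// cmul0r.
Qed.

Lemma integrated0 : integrated pi U (fun=> 0) = 0.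
Proof. by rewrite (@integratedE _ [::])// big_nil. Qed.

Lemma integrated_linear (k : R[i]) f g : Cc setT f -> Cc setT g ->
  integrated pi U (fun x => k *: f x + g x) = k *: integrated pi U f + integrated pi U g.
Proof.
move=> fC gC; have [s us fs] := Cc_support2 fC gC.
rewrite !(integratedE us);
  try by move=> x; apply: contra_notT => /fs[h1 h2]; rewrite ?h1 ?h2 ?scaler0 ?addr0.
rewrite scaler_sumr -big_split; apply: eq_bigr => x _.
by rewrite star_homD// star_homZ// cmulDl cmulZl.
Qed.

Lemma integratedD f g : Cc setT f -> Cc setT g ->
  integrated pi U (fun x => f x + g x) = integrated pi U f + integrated pi U g.
Proof.
move=> Sf Sg; have := integrated_linear 1 Sf Sg; rewrite scale1r => <-.
by congr integrated; apply/funext => x; rewrite scale1r.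
Qed.

Lemma integrated_single a x : integrated pi U (single a x) = pi a ** U x.
Proof.
rewrite (@integratedE _ [:: x])// => [|y].
  by rewrite big_seq1 /Defs.single eqxx.
by rewrite /Defs.single; case: eqP => // -> _; rewrite mem_head.
Qed.

(** Both sides of each identity are additive, so everything reduces to a delta_x and b delta_y,
    where it is the covariance of (pi, U). *)
Lemma integrated_Cc_representation : Cc_representation rho sigma (integrated pi U).
Proof.
have [[p1 pl pM ps] _ UM Uc] := cov; split.
- by rewrite integrated_single p1 covariant_unit cmul1r.
- by move=> k f g Sf Sg; exact: integrated_linear.
- move=> f g Sf Sg; move: f Sf.
  apply: Cc_ind => [//||a x f _ Sf IH]; first by rewrite conv0l integrated0 cmul0r.
  have Sax : Cc setT (single a x) by exact: CcT_single.
  rewrite convDl// !integratedD//; [|exact: Cc_convT..].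
  rewrite IH cmulDl; congr (_ + _); move: g Sg {IH}.
  apply: Cc_ind => [//||b y g _ Sg IH]; first by rewrite conv0r// integrated0 cmulr0.
  rewrite convDr// !integratedD//; [|exact: CcT_single|apply: Cc_convT => //; exact: CcT_single
    |exact: Cc_convT].
  rewrite IH cmulDr; congr (_ + _).
  rewrite conv_single// !integrated_single !pM// Uc -!cmulA.
  rewrite -UM [star (U x) ** _]cmulA (proj1 (UU x)) cmul1r.
  by [].
- apply: Cc_ind => [//||a x f _ Sf IH]; first by rewrite convstar0// integrated0 star0.
  rewrite convstarD// !integratedD//; [|exact: CcT_single|apply: Cc_convstarT => //; exact: CcT_single
    |exact: Cc_convstarT].
  rewrite IH starD; congr (_ + _).
  rewrite convstar_single// !integrated_single pM// !ps// Uc starM ps//.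
  rewrite -!cmulA (proj1 (UU x^-1%g)) cmulr1 cmulA covariant_inv.
  by [].
Qed.

End IntegratedForm.

(** * Limits of sequences and continuity on a subset *)

Definition seq_lim R (V : normedModType R[i]) (u : nat -> V) (l : V) : Prop :=
  forall e : R, 0 < e -> exists N, forall n, (N <= n)%N -> rnorm (l - u n) < e.

Lemma seq_limP R (V : normedModType R[i]) (u : nat -> V) (l : V) :
  (u @ \oo --> l) <-> seq_lim u l.
Proof.
rewrite real_cvgP; split=> h e /h[N].
  by move=> _ NE; exists N => n /NE.
by move=> NE; exists N => // n /NE.
Qed.

Section SeqLim.
Variable R : realType.

Lemma seq_lim_cst (V : normedModType R[i]) (l : V) : seq_lim (fun=> l) l.
Proof. by move=> e e0; exists 0%N => n _; rewrite subrr rnorm0. Qed.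

Lemma seq_lim_linear (V : normedModType R[i]) (k : R[i]) (u v : nat -> V) l m :
  seq_lim u l -> seq_lim v m -> seq_lim (fun n => k *: u n + v n) (k *: l + m).
Proof.
move=> ul vm e e0; have k1 : 0 < cabs k + 1 by rewrite ltr_wpDl.
have [N NE] := ul (e / 2 / (cabs k + 1)) ltac:(by rewrite !divr_gt0).
have [P PE] := vm (e / 2) ltac:(by rewrite divr_gt0).
exists (maxn N P) => n; rewrite geq_max => /andP[Nn Pn].
rewrite opprD addrACA -scalerBr; apply: le_lt_trans (rnormD _ _) _.
rewrite [ltRHS]splitr; apply: ltrD; last exact: PE.
rewrite rnormZ; have := NE n Nn; rewrite ltr_pdivlMr//; apply: le_lt_trans.
by rewrite mulrC ler_wpM2l// lerDl ler01.
Qed.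

Lemma seq_limM (E : cstarType R) (u v : nat -> E) l m :
  seq_lim u l -> seq_lim v m -> seq_lim (fun n => u n ** v n) (l ** m).
Proof.
move=> ul vm e e0; pose M := rnorm l + rnorm m + 1.
have M0 : 0 < M by rewrite ltr_wpDl// addr_ge0.
(* The minimum with 1 makes the quadratic error |l - u| |m - v| linear in d, so the total stays
   below d M <= e. *)
pose d := Num.min 1 (e / M).
have d0 : 0 < d by rewrite lt_min ltr01 divr_gt0.
have [N NE] := ul d d0; have [P PE] := vm d d0.
exists (maxn N P) => n; rewrite geq_max => /andP[/NE lu /PE mv].
have -> : l ** m - u n ** v n = (l - u n) ** m + l ** (m - v n) - (l - u n) ** (m - v n).
  rewrite !cmulBl !cmulBr [- (_ - _ - _)]opprB [RHS]addrACA subrr addr0.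
  by rewrite addrA subrK.
apply: le_lt_trans (rnormB _ _) _.
apply: (@le_lt_trans _ _ (rnorm (l - u n) * rnorm m + rnorm l * rnorm (m - v n) +
    rnorm (l - u n) * rnorm (m - v n))).
  apply: lerD; last exact: rnormM.
  by apply: le_trans (rnormD _ _) _; apply: lerD; exact: rnormM.
have := rnorm_ge0 l; have := rnorm_ge0 m.
have := rnorm_ge0 (l - u n); have := rnorm_ge0 (m - v n).
have d1 : d <= 1 by rewrite ge_min lexx.
have dM : d * M <= e by rewrite -ler_pdivlMr// ge_min lexx orbT.
move: lu mv dM; rewrite /M.
move: (rnorm (l - u n)) (rnorm (m - v n)) (rnorm l) (rnorm m) d d0 d1 {M0 NE PE}.
move=> a b p q c c0 c1 ac bc dM b0 a0 q0 p0.
apply: (@lt_le_trans _ _ (c * q + p * c + c * 1)); last by nra.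
apply: ler_ltD; first by apply: lerD; [apply: ler_wpM2r => //; exact: ltW|apply: ler_wpM2l => //; exact: ltW].
nra.
Qed.

Lemma seq_lim_star (E : cstarType R) (u : nat -> E) l :
  seq_lim u l -> seq_lim (fun n => star (u n)) (star l).
Proof.
by move=> ul e /ul[N NE]; exists N => n /NE; rewrite -starB rnorm_star.
Qed.

Lemma seq_lim_closure (V : normedModType R[i]) (u : nat -> V) l (S : set V) :
  (forall n, S (u n)) -> seq_lim u l -> closure S l.
Proof.
move=> Su ul; apply/closureP => e /ul[N NE].
by exists (u N) => //; exact: NE.
Qed.

Lemma closure_star_subalgebra (E : cstarType R) (S : set E) :
  star_subalgebra S -> star_subalgebra (closure S).
Proof.
move=> Ss; have [S1 Sl SM St] := Ss.
have seqS a : closure S a -> exists2 u : nat -> E, (forall n, S (u n)) & seq_lim u a.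
  move=> /closureP Sa.
  have /choice[u uP] : forall n : nat, exists u, S u /\ rnorm (a - u) < n.+1%:R^-1.
    by move=> n; have [|u Su au] := Sa n.+1%:R^-1; [rewrite invr_gt0|exists u].
  exists u => [n|e /inv_small[N NE]]; first by case: (uP n).
  by exists N => n /NE; apply: lt_trans; case: (uP n).
split.
- exact: subset_closure.
- exact: (proj2 (closure_linear (star_subalgebra_linear Ss))).
- move=> a b /seqS[u Su ua] /seqS[v Sv vb].
  by apply: (seq_lim_closure _ (seq_limM ua vb)) => n; exact: SM.
- move=> a /seqS[u Su ua].
  by apply: (seq_lim_closure _ (seq_lim_star ua)) => n; exact: St.
Qed.

Lemma within_continuousP (V W : normedModType R[i]) (S : set V) (f : V -> W) :
  {within S, continuous f} -> forall x, S x -> forall e : R, 0 < e ->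
  exists2 d : R, 0 < d & forall y, S y -> rnorm (x - y) < d -> rnorm (f x - f y) < e.
Proof.
move=> /subspace_continuousP fc x Sx e e0.
have /real_cvgP/(_ e e0) h := fc x Sx.
have /nbhs_rball[d d0 dE] : nbhs x [set y | S y -> rnorm (f x - f y) < e] by exact: h.
by exists d => // y Sy xy; exact: dE.
Qed.

(** Continuity is relative to [S] because a representation of a triple is only meaningful on its
    algebra. *)
Lemma within_eq (V W : normedModType R[i]) (S P : set V) (f g : V -> W) :
  {within S, continuous f} -> {within S, continuous g} -> P `<=` S -> S `<=` closure P ->
  (forall x, P x -> f x = g x) -> forall x, S x -> f x = g x.
Proof.
move=> fc gc PS SP fg x Sx; apply/subr0_eq/rnorm_small => e e0.
have e2 : 0 < e / 2 by rewrite divr_gt0.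
have [d d0 fE] := within_continuousP fc Sx e2.
have [d' d'0 gE] := within_continuousP gc Sx e2.
have m0 : 0 < Num.min d d' by rewrite lt_min d0.
have /closureP/(_ _ m0)[y Py] := SP x Sx; rewrite lt_min => /andP[xy xy'].
apply: le_lt_trans (rdistD (f y) _ _) _; rewrite [ltRHS]splitr; apply: ltrD.
  by apply: fE => //; exact: PS.
by rewrite (fg y Py) rdistC; apply: gE => //; exact: PS.
Qed.

Lemma within_closure (V W : normedModType R[i]) (S P : set V) (Q : set W) (f : V -> W) :
  {within S, continuous f} -> P `<=` S -> S `<=` closure P ->
  (forall x, P x -> Q (f x)) -> forall x, S x -> closure Q (f x).
Proof.
move=> fc PS SP fQ x Sx; apply/closureP => e e0.
have [d d0 fE] := within_continuousP fc Sx e0.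
have /closureP/(_ _ d0)[y Py xy] := SP x Sx; exists (f y); first exact: fQ.
by apply: fE => //; exact: PS.
Qed.

Lemma bounded_within (V W : normedModType R[i]) (S : set V) (f : V -> W) (M : R) :
  linear f -> (forall x, rnorm (f x) <= M * rnorm x) -> {within S, continuous f}.
Proof.
move=> fl fM; apply/continuous_subspaceT => x; apply/real_cvgP => e e0.
have M1 : 0 < `|M| + 1 by rewrite ltr_wpDl.
apply: filterS (rball_nbhs x (divr_gt0 e0 M1)) => y /=.
rewrite ltr_pdivlMr// -(linear_funB fl) => xy; apply: le_lt_trans (fM _) _.
apply: le_lt_trans xy; rewrite mulrDr mulr1 [M * _]mulrC ler_wpDr//.
by rewrite ler_wpM2l// ler_norm.
Qed.

End SeqLim.

(** * Crossed product algebras *)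

Section FullImage.
Variables (R : realType) (A : cstarType R) (G : groupType).
Variables (rho : G -> A -> A) (sigma : G -> G -> A).
Hypothesis sys : twisted_system rho sigma.
Implicit Types f g : nat -> G -> A.

Local Notation conv := (conv rho sigma).
Local Notation convstar := (convstar rho sigma).
Local Notation full_cauchy := (full_cauchy rho sigma).
Local Notation Cc_representation := (Cc_representation rho sigma).

Lemma full_cauchyP f : full_cauchy f <-> (forall n, Cc setT (f n)) /\
  forall e : R, 0 < e -> exists N, forall m n, (N <= m)%N -> (N <= n)%N ->
    forall (K : hilbertType R) (Theta : (G -> A) -> bop K), Cc_representation Theta ->
    rnorm (Theta (f m) - Theta (f n)) <= e.
Proof.
split=> -[fC fc]; split=> // e e0; have [N NE] := fc e e0; exists N => m n Nm Nn K Th ThR.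
  by rewrite rnorm_le -(Cc_repB ThR)//; exact: NE.
by rewrite -rnorm_le (Cc_repB ThR)//; exact: NE.
Qed.

(** Beyond N all terms are within 1 of f N in every representation, and f N obeys the l^1 bound.
    This uniformity lets products of Cauchy sequences be Cauchy. *)
Lemma full_cauchy_bound f : full_cauchy f -> exists2 M : R, 0 <= M & exists N,
  forall n, (N <= n)%N -> forall (K : hilbertType R) (Theta : (G -> A) -> bop K),
    Cc_representation Theta -> rnorm (Theta (f n)) <= M.
Proof.
move=> /full_cauchyP[fC fc]; have [N NE] := fc 1 ltr01.
have [s us fs] := Cc_support (fC N).
exists (1 + \sum_(x <- s) rnorm (f N x)).
  by rewrite addr_ge0 ?ler01// sumr_ge0// => x _; exact: rnorm_ge0.
exists N => n Nn K Th ThR; rewrite -[Th (f n)](subrK (Th (f N))).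
apply: le_trans (rnormD _ _) _; apply: lerD; first exact: NE.
by rewrite rnorm_bop; exact: (Cc_rep_bound sys ThR us fs).
Qed.

Lemma full_cauchy_cst (f : G -> A) : Cc setT f -> full_cauchy (fun=> f).
Proof.
move=> fC; apply/full_cauchyP; split=> // e e0; exists 0%N => m n _ _ K Th _.
by rewrite subrr rnorm0 ltW.
Qed.

Lemma full_cauchy_linear (k : R[i]) f g : full_cauchy f -> full_cauchy g ->
  full_cauchy (fun n x => k *: f n x + g n x).
Proof.
move=> /full_cauchyP[fC fc] /full_cauchyP[gC gc]; apply/full_cauchyP.
split=> [n|e e0]; first exact: (CcT_linear k (fC n) (gC n)).
have k1 : 0 < cabs k + 1 by rewrite ltr_wpDl.
have [N NE] := fc (e / 2 / (cabs k + 1)) ltac:(by rewrite !divr_gt0).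
have [P PE] := gc (e / 2) ltac:(by rewrite divr_gt0).
exists (maxn N P) => m n; rewrite !geq_max => /andP[Nm Pm] /andP[Nn Pn] K Th ThR.
have [_ Tl _ _] := ThR; rewrite !Tl// opprD addrACA -scalerBr.
apply: le_trans (rnormD _ _) _; rewrite [leRHS]splitr; apply: lerD; last exact: PE.
rewrite rnormZ; have := NE m n Nm Nn K Th ThR; rewrite ler_pdivlMr//; apply: le_trans.
by rewrite mulrC ler_wpM2l// lerDl ler01.
Qed.

Lemma full_cauchy_conv f g : full_cauchy f -> full_cauchy g ->
  full_cauchy (fun n => conv (f n) (g n)).
Proof.
move=> fF gF; have [Mf Mf0 [N1 N1E]] := full_cauchy_bound fF.
have [Mg Mg0 [N2 N2E]] := full_cauchy_bound gF.
move/full_cauchyP: fF => [fC fc]; move/full_cauchyP: gF => [gC gc]; apply/full_cauchyP.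
split=> [n|e e0]; first exact: (Cc_convT sys (fC n) (gC n)).
have M1 : 0 < Mf + Mg + 1 by rewrite ltr_wpDl// addr_ge0.
have [N3 N3E] := fc _ (divr_gt0 e0 M1); have [N4 N4E] := gc _ (divr_gt0 e0 M1).
exists (maxn (maxn N1 N2) (maxn N3 N4)) => m n.
rewrite !geq_max => /andP[/andP[m1 m2] /andP[m3 m4]] /andP[/andP[n1 n2] /andP[n3 n4]].
move=> K Th ThR; have [_ _ TM _] := ThR; rewrite !TM//.
have -> : Th (f m) ** Th (g m) - Th (f n) ** Th (g n) =
    (Th (f m) - Th (f n)) ** Th (g m) + Th (f n) ** (Th (g m) - Th (g n)).
  by rewrite cmulBl cmulBr addrA subrK.
apply: le_trans (rnormD _ _) _; apply: le_trans (lerD (rnormM _ _) (rnormM _ _)) _.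
have := N3E m n m3 n3 K Th ThR; have := N4E m n m4 n4 K Th ThR.
have := N2E m m2 K Th ThR; have := N1E n n1 K Th ThR.
set a := rnorm (Th (f n)); set b := rnorm (Th (g m)); set c := rnorm (_ - _); set d := rnorm (_ - _).
move=> aM bM; rewrite !ler_pdivlMr// => hc hd.
have a0 : 0 <= a by exact: rnorm_ge0. have b0 : 0 <= b by exact: rnorm_ge0.
have c0 : 0 <= c by exact: rnorm_ge0. have d0 : 0 <= d by exact: rnorm_ge0.
have h1 : d * b <= d * Mg by rewrite ler_wpM2l.
have h2 : a * c <= c * Mf by rewrite mulrC ler_wpM2l.
apply: le_trans (lerD h1 h2) _.
have [cd|dc] := leP c d; nra.
Qed.

Lemma full_cauchy_star f : full_cauchy f -> full_cauchy (fun n => convstar (f n)).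
Proof.
move=> /full_cauchyP[fC fc]; apply/full_cauchyP.
split=> [n|e /fc[N NE]]; first exact: (Cc_convstarT sys (fC n)).
exists N => m n Nm Nn K Th ThR; have [_ _ _ Ts] := ThR; rewrite !Ts// -starB rnorm_star.
exact: NE.
Qed.

Variables (K : hilbertType R) (Theta : (G -> A) -> bop K).
Hypothesis TR : Cc_representation Theta.

Lemma full_imageP T : full_image rho sigma Theta T <->
  exists2 f, full_cauchy f & seq_lim (Theta \o f) T.
Proof. by split=> -[f fF] /seq_limP fT; exists f => //; exact/seq_limP. Qed.

(** The operations are carried out on the Cauchy sequences, which are stable under them, and then
    pass to limits; that the image is closed never enters. *)
Lemma full_image_star_subalgebra : star_subalgebra (full_image rho sigma Theta).
Proof.
have [T1 Tl TM Ts] := TR; split.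
- apply/full_imageP; exists (fun=> @single R A G cone 1%g).
    by apply: full_cauchy_cst; exact: CcT_single.
  by rewrite -T1; exact: seq_lim_cst.
- move=> k a b /full_imageP[f fF fa] /full_imageP[g gF gb]; apply/full_imageP.
  exists (fun n x => k *: f n x + g n x); first exact: full_cauchy_linear.
  have := seq_lim_linear k fa gb; congr (seq_lim _ _); apply/funext => n /=.
  by rewrite Tl//; [case: fF => + _|case: gF => + _]; apply.
- move=> a b /full_imageP[f fF fa] /full_imageP[g gF gb]; apply/full_imageP.
  exists (fun n => conv (f n) (g n)); first exact: full_cauchy_conv.
  have := seq_limM fa gb; congr (seq_lim _ _); apply/funext => n /=.
  by rewrite TM//; [case: fF => + _|case: gF => + _]; apply.
- move=> a /full_imageP[f fF fa]; apply/full_imageP.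
  exists (fun n => convstar (f n)); first exact: full_cauchy_star.
  have := seq_lim_star fa; congr (seq_lim _ _); apply/funext => n /=.
  by rewrite Ts//; case: fF => + _; apply.
Qed.

Lemma Cc_image_sub S : Theta @` Cc S `<=` full_image rho sigma Theta.
Proof.
move=> _ [f fS <-]; apply/full_imageP; exists (fun=> f); last exact: seq_lim_cst.
by apply: full_cauchy_cst; exact: Cc_mono fS.
Qed.

Section Dense.
Variable S : set A.
Hypotheses (Ss : star_subalgebra S) (S_rho : forall x a, S a -> S (rho x a))
  (S_sigma : forall x y, S (sigma x y)) (Sd : forall a, closure S a).

Lemma Cc_image_star_subalgebra : star_subalgebra (Theta @` Cc S).
Proof.
have [T1 Tl TM Ts] := TR; have Sl := star_subalgebra_linear Ss; split.
- exists (@single R A G cone 1%g) => //; apply: Cc_single; first exact: (proj1 Sl).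
  by case: Ss.
- move=> k _ _ [f fS <-] [g gS <-]; exists (fun x => k *: f x + g x).
    exact: Cc_linear Sl fS gS.
  by rewrite Tl//; [exact: Cc_mono fS|exact: Cc_mono gS].
- move=> _ _ [f fS <-] [g gS <-]; exists (conv f g); first exact: (Cc_conv sys).
  by rewrite TM//; [exact: Cc_mono fS|exact: Cc_mono gS].
- move=> _ [f fS <-]; exists (convstar f); first exact: (Cc_convstar sys).
  by rewrite Ts//; exact: Cc_mono fS.
Qed.

Lemma Cc_approx (f : G -> A) (e : R) : Cc setT f -> 0 < e ->
  exists2 g, Cc S g & rnorm (Theta f - Theta g) < e.
Proof.
move=> fC e0; have [s us fs] := Cc_support fC; have Sl := star_subalgebra_linear Ss.
(* An error below d at each point of the support adds up, by the l^1 bound, to less than e; the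
   successor allows an empty support. *)
pose d := e / (size s).+1%:R; have d0 : 0 < d by rewrite divr_gt0.
have /choice[h hP] : forall x, exists b, S b /\ rnorm (f x - b) < d.
  by move=> x; have /closureP/(_ d d0)[b Sb fb] := @Sd (f x); exists b.
pose g x := if x \in s then h x else 0.
have gS : Cc S g.
  apply: (@Cc_of_support _ _ _ _ _ s) => x; rewrite /g; case: ifP => // _.
    by case: (hP x).
  exact: (proj1 Sl).
exists g => //; rewrite -(Cc_repB TR)//; last exact: Cc_mono gS.
rewrite rnorm_bop; apply: le_lt_trans (Cc_rep_bound sys TR us _) _.
  move=> x; apply: contra_notT => xs; rewrite /g (negbTE xs) subr0.
  by apply: contrapT => /fs; exact/negP.
apply: (@le_lt_trans _ _ (\sum_(x <- s) d)).
  rewrite big_seq [leRHS]big_seq; apply: ler_sum => x xs; rewrite /g xs.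
  by rewrite ltW//; case: (hP x).
rewrite big_const_seq count_predT iter_addr_0 -[d *+ _]mulr_natl /d mulrCA.
by rewrite gtr_pMr// ltr_pdivrMr// mul1r ltr_nat.
Qed.

Lemma full_image_closure : full_image rho sigma Theta `<=` closure (Theta @` Cc S).
Proof.
move=> T /full_imageP[f [fC _] fT]; apply/closureP => e e0.
have [N NE] := fT (e / 2) ltac:(by rewrite divr_gt0).
have [g gS fg] := @Cc_approx (f N) (e / 2) (fC N) ltac:(by rewrite divr_gt0).
exists (Theta g); first by exists g.
apply: le_lt_trans (rdistD (Theta (f N)) _ _) _; rewrite [ltRHS]splitr ltrD//.
exact: NE.
Qed.

Lemma Cc_image_dense : dense_star_subalgebra (Theta @` Cc S) (full_image rho sigma Theta).
Proof.
split; [exact: Cc_image_star_subalgebra|exact: Cc_image_sub|exact: full_image_closure].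
Qed.

End Dense.
End FullImage.

(** * Translations and block-diagonal operators on l^2(G) *)

Section Translations.
Variables (R : realType) (G : groupType) (l2 : l2_space R G).
Local Notation delta := (l2_delta l2).
Implicit Types g h x y : G.

Lemma delta_dense : dense (span (range delta)).
Proof.
apply/denseP => z e e0; have /denseP/(_ z e e0)[_ [n [c [x ->]]] zu] := @l2_dense _ _ l2.
by exists (\sum_i c i *: delta (x i)) => //; exists n, c, (fun i => delta (x i)).
Qed.

Lemma left_translationE g x : left_translation l2 g (delta x) = delta (g * x)%g.
Proof.
pose S := [set p : l2 * l2 | exists x, p = (delta x, delta (g * x)%g)].
have [||f [fl fM fS]] := @scaled_extension _ l2 l2 S 1 ler01.
- move=> _ _ [u ->] [v ->] /=; rewrite !l2_orthonormal (inj_eq (mulgI g)).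
  by rewrite expr1n mul1r.
- apply: dense_span_mono delta_dense => _ [y _ <-]; apply: sub_span.
  by exists (delta y, delta (g * y)%g) => //; exists y.
have [T TE] := bounded_bop fl ler01 fM.
have TP y : T (delta y) = delta (g * y)%g by rewrite TE; apply: fS; exists y.
by have := @xgetPex _ 0 [set W : bop l2 | forall x, W (delta x) = delta (g * x)%g]
  (ex_intro _ T TP) x.
Qed.

Lemma left_translationM g h :
  left_translation l2 g ** left_translation l2 h = left_translation l2 (g * h)%g.
Proof.
apply: (eq_bop delta_dense) => _ [x _ <-].
by rewrite [LHS]/= !left_translationE mulgA.
Qed.

Lemma left_translation1 : left_translation l2 1%g = cone.
Proof.
by apply: (eq_bop delta_dense) => _ [x _ <-]; rewrite left_translationE mul1g.
Qed.

Lemma left_translation_star g : star (left_translation l2 g) = left_translation l2 g^-1%g.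
Proof.
apply: (eq_bop delta_dense) => _ [x _ <-]; rewrite left_translationE.
apply: (inner_inj_total delta_dense) => _ [y _ <-].
rewrite -[star _]/(badj _) -badjE left_translationE !l2_orthonormal.
by rewrite -(inj_eq (mulgI g^-1%g)) mulKg.
Qed.

Lemma left_translation_unitary g : unitary (left_translation l2 g).
Proof.
by split; rewrite left_translation_star left_translationM ?mulVg ?mulgV left_translation1.
Qed.

End Translations.

Section BlockDiagonal.
Variables (R : realType) (G : groupType) (H : hilbertType R) (l2 : l2_space R G).
Variable L : tensor_space H l2.
Local Notation delta := (l2_delta l2).

Lemma ts_delta_dense : dense (span [set z : L | exists xi y, z = ts_map L xi (delta y)]).
Proof.
apply: dense_span_mono (@ts_total _ _ _ L _ _ (@dense_spanT _ _) (@delta_dense _ _ l2)).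
move=> _ [x [_ [_ [y _ <-] ->]]].
by apply: sub_span; exists x, y.
Qed.

(** The subspaces H (x) delta_y are mutually orthogonal, so a common bound on the blocks bounds the
    whole operator. It yields Fell's unitary and the commutators of M_ell. *)
Lemma block_bop (B : G -> bop H) (M : R) : 0 <= M -> (forall y, bnorm (B y) <= M) ->
  exists W : bop L, forall xi y, W (ts_map L xi (delta y)) = ts_map L (B y xi) (delta y).
Proof.
move=> M0 BM.
pose S := [set p : L * L | exists xi y,
  p = (ts_map L xi (delta y), ts_map L (B y xi) (delta y))].
have [||W _ WS] := @bop_extension _ L (span S) M (span_linear S) M0.
- apply: dense_span_fst; apply: dense_span_mono ts_delta_dense => _ [xi [y ->]].
  apply: sub_span; exists (ts_map L xi (delta y), ts_map L (B y xi) (delta y)) => //.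
  by exists xi, y.
- move=> _ [n [c [p [Sp ->]]]]; have /choice[xi /choice[y pE]] := Sp.
  pose s := undup [seq y i | i : 'I_n]; have us : uniq s by exact: undup_uniq.
  have ys i : y i \in s by rewrite mem_undup; exact: map_f (mem_enum _ _).
  (* Several terms may sit over the same group element; they are collected first, since
     orthogonality holds only between different ones. *)
  pose z w := \sum_(i < n | y i == w) c i *: xi i.
  have E (T : G -> bop H) : \sum_i ts_map L (T (y i) (c i *: xi i)) (delta (y i)) =
      \sum_(w <- s) ts_map L (T w (z w)) (delta w).
    have -> : \sum_(w <- s) ts_map L (T w (z w)) (delta w) =
        \sum_(w <- s) \sum_(i < n | y i == w) ts_map L (T w (c i *: xi i)) (delta w).
      by apply: eq_bigr => w _; rewrite (linear_fun_sum _ _ _ (bop_linear (T w))) ts_suml.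
    rewrite (exchange_big_dep xpredT)//=; apply: eq_bigr => i _.
    rewrite (big_rem (y i))//= eqxx big_seq_cond big1 ?addr0// => w.
    by rewrite mem_rem_uniq// inE => /andP[/andP[wy _] /eqP yw]; rewrite yw eqxx in wy.
  have E1 : (\sum_i c i *: p i).1 = \sum_(w <- s) ts_map L (z w) (delta w).
    rewrite fst_sum -(E (fun=> @bid R H)).
    by apply: eq_bigr => i _; rewrite pE tsZl.
  have E2 : (\sum_i c i *: p i).2 = \sum_(w <- s) ts_map L (B w (z w)) (delta w).
    rewrite snd_sum -(E B).
    by apply: eq_bigr => i _; rewrite pE bopZ tsZl.
  have o (T : G -> H) : rnorm (\sum_(w <- s) ts_map L (T w) (delta w)) ^+ 2 =
      \sum_(w <- s) rnorm (T w) ^+ 2.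
    rewrite ortho_sum// => [|w v _ _ wv].
      apply: eq_bigr => w _; rewrite rnorm_ts exprMn -[rnorm (delta w) ^+ 2]Re_inner_xx.
      by rewrite l2_orthonormal eqxx mulr1.
    by rewrite ts_inner l2_orthonormal (negbTE wv) mulr0.
  rewrite E1 E2; apply: rnorm_le_sqr => //; rewrite !o mulr_sumr; apply: ler_sum => w _.
  rewrite -exprMn ler_pXn2r ?nnegrE ?mulr_ge0//.
  by apply: le_trans (le_bnorm _ _) _; rewrite ler_wpM2r//.
by exists W => xi y; apply: WS; apply: sub_span; exists xi, y.
Qed.

End BlockDiagonal.

Lemma group_algebraE R (G : groupType) (l2 : l2_space R G) :
  @group_algebra R G l2 = span (range (left_translation l2)).
Proof.
apply/seteqP; split=> [_ [n [c [g ->]]]|_ [n [c [f [fE ->]]]]].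
  by exists n, c, (fun i => left_translation l2 (g i)).
have /choice[g gE] : forall i, exists g, left_translation l2 g = f i.
  by move=> i; have [g _ gE] := fE i; exists g.
by exists n, c, g; apply: eq_bigr => i _; rewrite gE.
Qed.

Lemma span_star_subalgebra R (E : cstarType R) (S : set E) :
  S cone -> (forall a b, S a -> S b -> span S (a ** b)) ->
  (forall a, S a -> span S (star a)) -> star_subalgebra (span S).
Proof.
move=> S1 SM Ss; have Sl := span_linear S; split; first exact: sub_span.
- exact: (proj2 Sl).
- move=> a b; move: a; apply: (@span_min _ _ _ [set a | span S b -> span S (a ** b)]).
    split=> [_|k x y xb yb Sb] /=; first by rewrite cmul0r; exact: (proj1 Sl).
    by rewrite cmulDl cmulZl; apply: (proj2 Sl); [exact: xb|exact: yb].
  move=> a Sa; move: b; apply: (@span_min _ _ _ [set b | span S (a ** b)]).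
    split=> [|k x y xb yb] /=; first by rewrite cmulr0; exact: (proj1 Sl).
    by rewrite cmulDr cmulZr; exact: (proj2 Sl).
  by move=> b Sb; exact: SM.
- apply: (@span_min _ _ _ [set a | span S (star a)]) => [|a Sa]; last exact: Ss.
  split=> [|k x y xb yb] /=; first by rewrite star0; exact: (proj1 Sl).
  by rewrite starD starZ; exact: (proj2 Sl).
Qed.

Lemma group_algebra_star_subalgebra R (G : groupType) (l2 : l2_space R G) :
  star_subalgebra (@group_algebra R G l2).
Proof.
rewrite group_algebraE; apply: span_star_subalgebra.
- by exists 1%g => //; rewrite left_translation1.
- by move=> _ _ [g _ <-] [h _ <-]; rewrite left_translationM; apply: sub_span; eexists.
- by move=> _ [g _ <-]; rewrite left_translation_star; apply: sub_span; eexists.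
Qed.

(** * The regular representation and Fell absorption *)

Section RegularRepresentation.
Variables (R : realType) (A : cstarType R) (G : groupType).
Variables (rho : G -> A -> A) (sigma : G -> G -> A).
Hypothesis sys : twisted_system rho sigma.
Variables (H : hilbertType R) (l2 : l2_space R G) (L : tensor_space H l2).
Variables (pi : A -> bop H) (U : G -> bop H).
Hypothesis cov : twisted_covariant rho sigma pi U.
Local Notation delta := (l2_delta l2).
Local Notation lambda := (left_translation l2).
Local Notation single := (@single R A G).
Local Notation Lambda := (regular rho sigma L pi).

Let UU x : unitary (U x). Proof. by case: cov. Qed.

Lemma eq_bop_delta (S T : bop L) :
  (forall xi y, S (ts_map L xi (delta y)) = T (ts_map L xi (delta y))) -> S = T.
Proof.
by move=> ST; apply: (eq_bop (@ts_delta_dense _ _ _ _ L)) => _ [xi [y ->]].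
Qed.

(** Fell's unitary, written W in the overview; in the code [W] names the triple tensor product. It
    is block diagonal with unitary blocks, and its adjoint is built from the adjoint blocks. *)
Lemma untwisting_ex : exists V : bop L, [/\ star V ** V = cone, V ** star V = cone,
  (forall xi y, V (ts_map L xi (delta y)) = ts_map L (star (U y^-1%g) xi) (delta y)) &
  (forall xi y, star V (ts_map L xi (delta y)) = ts_map L (U y^-1%g xi) (delta y))].
Proof.
have b1 y : bnorm (star (U y^-1%g)) <= 1.
  by apply: unitary_bnorm; rewrite starK; case: (UU y^-1%g).
have b2 y : bnorm (U y^-1%g) <= 1 by apply: unitary_bnorm; case: (UU y^-1%g).
have [V VE] := block_bop L ler01 b1; have [V' V'E] := block_bop L ler01 b2.
have sV : star V = V'.
  apply: eq_bop_delta => xi y; apply: (inner_inj_total (@ts_delta_dense _ _ _ _ L)).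
  move=> _ [eta [z ->]]; rewrite -[star V]/(badj V) -badjE VE V'E !ts_inner l2_orthonormal.
  have [->|_] := eqVneq z y; last by rewrite !mulr0.
  by rewrite -[star _]/(badj _) -badjEr.
exists V; split; rewrite ?sV//; apply: eq_bop_delta => xi y.
  rewrite /cmul/= VE V'E.
  by congr (ts_map L _ _); rewrite -[LHS]/((U y^-1%g ** star (U y^-1%g)) xi) (proj2 (UU _)).
rewrite /cmul/= V'E VE.
by congr (ts_map L _ _); rewrite -[LHS]/((star (U y^-1%g) ** U y^-1%g) xi) (proj1 (UU _)).
Qed.

Section Untwisted.
Variable V : bop L.
Hypotheses (VV : star V ** V = cone) (VV' : V ** star V = cone)
  (VE : forall xi y, V (ts_map L xi (delta y)) = ts_map L (star (U y^-1%g) xi) (delta y))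
  (V'E : forall xi y, star V (ts_map L xi (delta y)) = ts_map L (U y^-1%g xi) (delta y)).

(* Fell's absorption principle. *)
Lemma regular_opE a x :
  regular_op rho sigma L pi a x = star V ** optens L (pi a ** U x) (lambda x) ** V.
Proof.
have WE xi y : (star V ** optens L (pi a ** U x) (lambda x) ** V) (ts_map L xi (delta y)) =
    ts_map L (pi (rho (y^-1 * x^-1)%g a ** sigma (y^-1 * x^-1)%g x) xi) (delta (x * y)%g).
  have [[p1 pl pM ps] _ UM Uc] := cov.
  transitivity (star V (optens L (pi a ** U x) (lambda x) (V (ts_map L xi (delta y))))).
    by [].
  rewrite VE optensE left_translationE V'E; congr (ts_map L _ _).
  rewrite invgM pM// Uc.
  (* The cocycle is solved from the product rule of U. Its first factor then cancels the adjoint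
     that covariance places behind pi(a), leaving U_((x y)^-1) pi(a) U_x followed by the block of
     the unitary at y. *)
  have -> : pi (sigma (y^-1 * x^-1)%g x) = U (y^-1 * x^-1)%g ** U x ** star (U y^-1%g).
    by rewrite UM mulgVK -cmulA (proj2 (UU _)) cmulr1.
  rewrite -!cmulA [star (U _) ** (U (y^-1 * x^-1)%g ** _)]cmulA (proj1 (UU _)) cmul1r.
  by [].
have h := @xgetPex _ 0 [set W : bop L | forall xi y, W (ts_map L xi (delta y)) =
    ts_map L (pi (rho (y^-1 * x^-1)%g a ** sigma (y^-1 * x^-1)%g x) xi)
             (delta (x * y)%g)] (ex_intro _ _ WE).
by apply: eq_bop_delta => xi y; rewrite WE; exact: h.
Qed.

Definition untwist (T : bop L) : bop L := V ** T ** star V.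

Lemma conjugation_star_hom (E : cstarType R) (u : E) : star u ** u = cone ->
  u ** star u = cone -> star_hom setT (fun a => u ** a ** star u).
Proof.
move=> h1 h2; split=> [|k a b _ _|a b _ _|a _].
- by rewrite cmulr1.
- by rewrite cmulDr cmulZr cmulDl cmulZl.
- by rewrite -!cmulA [star u ** (u ** _)]cmulA h1 cmul1r.
- by rewrite !starM starK cmulA.
Qed.

Lemma untwist_star_hom : star_hom setT untwist.
Proof. exact: conjugation_star_hom. Qed.

Lemma untwist_inj : injective untwist.
Proof.
move=> S T h; have := congr1 (fun X => star V ** X ** V) h; rewrite /untwist /=.
by rewrite -!cmulA VV !cmulr1 !cmulA VV !cmul1r.
Qed.

Let pi3 a := star V ** optens L (pi a) cone ** V.
Let U3 x := star V ** optens L (U x) (lambda x) ** V.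

Let conjM (S T : bop L) : (star V ** S ** V) ** (star V ** T ** V) = star V ** (S ** T) ** V.
Proof. by rewrite -!cmulA [V ** (star V ** _)]cmulA VV' cmul1r. Qed.

Let conj_star (S : bop L) : star (star V ** S ** V) = star V ** star S ** V.
Proof. by rewrite !starM starK cmulA. Qed.

Let cov3 : twisted_covariant rho sigma pi3 U3.
Proof.
have [[p1 pl pM ps] _ UM Uc] := cov; split.
- split=> [|k a b _ _|a b _ _|a _].
  + by rewrite /pi3 p1 optens1 cmulr1 VV.
  + rewrite /pi3 pl// (optens_linearl L cone k (pi a) (pi b)).
    by rewrite cmulDr cmulZr cmulDl cmulZl.
  + by rewrite /pi3 pM// conjM optensM cmulr1.
  + by rewrite /pi3 ps// conj_star optens_star star1.
- by move=> x; split; rewrite /U3 conj_star conjM optens_star optensM;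
    rewrite ?(proj1 (UU x)) ?(proj2 (UU x)) ?(proj1 (left_translation_unitary l2 x))
            ?(proj2 (left_translation_unitary l2 x)) optens1 cmulr1 VV.
- by move=> x y; rewrite /U3 /pi3 !conjM !optensM UM left_translationM cmul1r.
- move=> x a; rewrite /U3 /pi3 conj_star !conjM !optensM optens_star optensM Uc cmulr1.
  by rewrite (proj2 (left_translation_unitary l2 x)).
Qed.

(** Conjugating back the pair (pi (x) 1, U (x) lambda) gives a covariant pair, so the general result
    on integrated forms applies to the regular representation. *)
Lemma regularE : Lambda = integrated pi3 U3.
Proof.
apply/funext => f; apply: eq_fsbigr => x _.
by rewrite regular_opE /pi3 /U3 conjM optensM cmul1r.
Qed.

Lemma regular_Cc_representation : Cc_representation rho sigma Lambda.
Proof. rewrite regularE; exact: integrated_Cc_representation. Qed.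

Lemma untwist_single a g : untwist (Lambda (single a g)) = optens L (pi a ** U g) (lambda g).
Proof.
rewrite regularE (integrated_single cov3) /pi3 /U3 conjM optensM cmul1r /untwist.
by rewrite -!cmulA VV' cmulr1 !cmulA VV' cmul1r.
Qed.

End Untwisted.
End RegularRepresentation.

(** * Amplification *)

Section Associator.
Variables (R : realType) (H K V : hilbertType R).
Variables (t : tensor_space H K) (LV : tensor_space K V) (W : tensor_space H LV).

(** For fixed v, sending xi (x) eta to xi (x) (eta (x) v) multiplies inner products by |v|^2. *)
Lemma assoc_factor_ex (v : V) : exists f : t -> W, [/\ linear f,
  forall u, rnorm (f u) <= rnorm v * rnorm u &
  forall xi eta, f (ts_map t xi eta) = ts_map W xi (ts_map LV eta v)].
Proof.
pose S := [set p : t * W | exists xi eta,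
  p = (ts_map t xi eta, ts_map W xi (ts_map LV eta v))].
have [||f [fl fM fS]] := @scaled_extension _ t W S (rnorm v) (rnorm_ge0 v).
- move=> _ _ [x [y ->]] [x' [y' ->]] /=; rewrite !ts_inner inner_xx; ring.
- apply: dense_span_mono (@elementary_dense _ _ _ t) => _ [x [y ->]]; apply: sub_span.
  by exists (ts_map t x y, ts_map W x (ts_map LV y v)) => //; exists x, y.
by exists f; split=> // xi eta; apply: fS; exists xi, eta.
Qed.

Definition assoc_map (u : t) (v : V) : W := sval (cid (assoc_factor_ex v)) u.

Let assoc_linearl v : linear (assoc_map^~ v).
Proof. by rewrite /assoc_map; case: cid => f []. Qed.

Let assoc_bound v u : rnorm (assoc_map u v) <= rnorm v * rnorm u.
Proof. by rewrite /assoc_map; case: cid => f []. Qed.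

Lemma assoc_mapE xi eta v : assoc_map (ts_map t xi eta) v = ts_map W xi (ts_map LV eta v).
Proof. by rewrite /assoc_map; case: cid => f []. Qed.

(** The maps for different v are chosen independently. Linearity in v is recovered by comparing two
    bounded maps of u on elementary tensors. *)
Let assoc_linearr u : linear (assoc_map u).
Proof.
move=> a v w; move: u.
pose g u := a *: assoc_map u v + assoc_map u w.
have gl : linear g.
  move=> k x y; rewrite /g !assoc_linearl !scalerDr addrACA; congr (_ + _ + _).
  by rewrite !scalerA mulrC.
have gM u : rnorm (g u) <= (cabs a * rnorm v + rnorm w) * rnorm u.
  apply: le_trans (rnormD _ _) _; rewrite mulrDl rnormZ; apply: lerD => //.
  by rewrite -mulrA ler_wpM2l.
apply: (eq_bounded (assoc_linearl (a *: v + w)) gl (assoc_bound _) gM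
  (@elementary_dense _ _ _ t)) => _ [x [y ->]].
by rewrite /g !assoc_mapE tsDr tsDr tsZr tsZr.
Qed.

Let assoc_inner u v u' v' :
  inner (assoc_map u v) (assoc_map u' v') = inner u u' * inner v v'.
Proof.
rewrite mulrC; apply: (inner_total (assoc_linearl v) (assoc_linearl v')
  (rnorm_ge0 v) (rnorm_ge0 v') (assoc_bound v) (assoc_bound v') (@elementary_dense _ _ _ t)).
by move=> _ _ [x [y ->]] [x' [y' ->]]; rewrite !assoc_mapE !ts_inner; ring.
Qed.

Lemma triple_dense :
  dense (span [set z : W | exists xi eta v, z = ts_map W xi (ts_map LV eta v)]).
Proof.
apply: dense_span_mono
  (@ts_total _ _ _ W _ _ (@dense_spanT _ _) (@elementary_dense _ _ _ LV)).
move=> _ [x [_ [_ [y [v ->]] ->]]].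
by apply: sub_span; exists x, y, v.
Qed.

Let assoc_dense : dense [set z : W | exists n (x : 'I_n -> t) (y : 'I_n -> V),
  z = \sum_i assoc_map (x i) (y i)].
Proof.
apply/denseP => z e e0; have /denseP/(_ z e e0)[u [n [c [f [fE ->]]]] zu] := triple_dense.
exists (\sum_i c i *: f i) => //.
have /choice[xi /choice[eta /choice[v vE]]] := fE.
exists n, (fun i => ts_map t (c i *: xi i) (eta i)), v.
by apply: eq_bigr => i _; rewrite assoc_mapE vE tsZl.
Qed.

(* H (x) (K (x) V), seen as (H (x) K) (x) V. *)
Definition assoc : tensor_space t V :=
  @TensorSpace _ t V W assoc_map assoc_linearl assoc_linearr assoc_inner assoc_dense.

(** T (x) 1_V for an operator on H (x) K that need not be elementary, carried to the bracketing H
    (x) (K (x) V) of [W]. *)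
Definition amp (T : bop t) : bop W := optens assoc T cone.

Lemma ampE T u v : amp T (assoc_map u v) = assoc_map (T u) v.
Proof. exact: (optensE assoc T cone u v). Qed.

Lemma amp_optens a b : amp (optens t a b) = optens W a (optens LV b cone).
Proof.
apply: (eq_bop triple_dense) => _ [xi [eta [v ->]]].
by rewrite -{1}assoc_mapE ampE !optensE assoc_mapE.
Qed.

Lemma bnorm_one (X : hilbertType R) : bnorm (cone : bop X) <= 1.
Proof. by apply: bnorm_le => [|x]; [exact: ler01|rewrite mul1r]. Qed.

Lemma bnorm_amp T : bnorm (amp T) <= bnorm T.
Proof.
apply: le_trans (bnorm_optens assoc T cone) _.
exact: ler_piMr (bnorm_ge0 _) (bnorm_one _).
Qed.

Lemma amp_linear : linear amp.
Proof. by move=> k a b; exact: (optens_linearl assoc cone k a b). Qed.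

Lemma amp_star_hom : star_hom setT amp.
Proof. exact: optensl_star_hom assoc. Qed.

End Associator.

Lemma conjCE R (z : R[i]) : (z^* = conjc z)%R.
Proof. by []. Qed.

(** * Diagonalisation in finite dimension *)

Section FiniteDimensional.
Local Open Scope sesquilinear_scope.
Variables (R : realType) (V : hilbertType R).
Hypothesis finV : finite_dimensional V.

Lemma finite_orthonormal_basis : exists n (f : 'I_n -> V),
  (forall i j, inner (f i) (f j) = (i == j)%:R) /\
  forall v, v = \sum_i inner v (f i) *: f i.
Proof.
have [n [e eV]] := finV.
have [t [ut to] tE] := gram_schmidt [seq e i | i : 'I_n].
exists (size t), (fun i => t`_i); split=> [i j|v].
  by rewrite to ?mem_nth// nth_uniq.
have tv w : (exists i, w = e i) -> w = \sum_(i < size t) inner w t`_i *: t`_i.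
  move=> [i ->]; rewrite [LHS]tE; last exact: map_f (mem_enum _ _).
  by rewrite (big_nth 0) big_mkord.
have [c ->] := eV v.
rewrite [LHS](eq_bigr (fun k => \sum_(i < size t) (c k * inner (e k) t`_i) *: t`_i)).
  rewrite exchange_big; apply: eq_bigr => i _; rewrite -scaler_suml inner_suml.
  by congr (_ *: _); apply: eq_bigr => k _; rewrite innerZl.
move=> k _; rewrite [X in _ *: X]tv; last by exists k.
by rewrite scaler_sumr; apply: eq_bigr => i _; rewrite scalerA.
Qed.

Lemma finite_diagonalization n (f : 'I_n -> V) (T : bop V) :
  (forall i j, inner (f i) (f j) = (i == j)%:R) ->
  (forall v, v = \sum_i inner v (f i) *: f i) -> star T = T ->
  exists (e : 'I_n -> V) (t : 'I_n -> R),
    [/\ forall i j, inner (e i) (e j) = (i == j)%:R, forall v, span (range e) v &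
        forall k, T (e k) = (t k)%:C *: e k].
Proof.
move=> fo fV TT.
have Ts x y : inner (T x) y = inner x (T y) by rewrite badjE -[badj T]/(star T) TT.
(* Row i holds the coordinates of T (f i). Hence T acts on coordinates as row vectors times M, and
   by P M = diag(d) P the rows of P are the eigenvectors. *)
pose M : 'M[R[i]]_n := \matrix_(i, j) inner (T (f i)) (f j).
have Mh : M ^t* = M.
  by apply/matrixP => i j; rewrite !mxE conjCE -inner_conj Ts.
have Mn : M \is normalmx by apply/normalmxP; rewrite Mh.
pose P := spectralmx M; pose d := spectral_diag M.
have Pu : P \is unitarymx := spectral_unitarymx M.
have PM : P *m M = diag_mx d *m P.
  have := orthomx_spectralP Mn; rewrite -/P -/d => {1}->.
  by rewrite !mulmxA mulmxV ?mul1mx// unitarymx_unit.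
have PP : P *m P ^t* = 1%:M by exact/unitarymxP.
have PP' : P ^t* *m P = 1%:M by exact: mulmx1C.
pose e k := \sum_j P k j *: f j.
have eo k m : inner (e k) (e m) = (k == m)%:R.
  have -> : (k == m)%:R = (P *m P ^t*) k m by rewrite PP mxE.
  rewrite inner_suml mxE; apply: eq_bigr => j _; rewrite inner_sumr (bigD1 j)//=.
  rewrite big1 ?addr0 => [|l lj]; rewrite innerZl innerZr fo ?mxE.
    by rewrite eqxx mulr1 conjCE.
  by rewrite eq_sym (negbTE lj) !mulr0.
have Te k : T (e k) = d 0 k *: e k.
  rewrite /e scaler_sumr (linear_fun_sum _ _ _ (bop_linear T)).
  transitivity (\sum_l (P *m M) k l *: f l).
    rewrite (eq_bigr (fun j => \sum_l (P k j * M j l) *: f l)) => [|j _].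
      by rewrite exchange_big; apply: eq_bigr => l _; rewrite -scaler_suml mxE.
    rewrite bopZ [X in _ *: X]fV scaler_sumr; apply: eq_bigr => l _.
    by rewrite scalerA mxE.
  by apply: eq_bigr => l _; rewrite PM mul_diag_mx mxE scalerA.
have dreal k : d 0 k = (complex.Re (d 0 k))%:C.
  have := Ts (e k) (e k); rewrite Te innerZl innerZr eo eqxx !mulr1.
  by case: (d 0 k) => a b [] bE; apply/eqP; rewrite eq_complex /= eqxx /=; apply/eqP; lra.
exists e, (fun k => complex.Re (d 0 k)); split=> // [v|k]; last by rewrite -dreal.
rewrite [v]fV; apply: linear_set_sum => // j _.
apply: linear_setZ => //.
have -> : f j = \sum_k P ^t* j k *: e k.
  rewrite (eq_bigr (fun k => \sum_l (P ^t* j k * P k l) *: f l)) => [|k _].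
    rewrite exchange_big (eq_bigr (fun l => (1%:M : 'M[R[i]]_n) j l *: f l)) => [|l _].
      rewrite (bigD1 j)//= big1 ?addr0 => [|l lj].
        by rewrite mxE eqxx scale1r.
      by rewrite mxE eq_sym (negbTE lj) scale0r.
    by rewrite -scaler_suml -PP' mxE.
  by rewrite /e scaler_sumr; apply: eq_bigr => l _; rewrite scalerA.
apply: linear_set_sum => // k _.
by apply: linear_setZ => //; apply: sub_span; exists k.
Qed.

End FiniteDimensional.

(** * The two factors of the exterior product *)

Section LengthTriple.
Variables (R : realType) (G : groupType) (l2 : l2_space R G) (V : hilbertType R).
Variables (ell : G -> bop V) (LV : tensor_space l2 V).
Hypotheses (finV : finite_dimensional V) (ell_sa : forall x, star (ell x) = ell x)
  (ell_tb : translation_bounded ell) (ell_proper : proper_function ell).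
Local Notation delta := (l2_delta l2).
Local Notation lambda := (left_translation l2).
Local Notation Mell := (multiplication ell LV).

Lemma multiplicationE : Mell = span [set p | exists x v,
  p = (ts_map LV (delta x) v, ts_map LV (delta x) (ell x v))].
Proof.
apply/seteqP; split=> [[p1 p2] [n [x [v [/= -> ->]]]]|].
  have -> : (\sum_i ts_map LV (delta (x i)) (v i),
      \sum_i ts_map LV (delta (x i)) (ell (x i) (v i))) =
      \sum_i (ts_map LV (delta (x i)) (v i), ts_map LV (delta (x i)) (ell (x i) (v i))).
    by apply: injective_projections; rewrite ?fst_sum ?snd_sum.
  apply: linear_set_sum => // i _.
  by apply: sub_span; exists (x i), (v i).
move=> _ [n [a [p [pg ->]]]]; have /choice[x /choice[v pE]] := pg.
exists n, x, (fun i => a i *: v i); split.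
- by rewrite fst_sum; apply: eq_bigr => i _; rewrite pE tsZr.
- by rewrite snd_sum; apply: eq_bigr => i _; rewrite pE bopZ tsZr.
Qed.

Lemma multiplication_linear : linear_set Mell.
Proof. by rewrite multiplicationE. Qed.

Lemma multiplication_sym : symmetric_graph Mell.
Proof.
rewrite multiplicationE => p Sp u v Suv; move: p Sp.
apply: (@span_min _ _ _ [set p | inner v p.1 = inner u p.2]) => [|_ [x [w ->]] /=].
  split=> [|a q r /= hq hr]; first by rewrite /= !inner0r.
  by rewrite !innerDr !innerZr hq hr.
apply: (@span_min _ _ _ [set q | inner q.2 (ts_map LV (delta x) w) =
  inner q.1 (ts_map LV (delta x) (ell x w))] _ _ (u, v) Suv).
  split=> [|a q r /= hq hr]; first by rewrite /= !inner0l.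
  by rewrite !innerDl !innerZl hq hr.
move=> _ [y [z ->]] /=; rewrite !ts_inner l2_orthonormal.
have [->|_] := eqVneq y x; last by rewrite !mul0r.
by rewrite badjE -[badj _]/(star _) ell_sa.
Qed.

Lemma eigenvalue_spectrum (T : bop V) (t : R) v :
  T v = t%:C *: v -> v <> 0 -> spectrum T t%:C.
Proof.
move=> Tv v0 [b [_ h]]; apply: v0.
have := congr1 (fun X : bop V => X v) h; rewrite /cmul/= => <-.
by rewrite -[T v + _]/((T - t%:C *: (cone : bop V)) v) bsubE Tv subrr bop0x.
Qed.

Lemma multiplication_eigenbasis :
  exists (I : choiceType) (e : I -> LV) (t : I -> R), eigenbasis Mell e t.
Proof.
have [n [f [fo fV]]] := finite_orthonormal_basis finV.
have /choice[e /choice[t et]] : forall x, exists (e : 'I_n -> V) (t : 'I_n -> R),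
    [/\ forall i j, inner (e i) (e j) = (i == j)%:R, forall v, span (range e) v &
        forall k, ell x (e k) = (t k)%:C *: e k].
  by move=> x; apply: (finite_diagonalization fo fV).
exists (G * 'I_n)%type, (fun p => ts_map LV (delta p.1) (e p.1 p.2)), (fun p => t p.1 p.2).
split; first split.
- move=> [x i] [y j] /=; rewrite ts_inner l2_orthonormal xpair_eqE.
  have [<-|_] := eqVneq x y; last by rewrite mul0r.
  by have [-> _ _] := et x; rewrite mul1r.
- apply: dense_span_mono
    (@ts_total _ _ _ LV _ _ (@delta_dense _ _ l2) (@dense_spanT _ V)).
  move=> _ [_ [v [[x _ <-] _ ->]]].
  have [_ eV _] := et x.
  apply: (span_image (ts_linearr LV (delta x)) (span_linear _) _ (eV v)) => _ [i _ <-].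
  by apply: sub_span; exists (x, i).
- move=> [x i] /=; rewrite multiplicationE; apply: sub_span; exists x, (e x i).
  by have [_ _ ->] := et x; rewrite tsZr.
- move=> b; have [_ pfin xfin] := ell_proper.
  have sp x i : spectrum (ell x) (t x i)%:C.
    have [eo _ te] := et x; apply: eigenvalue_spectrum (te i) _ => e0.
    by have /eqP := eo i i; rewrite e0 inner0l eqxx eq_sym oner_eq0.
  pose T := [set r : R | [/\ - b <= r, r <= b & exists x, spectrum (ell x) r%:C]].
  (* Properness is used twice: [-b, b] contains finitely many spectral values, and each occurs at
     finitely many x. The index in 'I_n bounds the multiplicity. *)
  have Xfin : finite_set (\bigcup_(r in T) [set x | spectrum (ell x) r%:C]).
    by apply: bigcup_finite; [exact: pfin|move=> r [_ _]; exact: xfin].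
  apply: sub_finite_set (finite_setX Xfin (@finite_finset 'I_n setT)) => -[x i] /=.
  rewrite ler_norml => /andP[h1 h2]; split=> //; exists (t x i); last exact: sp.
  by split=> //; exists x.
Qed.

Lemma length_self_adjoint : self_adjoint (closure Mell).
Proof.
have [I [e [t et]]] := multiplication_eigenbasis.
exact: (eigenbasis_self_adjoint multiplication_linear multiplication_sym et).
Qed.

Lemma length_compact_resolvent : compact_resolvent (closure Mell).
Proof.
have [I [e [t et]]] := multiplication_eigenbasis.
exact: (eigenbasis_compact_resolvent multiplication_linear et).
Qed.

(** The commutator of M_ell with lambda_g is lambda_g B, where B has the block ell(g x) - ell(x)
    over x; these blocks are uniformly bounded by translation boundedness at g x. *)
Lemma translation_commutes g : exists C,
  commutes_mod Mell (optens LV (lambda g) cone) C.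
Proof.
have [M ME] := ell_tb g.
have bM x : bnorm (ell (g * x)%g - ell x) <= complex.Re M.
  have h : (bnorm (ell (g * x)%g - ell x))%:C <= M.
    by have := ME (g * x)%g; rewrite mulKg.
  by move: h; rewrite lecE => /andP[].
have M0 : 0 <= complex.Re M by apply: le_trans (bM 1%g); exact: bnorm_ge0.
have [B BE] := block_bop (ts_swap LV) M0 bM.
have {}BE v x : B (ts_map LV (delta x) v) = ts_map LV (delta x) ((ell (g * x)%g - ell x) v).
  exact: BE.
exists (optens LV (lambda g) cone ** B); rewrite multiplicationE.
apply: commutes_mod_span => _ _ [x [v [-> ->]]]; apply: sub_span.
exists (g * x)%g, v; rewrite /cmul/= BE !optensE left_translationE -tsDr.
by congr (_, ts_map LV _ _); rewrite bsubE addrC subrK.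
Qed.

Lemma group_algebra_commutes c : group_algebra c -> exists C,
  commutes_mod (closure Mell) (optens LV c cone) C.
Proof.
rewrite group_algebraE; move: c; have Ml := multiplication_linear.
apply: (@span_min _ _ _ [set c | exists C, commutes_mod (closure Mell) (optens LV c cone) C]).
  split=> /= [|a b c [B hB] [C hC]].
    have -> : optens LV 0 cone = 0 by exact: (linear_fun0 (optens_linearl LV cone)).
    by exists 0; exact: commutes_mod0 (closure_linear Ml).
  exists (a *: B + C); rewrite (optens_linearl LV cone a b c).
  by apply: commutes_modD => //; exact: closure_linear.
move=> _ [g _ <-]; have [C hC] := translation_commutes g.
by exists C; exact: commutes_mod_closure.
Qed.

Lemma star_hom_sub (E F : cstarType R) (S : set E) (f : E -> F) :
  star_hom setT f -> star_hom S f.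
Proof. by move=> [f1 fl fM fs]; split=> // *; [exact: fl|exact: fM|exact: fs]. Qed.

Lemma length_spectral_triple : spectral_triple (length_triple ell LV).
Proof.
have gs := @group_algebra_star_subalgebra _ _ l2; split.
- split; first exact: closure_star_subalgebra.
  by split=> //; exact: subset_closure.
- exact: star_hom_sub (optensl_star_hom LV).
- exact: length_self_adjoint.
- exact: length_compact_resolvent.
- move=> c /group_algebra_commutes[C hC].
  exact: commutes_mod_bounded length_self_adjoint hC.
Qed.

End LengthTriple.

Section EquivariantTriple.
Variables (R : realType) (A : cstarType R) (G : groupType).
Variables (rho : G -> A -> A) (sigma : G -> G -> A) (H : hilbertType R).
Variables (A0 : set A) (D : set (H * H)) (pi : A -> bop H) (U : G -> bop H).
Hypotheses (sys : twisted_system rho sigma) (smooth : smooth_system rho sigma A0)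
  (equiv : equivariant_spectral_triple rho sigma A0 D pi U).

Lemma equivariant_covariant : twisted_covariant rho sigma pi U.
Proof. by case: equiv. Qed.

Lemma equivariant_self_adjoint : self_adjoint D.
Proof. by case: equiv => -[]. Qed.

Lemma equivariant_compact_resolvent : compact_resolvent D.
Proof. by case: equiv => -[]. Qed.

Lemma smooth_star_subalgebra : star_subalgebra A0.
Proof. by case: equiv => -[[_ []]]. Qed.

Lemma smooth_dense a : closure A0 a.
Proof. by case: equiv => -[[_ [_ _]]] h _ _ _ _ _ _; exact: h. Qed.

Lemma smooth_rho x a : A0 a -> A0 (rho x a).
Proof. by move=> A0a; rewrite -(proj1 smooth x); exists a. Qed.

Lemma smooth_sigma x y : A0 (sigma x y).
Proof. exact: (proj2 smooth). Qed.

(** On generators, [D, pi(a) U_x] = pi(a) [D, U_x] + [D, pi(a)] U_x, both commutators being bounded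
    by equivariance. *)
Lemma integrated_commutes T : (integrated pi U @` Cc A0) T -> exists C, commutes_mod D T C.
Proof.
have Dsa := equivariant_self_adjoint; have Dl := self_adjoint_linear Dsa.
have A0l := star_subalgebra_linear smooth_star_subalgebra.
have cov := equivariant_covariant.
move=> [f fA <-]; move: f fA; apply: Cc_ind => [||a x f A0a fA [C fC]].
- exact: (proj1 A0l).
- by exists 0; rewrite (integrated0 cov); exact: commutes_mod0.
have [st _ hU] := equiv; have [_ _ _ _ ha] := st.
have [Ca aC] := bounded_commutes_mod Dsa (ha a A0a).
have [Cx xC] := bounded_commutes_mod Dsa (hU x).
rewrite (integratedD cov); last exact: Cc_mono fA; last exact: CcT_single.
rewrite (integrated_single cov).
exists (1 *: (pi a ** Cx + Ca ** U x) + C).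
rewrite -[pi a ** U x]scale1r; apply: commutes_modD => //.
exact: commutes_modM.
Qed.

Lemma image_spectral_triple : spectral_triple (image_triple rho sigma A0 D pi U).
Proof.
have IR := integrated_Cc_representation sys equivariant_covariant.
split.
- split; first exact: full_image_star_subalgebra sys _ _ IR.
  exact: (Cc_image_dense sys IR smooth_star_subalgebra smooth_rho smooth_sigma smooth_dense).
- by [].
- exact: equivariant_self_adjoint.
- exact: equivariant_compact_resolvent.
- move=> T /integrated_commutes[C hC].
  exact: commutes_mod_bounded equivariant_self_adjoint hC.
Qed.

End EquivariantTriple.

(** * The comparison *)

Section AlgTensor.
Variables (R : realType) (H K : hilbertType R) (t : tensor_space H K).
Implicit Types (A : set (bop H)) (B : set (bop K)).

Lemma alg_tensorE A B : linear_set A ->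
  @alg_tensor _ _ _ t A B = span [set T | exists a b, [/\ A a, B b & T = optens t a b]].
Proof.
move=> Al; apply/seteqP; split=> [T [n [a [b [Aa Bb ->]]]]|_ [n [c [f [fE ->]]]]].
  apply: linear_set_sum => // i _.
  by apply: sub_span; exists (a i), (b i).
have /choice[a /choice[b ab]] := fE.
exists n, (fun i => c i *: a i), b; split=> [i|i|].
- by apply: linear_setZ => //; have [] := ab i.
- by have [] := ab i.
- apply: eq_bigr => i _; have [_ _ ->] := ab i.
  by rewrite (linear_funZ (f := fun a => optens t a (b i)) _ _ (optens_linearl t (b i))).
Qed.

Lemma alg_tensor_star_subalgebra A B : star_subalgebra A -> star_subalgebra B ->
  star_subalgebra (@alg_tensor _ _ _ t A B).
Proof.
move=> As Bs; rewrite alg_tensorE; last exact: star_subalgebra_linear.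
have [A1 _ AM Ast] := As; have [B1 _ BM Bst] := Bs.
apply: span_star_subalgebra.
- by exists cone, cone; rewrite optens1.
- move=> _ _ [a [b [Aa Bb ->]]] [c [d [Ac Bd ->]]]; rewrite optensM.
  by apply: sub_span; exists (a ** c), (b ** d); split=> //; [exact: AM|exact: BM].
- move=> _ [a [b [Aa Bb ->]]]; rewrite optens_star.
  by apply: sub_span; exists (star a), (star b); split=> //; [exact: Ast|exact: Bst].
Qed.

(** Each factor is approximated in turn with the other fixed, since a (x) b depends on each of them
    by a bounded linear map. *)
Lemma alg_tensor_closure A0 A B0 B : linear_set A0 -> linear_set A ->
  A `<=` closure A0 -> B `<=` closure B0 ->
  @alg_tensor _ _ _ t A B `<=` closure (@alg_tensor _ _ _ t A0 B0).
Proof.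
move=> A0l Al AA BB; rewrite !alg_tensorE//; apply: span_min.
  exact/closure_linear/span_linear.
move=> _ [a [b [Aa Bb ->]]]; set T := [set T | _].
apply: (bounded_closure_mem (S := B0) (f := optens t a) (M := bnorm a)) (BB b Bb).
- exact: optens_linearr.
- by move=> x; rewrite !rnorm_bop; exact: bnorm_optens.
- move=> y B0y.
  apply: (bounded_closure_mem (S := A0) (f := fun a => optens t a y) (M := bnorm y)) (AA a Aa).
  + exact: optens_linearl.
  + by move=> x; rewrite !rnorm_bop mulrC; exact: bnorm_optens.
  + by move=> x A0x; apply: subset_closure; apply: sub_span; exists x, y.
Qed.

End AlgTensor.

(** The formulas for two copies are stated on pairs of generators. As 0 is in [E], they cover (x, 0)
    and (0, y), and each summand is then treated by totality. *)
Lemma eq_bop_hsum R (H : hilbertType R) (E : set H) (S T : bop (hsum H H)) :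
  E 0 -> dense (span E) ->
  (forall x y, E x -> E y -> S (x, y) = T (x, y)) -> S = T.
Proof.
move=> E0 Ed ST.
have lin (X : bop (hsum H H)) (i : H -> hsum H H) : linear i -> linear (fun x => X (i x)).
  by move=> il a x y; rewrite il bop_linear.
have bd (X : bop (hsum H H)) (i : H -> hsum H H) : (forall x, rnorm (i x) <= 1 * rnorm x) ->
    forall x, rnorm (X (i x)) <= bnorm X * rnorm x.
  move=> ib x; apply: le_trans (le_bnorm _ _) _.
  by rewrite ler_wpM2l// -[leRHS]mul1r ib.
apply: bopP => -[x y]; rewrite hsum_split.
rewrite !bopD; congr (_ + _).
  apply: (eq_bounded (lin S _ (@hsum_inl_linear _ _)) (lin T _ (@hsum_inl_linear _ _))
    (bd S _ (@rnorm_hsum_inl _ _)) (bd T _ (@rnorm_hsum_inl _ _)) Ed) => u Eu.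
  by apply: ST.
apply: (eq_bounded (lin S _ (@hsum_inr_linear _ _)) (lin T _ (@hsum_inr_linear _ _))
  (bd S _ (@rnorm_hsum_inr _ _)) (bd T _ (@rnorm_hsum_inr _ _)) Ed) => u Eu.
by apply: ST.
Qed.

Section Comparison.
Variables (R : realType) (A : cstarType R) (G : groupType).
Variables (rho : G -> A -> A) (sigma : G -> G -> A).
Variables (H V : hilbertType R) (A0 : set A) (D : set (H * H)).
Variables (pi : A -> bop H) (U : G -> bop H) (ell : G -> bop V).
Variables (l2 : l2_space R G) (L : tensor_space H l2) (LV : tensor_space l2 V).
Variable W : tensor_space H LV.
Hypotheses (sys : twisted_system rho sigma) (smooth : smooth_system rho sigma A0)
  (equiv : equivariant_spectral_triple rho sigma A0 D pi U)
  (finV : finite_dimensional V) (ell_sa : forall x, star (ell x) = ell x)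
  (ell_tb : translation_bounded ell) (ell_proper : proper_function ell).

Local Notation delta := (l2_delta l2).
Local Notation lambda := (left_translation l2).
Local Notation single := (@single R A G).
Local Notation Lambda := (regular rho sigma L pi).
Local Notation Ared := (reduced_crossed_product rho sigma L pi).
Local Notation Bfull := (full_image rho sigma (integrated pi U)).
Local Notation Bsmooth := (integrated pi U @` Cc A0).
Local Notation tB := (image_triple rho sigma A0 D pi U).
Local Notation tG := (length_triple ell LV).
Local Notation Cr := (@reduced_group_algebra R G l2).
Local Notation CG := (@group_algebra R G l2).
Local Notation tensor_alg := (@min_tensor _ _ _ L Bfull Cr).
Local Notation smooth_alg := (@alg_tensor _ _ _ L Bsmooth CG).
Local Notation Dext := (product_operator W D (closure (multiplication ell LV))).
Local Notation psiA := (is_psiA rho sigma pi U).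
Local Notation construction := (equivariant_construction rho sigma A0 D pi U ell).
Local Notation ampW := (@amp R H l2 V L LV W).
Implicit Types (psi : bop L -> bop L) (s t : triple (bop L) (hsum W W)).

Let cov := equivariant_covariant equiv.
Let Dsa := equivariant_self_adjoint equiv.
Let Dl := self_adjoint_linear Dsa.
Let IR := integrated_Cc_representation sys cov.
Let A0s := smooth_star_subalgebra equiv.
Let A0rho := smooth_rho smooth.
Let A0sigma := smooth_sigma smooth.
Let A0d := smooth_dense equiv.
Let Bfs : star_subalgebra Bfull := full_image_star_subalgebra sys IR.
Let Bss : star_subalgebra Bsmooth := Cc_image_star_subalgebra sys IR A0s A0rho A0sigma.
Let CGs : star_subalgebra CG := @group_algebra_star_subalgebra R G l2.
Let Crs : star_subalgebra Cr := closure_star_subalgebra CGs.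
Let Bfl := star_subalgebra_linear Bfs.
Let Bsl := star_subalgebra_linear Bss.
Let TG : spectral_triple tG := length_spectral_triple LV finV ell_sa ell_tb ell_proper.
Let Ml := multiplication_linear ell LV.

Lemma tensor_alg_star : star_subalgebra tensor_alg.
Proof. exact/closure_star_subalgebra/alg_tensor_star_subalgebra. Qed.

Lemma smooth_alg_sub : smooth_alg `<=` @alg_tensor _ _ _ L Bfull Cr.
Proof.
move=> T [n [a [b [h1 h2 ->]]]]; exists n, a, b; split=> // i.
  exact: (Cc_image_sub rho sigma (h1 i)).
exact: subset_closure.
Qed.

Lemma smooth_alg_dense : dense_star_subalgebra smooth_alg tensor_alg.
Proof.
split; first exact: alg_tensor_star_subalgebra.
- exact: subset_trans smooth_alg_sub (@subset_closure _ _).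
- rewrite [X in _ `<=` X](proj1 (closure_id _) (@closed_closure _ _)).
  apply: closure_subset; apply: alg_tensor_closure => //.
  exact: (full_image_closure sys IR A0s A0d).
Qed.

Lemma product_self_adjoint : self_adjoint Dext.
Proof.
have [I [e [s es]]] := eigenbasis_ex Dsa (equivariant_compact_resolvent equiv).
have [J [f [r fr]]] := multiplication_eigenbasis LV finV ell_sa ell_proper.
rewrite product_operator_closure//.
apply: (product_operator_self_adjoint W es fr Dl).
  by move=> p; rewrite {1}(proj2 Dsa).
exact: multiplication_sym.
Qed.

Lemma product_compact_resolvent :
  compact_resolvent Dext.
Proof.
have [I [e [s es]]] := eigenbasis_ex Dsa (equivariant_compact_resolvent equiv).
have [J [f [r fr]]] := multiplication_eigenbasis LV finV ell_sa ell_proper.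
rewrite product_operator_closure//.
exact: (product_operator_compact_resolvent W es fr Dl).
Qed.

Lemma dbl_amp_star_hom S : star_hom S (fun T : bop L => dbl (ampW T)).
Proof.
have [a1 al aM as_] := @amp_star_hom R H l2 V L LV W; split=> [|k a b _ _|a b _ _|a _].
- by rewrite a1 dbl1.
- by rewrite al// dbl_linear.
- by rewrite aM// dblM.
- by rewrite as_// dbl_star.
Qed.

Lemma dbl_amp_linear : linear (fun T : bop L => dbl (ampW T)).
Proof. by move=> k a b; rewrite amp_linear dbl_linear. Qed.

Lemma dbl_amp_bound (T : bop L) : rnorm (dbl (ampW T)) <= 2 * rnorm T.
Proof.
rewrite !rnorm_bop; apply: le_trans (bnorm_dbl _) _.
by rewrite ler_wpM2l// bnorm_amp.
Qed.

Lemma dbl_amp_continuous S : {within S, continuous (fun T : bop L => dbl (ampW T))}.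
Proof. exact: bounded_within dbl_amp_linear dbl_amp_bound. Qed.

Lemma exterior_rep t : exterior_product tB tG t ->
  forall T, tensor_alg T -> st_rep t T = dbl (ampW T).
Proof.
move=> [eA _ _ [th tc] tE]; rewrite eA in th tc.
apply: (within_eq (P := @alg_tensor _ _ _ L Bfull Cr)) => //.
- exact: dbl_amp_continuous.
- exact: subset_closure.
have gen a b : Bfull a -> Cr b -> st_rep t (optens L a b) = dbl (ampW (optens L a b)).
  move=> Ba Cb; apply: (@eq_bop_hsum _ _ (@elementary _ _ _ W)).
  - by exists 0, 0; rewrite ts0l.
  - exact: elementary_dense.
  - by move=> _ _ [x [y ->]] [x' [y' ->]]; rewrite dblE amp_optens !optensE tE.
rewrite alg_tensorE//; have [_ tl _ _] := th.
have genS T : (exists a b, [/\ Bfull a, Cr b & T = optens L a b]) -> tensor_alg T.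
  move=> [a [b [Ba Cb ->]]]; apply: subset_closure; rewrite alg_tensorE//.
  by apply: sub_span; exists a, b.
have Tl := star_subalgebra_linear tensor_alg_star.
(* Membership in the algebra is carried through the induction, because linearity of [st_rep t] is
   available only there. *)
suff : span [set T | exists a b, [/\ Bfull a, Cr b & T = optens L a b]] `<=`
    [set T | tensor_alg T /\ st_rep t T = dbl (ampW T)] by move=> h T /h[].
apply: span_min => [|T [a [b [Ba Cb ->]]]]; last first.
  by split; [apply: genS; exists a, b|exact: gen].
split=> [|k x y [Tx xE] [Ty yE]] /=.
  split; first exact: (proj1 Tl).
  by rewrite (star_hom0 th (proj1 Tl)) (linear_fun0 dbl_amp_linear).
by split; [exact: (proj2 Tl)|rewrite tl// xE yE dbl_amp_linear].
Qed.

Lemma smooth_alg_commutes T : smooth_alg T -> exists C,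
  commutes_mod Dext (dbl (ampW T)) C.
Proof.
have Pl := self_adjoint_linear product_self_adjoint.
rewrite [X in X _ -> _]alg_tensorE//; move: T.
apply: (@span_min _ _ _ [set T | exists C,
  commutes_mod Dext (dbl (ampW T)) C]).
  split=> /= [|k a b [B hB] [C hC]].
    by exists 0; rewrite (linear_fun0 dbl_amp_linear); exact: commutes_mod0.
  by exists (k *: B + C); rewrite dbl_amp_linear; exact: commutes_modD.
move=> _ [a [b [Ba Gb ->]]] /=; rewrite amp_optens.
have [Ca aC] := integrated_commutes equiv Ba.
have [Cb bC] := group_algebra_commutes LV ell_tb Gb.
by eexists; exact: (product_commutes Dl aC bC).
Qed.

Lemma exterior_spectral_triple t : exterior_product tB tG t -> spectral_triple t.
Proof.
move=> tP; have tR := exterior_rep tP; have [eA eS eO [th tc] tE] := tP.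
split.
- by rewrite eA eS; split; [exact: tensor_alg_star|exact: smooth_alg_dense].
- exact: th.
- rewrite eO; exact: product_self_adjoint.
- rewrite eO; exact: product_compact_resolvent.
- rewrite eS eO => T ST; rewrite tR; last by case: smooth_alg_dense => _ h _; exact: h.
  have [C hC] := smooth_alg_commutes ST.
  exact: commutes_mod_bounded product_self_adjoint hC.
Qed.

Lemma standard_grading_linear : linear (standard_grading W).
Proof.
by move=> a x y; apply: injective_projections; rewrite //= opprD scalerN.
Qed.

Lemma standard_gradingK : involutive (standard_grading W).
Proof. by move=> x; apply: injective_projections; rewrite //= opprK. Qed.

Lemma standard_grading_inner x y :
  inner (standard_grading W x) (standard_grading W y) = inner x y.
Proof. by rewrite !hsum_inner_def /= innerNl innerNr opprK. Qed.

Lemma dbl_standard_grading (T : bop W) x :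
  dbl T (standard_grading W x) = standard_grading W (dbl T x).
Proof. by rewrite !dblE /standard_grading /= bopN. Qed.

Lemma exterior_even t : exterior_product tB tG t ->
  even_spectral_triple t (standard_grading W).
Proof.
move=> tP; have tR := exterior_rep tP; have [eA eS eO _ _] := tP; split.
- exact: exterior_spectral_triple.
- by split; [exact: standard_grading_linear|exact: standard_gradingK].
- exact: standard_grading_inner.
- by move=> T x; rewrite eA => TT; rewrite tR// dbl_standard_grading.
- by move=> x y; rewrite eO; exact: product_operator_odd.
Qed.

Section WithUntwisting.
Variable Vt : bop L.
Hypotheses (VV : star Vt ** Vt = cone) (VV' : Vt ** star Vt = cone)
  (VE : forall xi y, Vt (ts_map L xi (delta y)) = ts_map L (star (U y^-1%g) xi) (delta y))
  (V'E : forall xi y, star Vt (ts_map L xi (delta y)) = ts_map L (U y^-1%g xi) (delta y)).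

Let LR : Cc_representation rho sigma Lambda := regular_Cc_representation sys cov VV VV' VE V'E.
Let psi0 : bop L -> bop L := untwist Vt.
Let psi0_single a g : psi0 (Lambda (single a g)) = optens L (pi a ** U g) (lambda g).
Proof. exact: (untwist_single cov VV VV' VE V'E). Qed.
Let psi0h : star_hom setT psi0 := untwist_star_hom VV VV'.

Let psi0_linear : linear psi0.
Proof. by have [_ h _ _] := psi0h => k a b; exact: h. Qed.

Let psi0_bound T : rnorm (psi0 T) <= 1 * rnorm T.
Proof. by rewrite mul1r rnorm_bop; exact: (star_hom_contractive T psi0h). Qed.

Let Ared_star : star_subalgebra Ared := full_image_star_subalgebra sys LR.
Let Al := star_subalgebra_linear Ared_star.

Lemma reduced_dense : dense_star_subalgebra (Lambda @` Cc A0) Ared.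
Proof. exact: (Cc_image_dense sys LR A0s A0rho A0sigma A0d). Qed.

Lemma reduced_denseT : Ared `<=` closure (Lambda @` Cc setT).
Proof.
by apply: (full_image_closure sys LR) => // a; exact: subset_closure.
Qed.

(** Uniqueness for maps specified only on a delta_h, used both for psi_A and for the representation
    of the equivariant construction. *)
Lemma reduced_rep_eq (K : hilbertType R) (f g : bop L -> bop K) :
  star_hom Ared f -> star_hom Ared g ->
  {within Ared, continuous f} -> {within Ared, continuous g} ->
  (forall a h, f (Lambda (single a h)) = g (Lambda (single a h))) ->
  forall T, Ared T -> f T = g T.
Proof.
move=> fh gh fc gc fg.
have sub : Lambda @` Cc setT `<=` Ared by exact: Cc_image_sub.
apply: (within_eq fc gc sub reduced_denseT) => _ [u uC <-]; move: u uC.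
apply: Cc_ind => [//||a x u _ uC IH].
  by rewrite (Cc_rep0 LR) (star_hom0 fh (proj1 Al)) (star_hom0 gh (proj1 Al)).
have Sx : Cc setT (single a x) by exact: CcT_single.
have A1 : Ared (Lambda (single a x)) by apply: sub; exists (single a x).
have A2 : Ared (Lambda u) by apply: sub; exists u.
rewrite (Cc_repD LR Sx uC) -[Lambda (single a x)]scale1r.
have [_ fl _ _] := fh; have [_ gl _ _] := gh.
by rewrite fl// gl// fg IH.
Qed.

Lemma is_psiA_untwist : psiA psi0.
Proof.
split; first exact: star_hom_sub psi0h.
- exact: bounded_within psi0_linear psi0_bound.
- exact: psi0_single.
Qed.

Lemma psiA_eq psi : psiA psi -> forall T, Ared T -> psi T = psi0 T.
Proof.
move=> [ph pc pE]; have [qh qc qE] := is_psiA_untwist.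
by apply: reduced_rep_eq => // a h; rewrite pE qE.
Qed.

Let s0 : bop L -> bop (hsum W W) := fun T => dbl (ampW (psi0 T)).

Let s0h : star_hom setT s0.
Proof.
have [a1 al aM as_] := dbl_amp_star_hom setT; have [p1 pl pM ps] := psi0h.
split=> [|k a b _ _|a b _ _|a _]; rewrite /s0.
- by rewrite p1 a1.
- by rewrite pl// al.
- by rewrite pM// aM.
- by rewrite ps// as_.
Qed.

Let s0c S : {within S, continuous s0}.
Proof.
apply: (@bounded_within _ _ _ _ _ 2) => [k a b|T].
  by rewrite /s0 psi0_linear dbl_amp_linear.
apply: le_trans (dbl_amp_bound _) _; rewrite ler_wpM2l//.
by have := psi0_bound T; rewrite mul1r.
Qed.

Let s0E a h xi x v xi' x' v' :
  s0 (Lambda (single a h))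
    (ts_map W xi (ts_map LV (delta x) v), ts_map W xi' (ts_map LV (delta x') v')) =
  (ts_map W ((pi a ** U h) xi) (ts_map LV (delta (h * x)%g) v),
   ts_map W ((pi a ** U h) xi') (ts_map LV (delta (h * x')%g) v')).
Proof. by rewrite /s0 psi0_single dblE amp_optens !optensE !left_translationE. Qed.

Lemma equivariant_construction_ex : exists s,
  construction s.
Proof.
exists (Triple Ared (Lambda @` Cc A0) (product_operator W D (multiplication ell LV)) s0).
split=> //; split; first exact: star_hom_sub s0h.
exact: (@s0c Ared).
Qed.

Lemma delta_triple_dense : dense (span [set z : W | exists xi x v,
  z = ts_map W xi (ts_map LV (delta x) v)]).
Proof.
have Ld := @ts_total _ _ _ LV _ _ (@delta_dense _ _ l2) (@dense_spanT _ V).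
apply: dense_span_mono (@ts_total _ _ _ W _ _ (@dense_spanT _ _) Ld).
move=> _ [xi [_ [_ [_ [v [[x _ <-] _ ->]]] ->]]].
by apply: sub_span; exists xi, x, v.
Qed.

Lemma equivariant_rep s : construction s ->
  forall T, Ared T -> st_rep s T = s0 T.
Proof.
move=> [_ _ _ [sh sc] sE]; apply: reduced_rep_eq => //.
- exact: star_hom_sub s0h.
- move=> a h; apply: (@eq_bop_hsum _ _ [set z : W | exists xi x v,
    z = ts_map W xi (ts_map LV (delta x) v)]).
  + by exists 0, 1%g, 0; rewrite ts0l.
  + exact: delta_triple_dense.
  + by move=> _ _ [xi [x [v ->]]] [xi' [x' [v' ->]]]; rewrite sE s0E.
Qed.

(** A generator a delta_x goes to the elementary tensor pi(a) U_x (x) lambda_x, so finitely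
    supported functions stay in the algebraic tensor product, before any completion. *)
Lemma untwist_smooth (S : set A) f : linear_set S -> Cc S f ->
  @alg_tensor _ _ _ L (integrated pi U @` Cc S) CG (psi0 (Lambda f)).
Proof.
move=> Sl; have il : linear_set (integrated pi U @` Cc S).
  split; first by exists (fun=> 0); [apply: Cc0; exact: (proj1 Sl)|exact: (integrated0 cov)].
  move=> k _ _ [g gS <-] [h hS <-]; exists (fun x => k *: g x + h x); first exact: Cc_linear.
  by rewrite (integrated_linear cov)//; [exact: Cc_mono gS|exact: Cc_mono hS].
rewrite alg_tensorE//; set E := [set T | _]; have El := span_linear E.
move: f; apply: Cc_ind => [||a x f Sa fS IH]; first exact: (proj1 Sl).
  by rewrite (Cc_rep0 LR) (star_hom0 psi0h)//; exact: (proj1 El).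
have Sx : Cc S (single a x) by apply: Cc_single => //; exact: (proj1 Sl).
rewrite (Cc_repD LR (Cc_mono Sx) (Cc_mono fS)) (star_homD _ _ psi0h) psi0_single.
apply: linear_setD => //; apply: sub_span; exists (pi a ** U x), (lambda x); split=> //.
  by exists (single a x) => //; exact: (integrated_single cov).
by rewrite group_algebraE; apply: sub_span; exists x.
Qed.

Lemma psiA_smooth psi f : psiA psi -> Cc A0 f -> smooth_alg (psi (Lambda f)).
Proof.
move=> pP fA; rewrite (psiA_eq pP); last by apply: Cc_image_sub; exists f => //; exact: Cc_mono fA.
exact: untwist_smooth (star_subalgebra_linear A0s) fA.
Qed.

Lemma psiA_tensor psi T : psiA psi -> Ared T -> tensor_alg (psi T).
Proof.
move=> pP AT; rewrite (psiA_eq pP)//; have [_ sub cl] := smooth_alg_dense.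
apply: (within_closure (S := Ared) (P := Lambda @` Cc A0)) => //.
- exact: bounded_within psi0_linear psi0_bound.
- by case: reduced_dense.
- by case: reduced_dense.
- move=> _ [f fA <-]; apply: smooth_alg_sub.
  exact: untwist_smooth (star_subalgebra_linear A0s) fA.
Qed.

(** Both representations become two copies of psi(T) (x) 1_V, the two operators differ only by
    closing M_ell inside the product, and psi is injective because it is conjugation by a unitary on
    the reduced algebra. *)
Lemma psiA_restriction psi s t : psiA psi ->
  construction s -> exterior_product tB tG t ->
  restriction psi s t.
Proof.
move=> pP sP tP; have sR := equivariant_rep sP; have tR := exterior_rep tP.
have [sA sS sO _ _] := sP; have [tA tS tO _ _] := tP; have [ph _ _] := pP.
split; first split.
- rewrite sA tA; split=> // T AT; exact: psiA_tensor.
- rewrite sA sS; exact: reduced_dense.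
- by rewrite sS tS => _ [f fA <-]; exact: psiA_smooth.
- by rewrite sO tO product_operator_closure.
- rewrite sA => T AT; rewrite sR// tR ?(psiA_eq pP)//.
  by rewrite -(psiA_eq pP)//; exact: psiA_tensor.
- rewrite sA => a b Aa Ab; rewrite !(psiA_eq pP)//; exact: untwist_inj.
Qed.

(** The analysis is shared with the exterior product: the operator is the same, and the image of
    each generator lies in [smooth_alg], whose commutators are already known to be bounded. *)
Lemma equivariant_even s : construction s ->
  even_spectral_triple s (standard_grading W).
Proof.
move=> sP; have sR := equivariant_rep sP; have [sA sS sO [sh sc] _] := sP.
have PE := product_operator_closure W (multiplication ell LV) Dl.
split.
- split.
  + by rewrite sA sS; split; [exact: Ared_star|exact: reduced_dense].
  + by rewrite sA.
  + by rewrite sO -PE; exact: product_self_adjoint.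
  + by rewrite sO -PE; exact: product_compact_resolvent.
  + rewrite sS sO -PE => _ [f fA <-]; rewrite sR; last first.
      by apply: Cc_image_sub; exists f => //; exact: Cc_mono fA.
    have /smooth_alg_commutes[C hC] : smooth_alg (psi0 (Lambda f)).
      exact: untwist_smooth (star_subalgebra_linear A0s) fA.
    exact: commutes_mod_bounded product_self_adjoint hC.
- by split; [exact: standard_grading_linear|exact: standard_gradingK].
- exact: standard_grading_inner.
- by move=> T x; rewrite sA => AT; rewrite sR// dbl_standard_grading.
- by move=> x y; rewrite sO; exact: product_operator_odd.
Qed.

End WithUntwisting.

Lemma exterior_product_ex : exists t, exterior_product tB tG t.
Proof.
exists (Triple tensor_alg smooth_alg
  Dext (fun T => dbl (ampW T))).
split=> //.
- by split; [exact: dbl_amp_star_hom|exact: dbl_amp_continuous].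
- by move=> a b x y x' y' _ _; rewrite dblE amp_optens !optensE.
Qed.

End Comparison.

Theorem proposition3p11 (R : realType) (A : cstarType R) (G : groupType)
  (rho : G -> A -> A) (sigma : G -> G -> A)
  (H V : hilbertType R) (A0 : set A) (D : set (H * H))
  (pi : A -> bop H) (U : G -> bop H) (ell : G -> bop V)
  (l2 : l2_space R G) (L : tensor_space H l2) (LV : tensor_space l2 V)
  (W : tensor_space H LV)
  (sepA : separable_space A) (sepH : separable_space H) (cntG : countable [set: G])
  (sys : twisted_system rho sigma) (smooth : smooth_system rho sigma A0)
  (pi_faithful : injective pi)
  (equiv : equivariant_spectral_triple rho sigma A0 D pi U)
  (finV : finite_dimensional V)
  (ell_sa : forall x, star (ell x) = ell x)
  (ell_tb : translation_bounded ell) (ell_proper : proper_function ell) :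
  let tB := image_triple rho sigma A0 D pi U in
  let tG := length_triple ell LV in
  [/\ spectral_triple tB,
      spectral_triple tG,
      exists psi : bop L -> bop L, is_psiA rho sigma pi U psi,
      (exists s : triple (bop L) (hsum W W),
          equivariant_construction rho sigma A0 D pi U ell s) /\
        (exists t : triple (bop L) (hsum W W), exterior_product tB tG t) &
      forall (psi : bop L -> bop L) (s t : triple (bop L) (hsum W W)),
        is_psiA rho sigma pi U psi ->
        equivariant_construction rho sigma A0 D pi U ell s ->
        exterior_product tB tG t ->
        [/\ even_spectral_triple t (standard_grading W),
            even_spectral_triple s (standard_grading W) &
            restriction psi s t]].
Proof.
move=> tB tG.
have cov := equivariant_covariant equiv.
have [Vt [VV VV' VE V'E]] := untwisting_ex L cov.
split.
- exact: (image_spectral_triple sys smooth equiv).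
- exact: (length_spectral_triple LV finV ell_sa ell_tb ell_proper).
- by exists (untwist Vt); exact: (is_psiA_untwist equiv VV VV' VE V'E).
- split; first exact: (equivariant_construction_ex ell W equiv VV VV' VE V'E).
  exact: exterior_product_ex.
- move=> psi s t pP sP tP; split.
  + exact: (exterior_even sys smooth equiv finV ell_sa ell_tb ell_proper tP).
  + exact: (equivariant_even sys smooth equiv finV ell_sa ell_tb ell_proper VV VV' VE V'E sP).
  + exact: (psiA_restriction sys smooth equiv VV VV' VE V'E pP sP tP).
Qed.
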